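(* $\mathcal{NMSO}_{\mathrm{ed}}=\mathcal{MREL}\circ\mathcal{DGSM}$ and $\mathcal{NMSO}_{\mathrm{nd}}=\mathcal{REL}\circ\mathcal{DGSM}_\varepsilon$.
   Context: Graphs over node alphabet $\Sigma$ and edge alphabet $\Gamma$ are triples $(V,E,\mathrm{lab})$, $E\subseteq V\times\Gamma\times V$, $\mathrm{lab}:V\to\Sigma$; $*$ denotes ''unlabelled''. $\mathrm{MSO}(\Sigma,\Gamma)$ is monadic second-order logic with node and node-set variables and atomic formulas $\mathrm{lab}_\sigma(x)$, $\mathrm{edge}_\gamma(x,y)$, $x=y$, $x\in X$. A nondeterministic mso definable graph transduction is given by a domain formula $\varphi_{\mathrm{dom}}$, a finite copy set $C$, node formulas $\varphi^c_\sigma(x)$ and edge formulas $\varphi^{c_1,c_2}_\gamma(x,y)$, all with common free node-set variables (parameters) $X_1,\dots,X_k$; for each input $g$ and each assignment of node sets of $g$ to the parameters satisfying $\varphi_{\mathrm{dom}}$, the output has nodes $(u,c)$ for which exactly one label $\sigma$ satisfies $\varphi^c_\sigma(u)$ (labelled $\sigma$) and edges $((u,c_1),\gamma,(v,c_2))$ between such nodes iff $\varphi^{c_1,c_2}_\gamma(u,v)$ holds; the transduction is the relation of all such pairs (input, output). String representations: for $w$ of length $k$, $\mathrm{nd}(w)$ has $k$ nodes labelled by the letters of $w$ and $k-1$ unlabelled successor edges; $\mathrm{ed}(w)$ has $k+1$ unlabelled nodes forming a path whose $k$ edges are labelled by the letters of $w$. $\mathcal{NMSO}_{\mathrm{nd}}$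 (resp. $\mathcal{NMSO}_{\mathrm{ed}}$) is the family of string transductions $m$ such that $\{(\mathrm{nd}(w),\mathrm{nd}(z))\mid(w,z)\in m\}$ (resp. with $\mathrm{ed}$) is a nondeterministic mso definable graph transduction. A 2gsm is $M=(Q,\Sigma_1,\Sigma_2,\delta,q_{in},q_f)$ with instructions $(p,\sigma,q_1,\alpha_1,\epsilon_1,q_0,\alpha_0,\epsilon_0)$, $p\neq q_f$, $\sigma\in\Sigma_1\cup\{\vdash,\dashv\}$, $\alpha_i\in\Sigma_2^*$, $\epsilon_i\in\{-1,0,+1\}$; on input $w$ the read-only tape is $\vdash w\dashv$ (positions $0..|w|+1$), start in $q_{in}$ at position 0; in state $p$ an instruction starting with $p$ is executed: if the scanned symbol is $\sigma$, go to $q_1$, append $\alpha_1$ to the output, move by $\epsilon_1$, else use $(q_0,\alpha_0,\epsilon_0)$; the head may not leave the tape. The realized relation consists of $(w,z)$ such that some computation reaches $q_f$ with output $z$. $M$ is deterministic if each state has at most one instruction. $\mathcal{DGSM}$: transductions realized by deterministic 2gsm's; $\mathcal{DGSM}_\varepsilon$: those $m\in\mathcal{DGSM}$ with $(\varepsilon,z)\in m\Rightarrow z=\varepsilon$. A string relabelling given by $R\subseteq\Delta_1\times\Delta_2$ maps $\sigma_1\cdots\sigma_n$ to all $\tau_1\cdots\tau_n$ with $\tau_i\in R(\sigma_i)$; $\mathcal{REL}$ is their family. A marked string relabelling maps $w$ to $\vdash w\dashv$ and then applies a string relabelling; $\mathcal{MREL}$ is their family. Composition: $R_1\circ R_2=\{(a,c)\mid\exists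 b:(a,b)\in R_1,(b,c)\in R_2\}$, extended to families elementwise. *)

(* Defs.v *)
From Stdlib Require Import List.
From mathcomp Require Import all_boot.
Set Implicit Arguments. Unset Strict Implicit. Unset Printing Implicit Defensive.

(* "unlabelled" ( * ) is modelled by the one-letter alphabet unit.      *)
Record graph (S G : Type) := Graph {
  gV : finType;
  gE : gV -> G -> gV -> bool;
  glab : gV -> S }.
Arguments gE {S G} g _ _ _.
Arguments glab {S G} g _.

Definition iso (S G : Type) (g h : graph S G) : Prop :=
  exists f : gV g -> gV h, bijective f /\
    (forall v, glab h (f v) = glab g v) /\
    (forall u c v, gE h (f u) c (f v) = gE g u c v).

Definition nd (S : Type) (w : seq S) : graph S unit :=
  @Graph S unit 'I_(size w)
    (fun i _ j => val j == (val i).+1)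
    (fun i => tnth (in_tuple w) i).

Definition ed (S : eqType) (w : seq S) : graph unit S :=
  @Graph unit S 'I_(size w).+1
    (fun i a j => (val j == (val i).+1) && (nth None (map Some w) (val i) == Some a))
    (fun _ => tt).
Arguments ed {S} w.

Inductive mso (S G : Type) :=
| FLab of S & nat
| FEdge of G & nat & nat
| FEq of nat & nat
| FIn of nat & nat
| FNot of mso S G
| FOr of mso S G & mso S G
| FEx1 of nat & mso S G
| FEx2 of nat & mso S G.

Definition upd (T : Type) (f : nat -> T) (n : nat) (a : T) : nat -> T :=
  fun m => if m == n then a else f m.

(* Satisfaction.  Node valuations are partial (nat -> option V) so that the
   empty graph is handled; an atomic formula mentioning an unassigned node
   variable is false. *)
Fixpoint sat (S : eqType) (G : Type) (g : graph S G)
    (nu : nat -> option (gV g)) (mu : nat -> {set gV g}) (f : mso S G) : bool :=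
  match f with
  | FLab s x => if nu x is Some v then glab g v == s else false
  | FEdge c x y => match nu x, nu y with
                   | Some u, Some v => gE g u c v | _, _ => false end
  | FEq x y => match nu x, nu y with
               | Some u, Some v => u == v | _, _ => false end
  | FIn x X => if nu x is Some v then v \in mu X else false
  | FNot f1 => ~~ sat nu mu f1
  | FOr f1 f2 => sat nu mu f1 || sat nu mu f2
  | FEx1 x f1 => [exists v, sat (upd nu x (Some v)) mu f1]
  | FEx2 X f1 => [exists A : {set gV g}, sat nu (upd mu X A) f1]
  end.

(* Parameters X_1..X_k are the set variables 0..k-1; in node formulas   *)
(* x is node variable 0, in edge formulas x, y are node variables 0, 1. *)
Record nmso (S1 G1 S2 G2 : Type) := NMso {
  nk : nat;
  ndom : mso S1 G1;
  nC : finType;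
  nnode : nC -> S2 -> mso S1 G1;
  nedge : nC -> nC -> G2 -> mso S1 G1 }.
Arguments nnode {S1 G1 S2 G2} n _ _.
Arguments nedge {S1 G1 S2 G2} n _ _ _.

Definition pval (V : finType) (k : nat) (X : 'I_k -> {set V}) : nat -> {set V} :=
  fun n => if @insub nat (fun n => n < k) 'I_k n is Some i then X i else set0.

Definition nv0 (V : Type) : nat -> option V := fun _ => None.
Definition nv1 (V : Type) (u : V) : nat -> option V :=
  fun n => if n == 0 then Some u else None.
Definition nv2 (V : Type) (u v : V) : nat -> option V :=
  fun n => if n == 0 then Some u else if n == 1 then Some v else None.

Definition out_node (S1 : eqType) (G1 : Type) (S2 : finType) (G2 : Type)
    (T : nmso S1 G1 S2 G2) (g : graph S1 G1) (X : 'I_(nk T) -> {set gV g})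
    (p : gV g * nC T) : bool :=
  #|[pred s : S2 | sat (nv1 p.1) (pval X) (nnode T p.2 s)]| == 1.

Definition is_output (S1 : eqType) (G1 : Type) (S2 : finType) (G2 : Type)
    (T : nmso S1 G1 S2 G2) (g : graph S1 G1) (X : 'I_(nk T) -> {set gV g})
    (h : graph S2 G2) : Prop :=
  exists f : {p : gV g * nC T | out_node X p} -> gV h,
    bijective f /\
    (forall p, sat (nv1 (val p).1) (pval X) (nnode T (val p).2 (glab h (f p)))) /\
    (forall p q c, gE h (f p) c (f q) =
       sat (nv2 (val p).1 (val q).1) (pval X) (nedge T (val p).2 (val q).2 c)).

Definition nmso_rel (S1 : eqType) (G1 : Type) (S2 : finType) (G2 : Type)
    (T : nmso S1 G1 S2 G2) (g : graph S1 G1) (h : graph S2 G2) : Prop :=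
  exists X : 'I_(nk T) -> {set gV g},
    sat (nv0 _) (pval X) (ndom T) /\ is_output X h.

Definition strans (A B : Type) := seq A -> seq B -> Prop.

Definition NMSO_nd (A B : finType) (m : strans A B) : Prop :=
  exists T : nmso A unit B unit, forall g h,
    nmso_rel T g h <-> exists w z, m w z /\ iso g (nd w) /\ iso h (nd z).

Definition NMSO_ed (A B : finType) (m : strans A B) : Prop :=
  exists T : nmso unit A unit B, forall g h,
    nmso_rel T g h <-> exists w z, m w z /\ iso g (ed w) /\ iso h (ed z).

Inductive tsym (A : Type) := LEnd | REnd | Sym of A.
Arguments LEnd {A}. Arguments REnd {A}.

Inductive move := MLeft | MStay | MRight.

Record gsm (A B : Type) := Gsm {
  gQ : finType;
  gdelta : seq (gQ * tsym A * (gQ * seq B * move) * (gQ * seq B * move));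
  gqin : gQ;
  gqf : gQ }.

Definition gsm_wf (A B : Type) (M : gsm A B) : Prop :=
  forall i, In i (gdelta M) -> i.1.1.1 <> gqf M.

Definition tape (A : Type) (w : seq A) (i : nat) : tsym A :=
  if i is k.+1 then
    (if nth None (map Some w) k is Some a then Sym a else REnd)
  else LEnd.

Definition newpos (n i : nat) (e : move) : option nat :=
  match e with
  | MLeft => if i is j.+1 then Some j else None
  | MStay => Some i
  | MRight => if i.+1 <= n.+1 then Some i.+1 else None
  end.

Inductive gstep (A B : Type) (M : gsm A B) (w : seq A) :
    gQ M * nat * seq B -> gQ M * nat * seq B -> Prop :=
| GStep1 p s q1 a1 e1 q0 a0 e0 i out j :
    In (p, s, (q1, a1, e1), (q0, a0, e0)) (gdelta M) ->
    tape w i = s -> newpos (size w) i e1 = Some j ->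
    @gstep A B M w (p, i, out) (q1, j, out ++ a1)
| GStep0 p s q1 a1 e1 q0 a0 e0 i out j :
    In (p, s, (q1, a1, e1), (q0, a0, e0)) (gdelta M) ->
    tape w i <> s -> newpos (size w) i e0 = Some j ->
    @gstep A B M w (p, i, out) (q0, j, out ++ a0).

Inductive greach (A B : Type) (M : gsm A B) (w : seq A) :
    gQ M * nat * seq B -> gQ M * nat * seq B -> Prop :=
| GRefl c : @greach A B M w c c
| GTrans c1 c2 c3 : @gstep A B M w c1 c2 -> @greach A B M w c2 c3 -> @greach A B M w c1 c3.

Definition gsm_rel (A B : Type) (M : gsm A B) : strans A B :=
  fun w z => exists i : nat, @greach A B M w (gqin M, 0, [::]) (gqf M, i, z).

Definition gsm_det (A B : Type) (M : gsm A B) : Prop :=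
  forall i j, In i (gdelta M) -> In j (gdelta M) -> i.1.1.1 = j.1.1.1 -> i = j.

Definition same_trans (A B : Type) (m1 m2 : strans A B) : Prop :=
  forall w z, m1 w z <-> m2 w z.

Definition DGSM (A B : finType) (m : strans A B) : Prop :=
  exists M : gsm A B, gsm_wf M /\ gsm_det M /\ same_trans m (gsm_rel M).

Definition DGSM_eps (A B : finType) (m : strans A B) : Prop :=
  DGSM m /\ forall z, m [::] z -> z = [::].

Definition relab (A B : Type) (R : A -> B -> bool) : strans A B :=
  fun w z => all2 R w z.

Definition REL (A B : finType) (m : strans A B) : Prop :=
  exists R : A -> B -> bool, same_trans m (relab R).

Definition mark (A : Type) (w : seq A) : seq (tsym A) :=
  LEnd :: rcons (map (@Sym A) w) REnd.

Definition MREL (A B : finType) (m : strans A B) : Prop :=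
  exists R : tsym A -> B -> bool, same_trans m (fun w z => relab R (mark w) z).

Definition comp (A B C : Type) (m1 : strans A B) (m2 : strans B C) : strans A C :=
  fun w z => exists y, m1 w y /\ m2 y z.

Definition fcomp (F1 : forall A B : finType, strans A B -> Prop)
                 (F2 : forall A B : finType, strans A B -> Prop)
                 (A C : finType) (m : strans A C) : Prop :=
  exists (B : finType) (m1 : strans A B) (m2 : strans B C),
    F1 A B m1 /\ F2 B C m2 /\ same_trans m (comp m1 m2).

(* Main.v *)
Require Import Defs.
From mathcomp Require Import all_boot.
From mathcomp Require Import boolp.

(* From logic to machines: by the DFA-versus-MSO correspondence, all the node and
   edge formulas of the transduction, and the formulas saying where the output
   starts, ends and continues, are decided by one deterministic automaton on the
   input word with the parameters and the free node variables marked on it.  The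
   relabelling guesses, at every position, the parameters, the state of that
   automaton on the prefix and its action on states over the suffix.  The two-way
   machine first checks this guess in one sweep (the conditions are local), and
   then walks from each output node to the next one: the annotation tells whether
   the successor lies to the left or to the right, and the machine recognizes it on
   arrival, having carried the state of the automaton along.

   From machines to logic: the relabelling becomes a guess of node sets, the output
   nodes are the configurations of the machine that are reached and emit a letter,
   and reachability (globally, or through steps without output) is expressed by
   quantifying over all families of node sets closed under steps. *)

Set Implicit Arguments.
Unset Strict Implicit.
Unset Printing Implicit Defensive.

(** Both kinds of string graphs are treated at once as [wgraph lab e u], a path whose node labels
    and outgoing edge labels are functions of the letters of [u]. For [nd] the word is the string
    itself; for [ed] it has one more letter, [None], at the last node. The machine built from
    formulas is proved sound by determinism: on a correct annotation one halting run is exhibited,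
    whose output is the string defined by the guessed parameters, and any accepted output must
    coincide with it. In the converse direction there are fewer nodes than tape cells: an [ed] input
    has |w|+1 nodes, but the tape holding a relabelling of [mark w] has |w|+4 cells; an [nd] input
    has |w| nodes for |w|+2 cells. The surplus cells are moved into the states at the two end nodes.
    The two statements differ at the empty string: its [nd] graph has no nodes, so every output is
    empty, whence the condition in [DGSM_eps]; its [ed] graph still has a node, on which a nonempty
    output can be produced. *)

(** * Closure properties of regular languages *)

Definition regular (T : Type) (K : seq T -> Prop) : Prop :=
  exists (Q : finType) (d : Q -> T -> Q) (q0 : Q) (F : pred Q),
    forall w, K w <-> F (foldl d q0 w).

Lemma regular_ext T (K K' : seq T -> Prop) :
  (forall w, K w <-> K' w) -> regular K -> regular K'.
Proof.
move=> KK' [Q [d [q0 [F H]]]]; exists Q, d, q0, F => w.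
by rewrite -KK'.
Qed.

Lemma regular_not T (K : seq T -> Prop) :
  regular K -> regular (fun w => ~ K w).
Proof.
move=> [Q [d [q0 [F H]]]]; exists Q, d, q0, (predC F) => w /=.
by rewrite H; split => /negP.
Qed.

Lemma regular_or T (K K' : seq T -> Prop) :
  regular K -> regular K' -> regular (fun w => K w \/ K' w).
Proof.
move=> [Q [d [q0 [F H]]]] [Q' [d' [q0' [F' H']]]].
exists (Q * Q')%type, (fun q t => (d q.1 t, d' q.2 t)), (q0, q0').
exists (fun q => F q.1 || F' q.2) => w.
have -> : foldl (fun q t => (d q.1 t, d' q.2 t)) (q0, q0') w
          = (foldl d q0 w, foldl d' q0' w).
  by elim: w q0 q0' {H H'} => //= t w IH q0 q0'; rewrite IH.
by rewrite /= H H'; split => /orP.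
Qed.

Lemma regular_and T (K K' : seq T -> Prop) :
  regular K -> regular K' -> regular (fun w => K w /\ K' w).
Proof.
move=> rK rK'.
apply: regular_ext (regular_not (regular_or (regular_not rK) (regular_not rK'))).
by move=> w; rewrite not_orE !not_notE.
Qed.

Lemma regular_map T T' (h : T -> T') (K : seq T' -> Prop) :
  regular K -> regular (fun w => K (map h w)).
Proof.
move=> [Q [d [q0 [F H]]]]; exists Q, (fun q t => d q (h t)), q0, F => w.
rewrite H; suff -> : foldl d q0 (map h w) = foldl (fun q t => d q (h t)) q0 w by [].
by elim: w q0 {H} => //=.
Qed.

(** Subset construction: a state is the set of states reachable under some choice of the bits that
    [h] writes into the letters. This is the automaton for an existential quantifier. *)
Lemma regular_proj T (h : T -> bool -> T) (K : seq T -> Prop) :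
  regular K ->
  regular (fun w => exists bs, size bs = size w /\
                    K [seq h p.1 p.2 | p <- zip w bs]).
Proof.
move=> [Q [d [q0 [F H]]]].
pose D (A : {set Q}) t := [set d p.1 (h t p.2) | p in setX A [set: bool]].
exists {set Q}, D, [set q0], (fun A : {set Q} => [exists q in A, F q]) => w.
have DP A q' : q' \in foldl D A w <->
    exists q bs, [/\ q \in A, size bs = size w
      & foldl d q [seq h p.1 p.2 | p <- zip w bs] = q'].
  elim: w A => [|t w IH] A /=.
    split=> [qA|[q [[|b bs] []//]]]; first by exists q', [::].
    by move=> qA _ <-.
  rewrite IH; split=> [[q [bs [/imsetP[[q1 b] /setXP[/= q1A _] ->] sz E]]]|].
    by exists q1, (b :: bs); rewrite /= sz.
  move=> [q [[|b bs] []// qA [sz] E]].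
  exists (d q (h t b)), bs; split=> //.
  by apply/imsetP; exists (q, b) => //; apply/setXP; rewrite inE.
split=> [[bs [sz /H Fq]]|/existsP[q /andP[/DP[q1 [bs [/set1P-> sz <-]]] Fq]]].
  apply/existsP; eexists; apply/andP; split; last exact: Fq.
  by apply/DP; exists q0, bs; rewrite inE eqxx.
by exists bs; split=> //; apply/H.
Qed.

Lemma regular_has T (p : pred T) :
  regular (fun w => exists i t, onth w i = Some t /\ p t).
Proof.
exists bool, (fun b t => b || p t), false, id => w.
have -> : foldl (fun b t => b || p t) false w = false || has p w.
  by elim: w false => [|t w IH] b /=; rewrite ?orbF // IH orbA.
elim: w => [|t w IH] /=; first by split=> // -[[|i] [t []]].
split=> [[[|i] [t' [/= E pt]]]|/orP[pt|/IH[i [t' Et']]]].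
- by case: E => ->; rewrite pt.
- by apply/orP; right; apply/IH; exists i, t'.
- by exists 0, t.
- by exists i.+1, t'.
Qed.

(** The first bit of the state remembers whether the previous letter satisfied [p1], the second
    whether a match has been completed. *)
Lemma regular_adjacent T (p1 p2 : pred T) :
  regular (fun w => exists i t1 t2,
    [/\ onth w i = Some t1, onth w i.+1 = Some t2, p1 t1 & p2 t2]).
Proof.
pose d (s : bool * bool) t := (p1 t, s.2 || (s.1 && p2 t)).
exists (bool * bool)%type, d, (false, false), snd => w.
(* Generalized to any start state for the induction; the middle alternative is a match whose first
   letter precedes the word. *)
suff H s : (foldl d s w).2 <->
   [\/ s.2, s.1 /\ (exists2 t, onth w 0 = Some t & p2 t) |
       exists i t1 t2,
         [/\ onth w i = Some t1, onth w i.+1 = Some t2, p1 t1 & p2 t2]].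
  by rewrite H; split=> [|[//|[]//|//]]; constructor 3.
elim: w s => [|t w IH] [b f] /=.
  split=> [->|[//|[_ []]//|[[|i] [? [? []]]]//]]; first by constructor.
rewrite IH /=; split.
- case=> [/orP[->|/andP[-> pt]]|[pt [t' E pt']]|[i [t1 [t2 H]]]].
  + by constructor 1.
  + by constructor 2; split=> //; exists t.
  + by constructor 3; exists 0, t, t'.
  + by constructor 3; exists i.+1, t1, t2.
- case=> [->|[-> [t' [->]] ->]|[[|i] [t1 [t2 []]]]].
  + by constructor 1.
  + by constructor 1; rewrite orbT.
  + by move=> [<-] /= E pt pt'; constructor 2; split=> //; exists t2.
  + by move=> /= E1 E2 pt pt'; constructor 3; exists i, t1, t2.
Qed.

Lemma regular_before T (p1 p2 : pred T) :
  regular (fun w => exists i j t1 t2,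
    [/\ i < j, onth w i = Some t1, onth w j = Some t2, p1 t1 & p2 t2]).
Proof.
pose d (s : bool * bool) t := (s.1 || p1 t, s.2 || (s.1 && p2 t)).
exists (bool * bool)%type, d, (false, false), snd => w.
suff H s : (foldl d s w).2 <->
   [\/ s.2, s.1 /\ (exists j t, onth w j = Some t /\ p2 t) |
       exists i j t1 t2,
         [/\ i < j, onth w i = Some t1, onth w j = Some t2, p1 t1 & p2 t2]].
  by rewrite H; split=> [|[//|[]//|//]]; constructor 3.
elim: w s => [|t w IH] [b f] /=.
  split=> [->|[//|[_ [[|j] [? []]]]//|[[|i] [? [? [? []]]]]//]]; first by constructor.
rewrite IH /=; split.
- case=> [/orP[->|/andP[-> pt]]|[/orP[->|pt] [j [t' [E pt']]]]|
          [i [j [t1 [t2 [ij ? ? ? ?]]]]]].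
  + by constructor 1.
  + by constructor 2; split=> //; exists 0, t.
  + by constructor 2; split=> //; exists j.+1, t'.
  + by constructor 3; exists 0, j.+1, t, t'.
  + by constructor 3; exists i.+1, j.+1, t1, t2.
- case=> [->|[-> [[|j] [t' [/= E pt]]]]|[[|i] [[|j] [t1 [t2 []]]]]] //=.
  + by constructor 1.
  + by case: E pt => <- ->; constructor 1; rewrite orbT.
  + by constructor 2; split=> //; exists j, t'.
  + by move=> _ [<-] E pt pt'; constructor 2; rewrite pt orbT; split=> //; exists j, t2.
  + by rewrite ltnS => ? ? ? ? ?; constructor 3; exists i, j, t1, t2.
Qed.

(** A counter that saturates at two, stored as the bits [0 < n] and [1 < n]. It serves to single out
    the set variables that denote one position. *)
Lemma regular_count1 T (p : pred T) : regular (fun w => count p w = 1).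
Proof.
pose d (s : bool * bool) t := (s.1 || p t, s.2 || (s.1 && p t)).
exists (bool * bool)%type, d, (false, false), (fun s => s.1 && ~~ s.2) => w.
suff foldlE n : foldl d (0 < n, 1 < n) w = (0 < n + count p w, 1 < n + count p w).
  by have /= -> := foldlE 0; case: count => [|[|n]].
elim: w n => [|t w IH] n; rewrite /= ?addn0 //.
have -> : d (0 < n, 1 < n) t = (0 < n + p t, 1 < n + p t).
  by rewrite /d /=; case: n => [|[|n]]; case: (p t).
by rewrite IH addnA.
Qed.

(** * Monadic second-order logic on words *)

(* A valuation maps a position and a variable to the truth value of
   "the position belongs to the variable". *)
Definition valn := nat -> nat -> bool.

Definition set_pos (nb : valn) x i : valn :=
  fun p y => if y == x then p == i else nb p y.
Definition set_set (sb : valn) X (Z : nat -> bool) : valn :=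
  fun p Y => if Y == X then Z p else sb p Y.

(* Node variable 0 at position [i] (and node variable 1 at position [j]). *)
Definition pos1 i : valn := fun p x => (x == 0) && (p == i).
Definition pos2 i j : valn := fun p x => (x == 0) && (p == i) || (x == 1) && (p == j).

(** Each letter carries the truth values of all variables at its position. The alphabet is then
    infinite, which [regular] allows, and no bound on the variables of a formula has to be
    tracked. *)
Fixpoint code L (u : seq L) (nb sb : valn) : seq (L * (nat -> bool) * (nat -> bool)) :=
  if u is a :: u' then
    (a, nb 0, sb 0) :: code u' (fun p => nb p.+1) (fun p => sb p.+1)
  else [::].

Lemma size_code L (u : seq L) nb sb : size (code u nb sb) = size u.
Proof. by elim: u nb sb => //= a u IH nb sb; rewrite IH. Qed.

Lemma onth_code L (u : seq L) nb sb i :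
  onth (code u nb sb) i = omap (fun a => (a, nb i, sb i)) (onth u i).
Proof. by elim: u nb sb i => [|a u IH] nb sb [|i] //=; rewrite IH. Qed.

Lemma eq_code L (u : seq L) nb nb' sb sb' :
  (forall i, i < size u -> nb i = nb' i /\ sb i = sb' i) ->
  code u nb sb = code u nb' sb'.
Proof.
move=> H; apply: eq_from_onth => i; rewrite !onth_code.
by case E: (onth u i) => [a|] //=; have [|-> ->//] := H i; rewrite -onthTE E.
Qed.

Definition wpred (L : Type) := seq L -> valn -> valn -> Prop.

(** Besides regularity this expresses that [P] sees the valuations only at positions of the word;
    [recog_local] exploits exactly that. *)
Definition recog L (P : wpred L) : Prop :=
  exists2 K : seq (L * (nat -> bool) * (nat -> bool)) -> Prop,
    regular K & forall u nb sb, P u nb sb <-> K (code u nb sb).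

Section Recog.
Variable L : Type.
Implicit Types P : wpred L.

Lemma recog_ext P P' :
  (forall u nb sb, P u nb sb <-> P' u nb sb) -> recog P -> recog P'.
Proof. by move=> PP' [K rK H]; exists K => // u nb sb; rewrite -PP'. Qed.

Lemma recog_not P : recog P -> recog (fun u nb sb => ~ P u nb sb).
Proof.
move=> [K rK H]; exists (fun w => ~ K w); first exact: regular_not.
by move=> u nb sb; rewrite H.
Qed.

Lemma recog_or P P' :
  recog P -> recog P' -> recog (fun u nb sb => P u nb sb \/ P' u nb sb).
Proof.
move=> [K rK H] [K' rK' H']; exists (fun w => K w \/ K' w); first exact: regular_or.
by move=> u nb sb; rewrite H H'.
Qed.

Lemma recog_and P P' :
  recog P -> recog P' -> recog (fun u nb sb => P u nb sb /\ P' u nb sb).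
Proof.
move=> [K rK H] [K' rK' H']; exists (fun w => K w /\ K' w); first exact: regular_and.
by move=> u nb sb; rewrite H H'.
Qed.

Lemma recog_false : recog (fun (u : seq L) nb sb => False).
Proof.
exists (fun _ => False) => //; exists unit, (fun q _ => q), tt, pred0 => w.
by split.
Qed.

Lemma recog_exists (J : finType) (P : J -> wpred L) :
  (forall j, recog (P j)) -> recog (fun u nb sb => exists j, P j u nb sb).
Proof.
move=> rP.
suff: forall s : seq J, recog (fun u nb sb => exists2 j, j \in s & P j u nb sb).
  move=> /(_ (enum J)); apply: recog_ext => u nb sb; split.
    by move=> [j _ ?]; exists j.
  by move=> [j ?]; exists j; rewrite ?mem_enum.
elim=> [|j s IH].
  by apply: recog_ext recog_false => u nb sb; split=> // -[].
apply: recog_ext (recog_or (rP j) IH) => u nb sb; split.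
  move=> [Pj|[k ks Pk]]; first by exists j; rewrite ?mem_head.
  by exists k; rewrite // inE ks orbT.
by move=> [k]; rewrite inE => /orP[/eqP->|ks] Pk; [left|right; exists k].
Qed.

(** Renaming of node variables, [None] making a variable empty. It lets one formula be read with its
    two nodes exchanged, or with one of them dropped. *)
Lemma recog_subst (s : nat -> option nat) P :
  recog P ->
  recog (fun u nb sb => P u (fun p x => if s x is Some y then nb p y else false) sb).
Proof.
move=> [K rK H].
pose h (t : L * (nat -> bool) * (nat -> bool)) :=
  (t.1.1, fun x => if s x is Some y then t.1.2 y else false, t.2).
exists (fun w => K (map h w)); first exact: regular_map.
move=> u nb sb; rewrite H.
suff -> : map h (code u nb sb) =
  code u (fun p x => if s x is Some y then nb p y else false) sb by [].
by elim: u nb sb => //= a u IH nb sb; rewrite IH.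
Qed.

Lemma recog_has (p : L -> (nat -> bool) -> (nat -> bool) -> bool) :
  recog (fun u nb sb => exists i a, onth u i = Some a /\ p a (nb i) (sb i)).
Proof.
exists (fun w => exists i t, onth w i = Some t /\ p t.1.1 t.1.2 t.2).
  exact: (regular_has (fun t => p t.1.1 t.1.2 t.2)).
move=> u nb sb; split=> [[i [a [E pa]]]|[i [t []]]].
  by exists i, (a, nb i, sb i); rewrite onth_code E.
by rewrite onth_code; case E: (onth u i) => [a|] //= [<-] /= pa; exists i, a.
Qed.

Lemma recog_adjacent (p1 p2 : L -> (nat -> bool) -> (nat -> bool) -> bool) :
  recog (fun u nb sb => exists i a b, [/\ onth u i = Some a, onth u i.+1 = Some b,
     p1 a (nb i) (sb i) & p2 b (nb i.+1) (sb i.+1)]).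
Proof.
have := regular_adjacent (fun t : L * (nat -> bool) * (nat -> bool) => p1 t.1.1 t.1.2 t.2)
                         (fun t => p2 t.1.1 t.1.2 t.2).
set K := (fun _ => _) => rK; exists K => // u nb sb; rewrite /K; split.
  move=> [i [a [b [Ea Eb pa pb]]]].
  by exists i, (a, nb i, sb i), (b, nb i.+1, sb i.+1); rewrite !onth_code Ea Eb.
move=> [i [t1 [t2 []]]]; rewrite !onth_code.
case Ea: (onth u i) => [a|] // [<-]; case Eb: (onth u i.+1) => [b|] // [<-] /= pa pb.
by exists i, a, b.
Qed.

Lemma recog_before x y :
  recog (fun (u : seq L) nb sb => exists i j, [/\ i < j, j < size u, nb i x & nb j y]).
Proof.
have := regular_before (fun t : L * (nat -> bool) * (nat -> bool) => t.1.2 x)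
                       (fun t => t.1.2 y).
set K := (fun _ => _) => rK; exists K => // u nb sb; rewrite /K; split.
  move=> [i [j [ij ju ni nj]]].
  case Ea: (onth u i) (onthTE u i) => [a|] /= ; last by rewrite (ltn_trans ij ju).
  case Eb: (onth u j) (onthTE u j) => [b|] /= _ _; last first.
    by move: (onthTE u j); rewrite Eb ju.
  by exists i, j, (a, nb i, sb i), (b, nb j, sb j); rewrite !onth_code Ea Eb.
move=> [i [j [t1 [t2 []]]]]; rewrite !onth_code.
case Ea: (onth u i) => [a|] // ij [<-]; case Eb: (onth u j) => [b|] //= [<-] /= ni nj.
by exists i, j; rewrite -onthTE Eb.
Qed.

(** Projection: the guessed bits become membership in [X], and of an arbitrary [Z] only the first
    [size u] values are visible. *)
Lemma recog_set X P :
  recog P -> recog (fun u nb sb => exists Z, P u nb (set_set sb X Z)).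
Proof.
move=> [K rK H].
pose h (t : L * (nat -> bool) * (nat -> bool)) b := (t.1, fun Y => if Y == X then b else t.2 Y).
have hE (u : seq L) nb sb bs : size bs = size u ->
    [seq h p.1 p.2 | p <- zip (code u nb sb) bs] =
    code u nb (set_set sb X (nth false bs)).
  elim: u nb sb bs => [|a u IH] nb sb [|b bs] //= [sz].
  by rewrite IH.
have := regular_proj h rK; set K' := (fun _ => _) => rK'; exists K' => // u nb sb.
split=> [[Z /H KZ]|[bs [sz]]].
  exists (mkseq Z (size u)); rewrite size_mkseq size_code hE ?size_mkseq //; split=> //.
  rewrite (_ : code _ _ _ = code u nb (set_set sb X Z)) //; apply: eq_code => i iu.
  by split=> //; apply/funext => Y; rewrite /set_set nth_mkseq.
by rewrite size_code in sz; rewrite hE // => Kbs; exists (nth false bs); apply/H.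
Qed.

Lemma count1_nth (bs : seq bool) :
  count id bs = 1 -> exists2 i, i < size bs & forall p, nth false bs p = (p == i).
Proof.
elim: bs => //= -[] bs IH /=; rewrite ?add0n.
  move=> [] /eqP; rewrite -leqn0 leqNgt -has_count => /hasPn H.
  exists 0 => // -[|p] //=; apply/negbTE; case: (ltnP p (size bs)) => pb.
    by apply: H; rewrite mem_nth.
  by rewrite nth_default.
by move=> /IH[i ib H]; exists i.+1 => // -[|p] //=; rewrite H.
Qed.

(** A position is a sequence of bits with exactly one true entry, so the node quantifier is a
    projection after intersection with [regular_count1]. *)
Lemma recog_pos x P :
  recog P -> recog (fun u nb sb => exists i, i < size u /\ P u (set_pos nb x i) sb).
Proof.
move=> [K rK H].
pose h (t : L * (nat -> bool) * (nat -> bool)) b :=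
  (t.1.1, fun y => if y == x then b else t.1.2 y, t.2).
pose v (nb : valn) bs : valn := fun p y => if y == x then nth false bs p else nb p y.
have hE (u : seq L) nb sb bs : size bs = size u ->
    [seq h p.1 p.2 | p <- zip (code u nb sb) bs] = code u (v nb bs) sb /\
    count (fun t => t.1.2 x) (code u (v nb bs) sb) = count id bs.
  elim: u nb sb bs => [|a u IH] nb sb [|b bs] //= [sz].
  have [E1 E2] := IH (fun p => nb p.+1) (fun p => sb p.+1) bs sz.
  split; first by rewrite E1.
  by congr (_ + _); rewrite /v ?eqxx.
have := regular_proj h (regular_and (regular_count1
  (fun t : L * (nat -> bool) * (nat -> bool) => t.1.2 x)) rK).
set K' := (fun _ => _) => rK'; exists K' => // u nb sb.
split=> [[i [iu /H KZ]]|[bs [sz]]].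
  exists (mkseq (eq_op^~ i) (size u)); rewrite size_mkseq size_code; split=> //.
  have [|-> ->] := hE u nb sb (mkseq (eq_op^~ i) (size u)); first by rewrite size_mkseq.
  split.
    by rewrite count_map (count_uniq_mem _ (iota_uniq _ _)) mem_iota iu.
  rewrite (_ : code _ _ _ = code u (set_pos nb x i) sb) //; apply: eq_code => p pu.
  by split=> //; apply/funext => Y; rewrite /set_pos /v nth_mkseq.
rewrite size_code in sz; have [-> ->] := hE u nb sb bs sz.
move=> [/count1_nth[i ib bsE] Kbs]; exists i; rewrite -sz; split=> //; apply/H.
rewrite (_ : code _ _ _ = code u (v nb bs) sb) //; apply: eq_code => p pu.
by split=> //; apply/funext => Y; rewrite /set_pos /v bsE.
Qed.

(** Product of the automata of a finite family. The annotation can then refer to a single automaton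
    that decides every test the walk makes. *)
Lemma recog_family (J : finType) (P : J -> wpred L) :
  (forall j, recog (P j)) ->
  exists (Q : finType) (d : Q -> L * (nat -> bool) * (nat -> bool) -> Q) (q0 : Q)
    (F : J -> pred Q),
    forall j u nb sb, P j u nb sb <-> F j (foldl d q0 (code u nb sb)).
Proof.
move=> rP.
suff: forall s : seq J,
  exists (Q : finType) (d : Q -> L * (nat -> bool) * (nat -> bool) -> Q) (q0 : Q)
    (F : J -> pred Q),
    forall j u nb sb, j \in s -> P j u nb sb <-> F j (foldl d q0 (code u nb sb)).
  move=> /(_ (enum J))[Q [d [q0 [F H]]]]; exists Q, d, q0, F => j u nb sb.
  by have := H j u nb sb; rewrite mem_enum; apply.
elim=> [|k s [Q [d [q0 [F H]]]]].
  by exists unit, (fun q _ => q), tt, (fun _ _ => true).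
have [K [Q' [d' [q0' [F' H']]]] E] := rP k.
exists (Q * Q')%type, (fun q t => (d q.1 t, d' q.2 t)), (q0, q0').
exists (fun j q => if j == k then F' q.2 else F j q.1) => j u nb sb.
have -> : foldl (fun q t => (d q.1 t, d' q.2 t)) (q0, q0') (code u nb sb)
          = (foldl d q0 (code u nb sb), foldl d' q0' (code u nb sb)).
  move: (code u nb sb) => w.
  by elim: w q0 q0' {H H'} => //= t w IH q0 q0'; rewrite IH.
rewrite inE /=; case: eqP => [-> _|_ /= js]; first by rewrite E.
exact: (H j u nb sb js).
Qed.

End Recog.

(** * Satisfaction of formulas on words and on path graphs *)

Section WordSat.
Variables (L : Type) (S : eqType) (G : Type) (lab : L -> S) (e : L -> G -> bool).

(** Node variables are read as sets of positions and atoms ask for a witness. An unassigned variable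
    is the empty set, so its atoms are false, in agreement with [sat]. *)
Fixpoint wsat (u : seq L) (nb sb : valn) (f : mso S G) : Prop :=
  match f with
  | FLab s x => exists i a, [/\ onth u i = Some a, nb i x & lab a = s]
  | FEdge c x y => exists i a,
      [/\ onth u i = Some a, i.+1 < size u, nb i x && e a c & nb i.+1 y]
  | FEq x y => exists i, [/\ i < size u, nb i x & nb i y]
  | FIn x X => exists i, [/\ i < size u, nb i x & sb i X]
  | FNot f1 => ~ wsat u nb sb f1
  | FOr f1 f2 => wsat u nb sb f1 \/ wsat u nb sb f2
  | FEx1 x f1 => exists i, i < size u /\ wsat u (set_pos nb x i) sb f1
  | FEx2 X f1 => exists Z, wsat u nb (set_set sb X Z) f1
  end.

Lemma recog_wsat f : recog (fun u nb sb => wsat u nb sb f).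
Proof.
elim: f => [s x|c x y|x y|x X|f IH|f1 IH1 f2 IH2|x f IH|X f IH] /=.
- apply: recog_ext (recog_has (fun a n _ => n x && (lab a == s))) => u nb sb.
  split=> [[i [a [E /andP[ni /eqP]]]]|[i [a [E ni /eqP la]]]]; first by exists i, a.
  by exists i, a; rewrite ni.
- apply: recog_ext (recog_adjacent (fun a n _ => n x && e a c) (fun _ n _ => n y)).
  move=> u nb sb; split=> [[i [a [b [Ea Eb ni nj]]]]|[i [a [Ea iu ni nj]]]].
    by exists i, a; rewrite -onthTE Eb.
  move: iu; rewrite -onthTE; case Eb: (onth u i.+1) => [b|] // _.
  by exists i, a, b.
- apply: recog_ext (recog_has (fun a n _ => n x && n y)) => u nb sb.
  split=> [[i [a [E /andP[nx ny]]]]|[i [iu nx ny]]].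
    by exists i; rewrite -onthTE E.
  by move: iu; rewrite -onthTE; case E: (onth u i) => [a|] // _; exists i, a; rewrite nx.
- apply: recog_ext (recog_has (fun a n s => n x && s X)) => u nb sb.
  split=> [[i [a [E /andP[nx ny]]]]|[i [iu nx ny]]].
    by exists i; rewrite -onthTE E.
  by move: iu; rewrite -onthTE; case E: (onth u i) => [a|] // _; exists i, a; rewrite nx.
- exact: recog_not.
- exact: recog_or.
- exact: (recog_pos x IH).
- exact: (recog_set X IH).
Qed.

Lemma wsat_ext f u nb nb' sb sb' :
  (forall i, i < size u -> nb i = nb' i /\ sb i = sb' i) ->
  wsat u nb sb f -> wsat u nb' sb' f.
Proof.
move=> H; have [K _ E] := recog_wsat f.
by rewrite !E (eq_code H).
Qed.

(** The common form of [nd] (where [lab] is the identity and [e] is always true) and [ed] (where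
    [lab] is constant and [e] compares the letter with the edge label). *)
Definition wgraph (u : seq L) : graph S G :=
  @Graph S G 'I_(size u) (fun i c j => (val j == (val i).+1) && e (tnth (in_tuple u) i) c)
    (fun i => lab (tnth (in_tuple u) i)).

Section Transfer.
Variables (g : graph S G) (u : seq L) (f : 'I_(size u) -> gV g).
Hypothesis f_bij : bijective f.
Hypothesis f_lab : forall i, glab g (f i) = lab (tnth (in_tuple u) i).
Hypothesis f_edge : forall i c j,
  gE g (f i) c (f j) = (val j == (val i).+1) && e (tnth (in_tuple u) i) c.

Definition pos_val (nu : nat -> option (gV g)) : valn :=
  fun p x => [exists i : 'I_(size u), (val i == p) && (nu x == Some (f i))].
Definition set_val (mu : nat -> {set gV g}) : valn :=
  fun p X => [exists i : 'I_(size u), (val i == p) && (f i \in mu X)].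

Lemma pos_valP nu (i : 'I_(size u)) x : pos_val nu i x = (nu x == Some (f i)).
Proof.
apply/existsP/eqP => [[j /andP[/eqP/val_inj-> /eqP->]]|E] //.
by exists i; rewrite eqxx E eqxx.
Qed.

Lemma set_valP mu (i : 'I_(size u)) X : set_val mu i X = (f i \in mu X).
Proof.
apply/existsP/idP => [[j /andP[/eqP/val_inj->]]|E] //.
by exists i; rewrite eqxx E.
Qed.

Lemma pos_val_lt nu p x : pos_val nu p x -> p < size u.
Proof. by move=> /existsP[i /andP[/eqP<- _]]; apply: ltn_ord. Qed.

Lemma tnth_word (i : 'I_(size u)) : onth u i = Some (tnth (in_tuple u) i).
Proof. exact: ((tnth_onth _ (in_tuple u) i).1 erefl). Qed.

Lemma sat_wsat nu mu phi :
  sat nu mu phi <-> wsat u (pos_val nu) (set_val mu) phi.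
Proof.
have [f' fK f'K] := f_bij.
elim: phi nu mu => [s x|c x y|x y|x X|f1 IH|f1 IH1 f2 IH2|x f1 IH|X f1 IH] nu mu /=.
- split=> [|[p [a [E ni la]]]].
    case E: (nu x) => [v|] // /eqP <-; exists (f' v), (tnth (in_tuple u) (f' v)).
    by rewrite tnth_word pos_valP f'K E -f_lab f'K.
  have pu := pos_val_lt ni; move: ni E.
  rewrite -[p]/(val (Ordinal pu)) pos_valP tnth_word => /eqP -> [E].
  by rewrite f_lab E la.
- split=> [|[p [a [Ea _ /andP[ni ea] nj]]]].
    case Ex: (nu x) => [v|] //; case Ey: (nu y) => [v'|] //.
    rewrite -[v]f'K -[v']f'K f_edge => /andP[/eqP E ec].
    exists (f' v), (tnth (in_tuple u) (f' v)).
    by rewrite -E !tnth_word !pos_valP !f'K Ex Ey !eqxx ec ltn_ord.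
  have pu := pos_val_lt ni; have pu' := pos_val_lt nj; move: ni nj Ea.
  rewrite -[p in pos_val _ p]/(val (Ordinal pu)) -[p.+1]/(val (Ordinal pu')) !pos_valP.
  move=> /eqP -> /eqP->; rewrite -[p]/(val (Ordinal pu)) tnth_word => -[E].
  by rewrite f_edge /= eqxx E.
- split=> [|[p [pu]]].
    case Ex: (nu x) => [v|] //; case Ey: (nu y) => [v'|] // /eqP E.
    by rewrite -E in Ey; exists (f' v); rewrite ltn_ord !pos_valP !f'K Ex Ey !eqxx.
  by rewrite -[p]/(val (Ordinal pu)) !pos_valP => /eqP-> /eqP->; rewrite eqxx.
- split=> [|[p [pu]]].
    case Ex: (nu x) => [v|] // vX.
    by exists (f' v); rewrite ltn_ord pos_valP set_valP !f'K Ex !eqxx.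
  by rewrite -[p]/(val (Ordinal pu)) !pos_valP set_valP => /eqP->.
- by rewrite -IH; split=> /negP.
- by rewrite -IH1 -IH2; split=> /orP.
- have E (i : 'I_(size u)) : pos_val (upd nu x (Some (f i))) = set_pos (pos_val nu) x i.
    apply/funext => p; apply/funext => y; rewrite /set_pos /pos_val /upd.
    case: (y == x) => //; apply/existsP/eqP => [[j /andP[/eqP<- /eqP[]]]|->].
      by move=> /(bij_inj f_bij) ->.
    by exists i; rewrite !eqxx.
  split=> [/existsP[v]|[p [pu]]].
    by rewrite -[v]f'K IH E => H; exists (f' v); rewrite ltn_ord.
  rewrite -[p]/(val (Ordinal pu)) -E -IH => H.
  by apply/existsP; exists (f (Ordinal pu)).
- split=> [/existsP[A]|[Z]].
    rewrite IH => H; exists (fun p => set_val (upd mu X A) p X).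
    rewrite (_ : set_set _ _ _ = set_val (upd mu X A)) //.
    apply/funext => p; apply/funext => Y; rewrite /set_set.
    by case: eqP => [->//|/eqP/negbTE YX]; apply: eq_existsb => i; rewrite /upd YX.
  (* [Z] is an arbitrary predicate on numbers. The node set agrees with it only at positions of the
     word, hence the appeal to [wsat_ext]. *)
  move=> H; apply/existsP; exists [set v | Z (f' v)]; apply/IH.
  apply: (wsat_ext _ H) => p pu; split=> //; apply/funext => Y.
  rewrite -[p]/(val (Ordinal pu)) /set_set !set_valP /upd.
  by case: eqP => // _; rewrite inE fK.
Qed.

Lemma pos_val_nv0 : pos_val (nv0 _) = (fun _ _ => false).
Proof. by apply/funext => p; apply/funext => x; apply/existsP => -[j /andP[]]. Qed.

Lemma pos_val_nv1 (i : 'I_(size u)) : pos_val (nv1 (f i)) = pos1 i.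
Proof.
apply/funext => p; apply/funext => x; rewrite /pos_val /pos1 /nv1.
case: (x == 0) => /=; last by apply/existsP => -[j /andP[]].
apply/existsP/eqP => [[j /andP[/eqP<- /eqP[/(bij_inj f_bij)->]]] //|->].
by exists i; rewrite !eqxx.
Qed.

Lemma pos_val_nv2 (i j : 'I_(size u)) : pos_val (nv2 (f i) (f j)) = pos2 i j.
Proof.
apply/funext => p; apply/funext => x; rewrite /pos_val /pos2 /nv2.
case: x => [|[|x]] /=; last by apply/existsP => -[l /andP[]].
  rewrite orbF; apply/existsP/eqP => [[l /andP[/eqP<- /eqP[/(bij_inj f_bij)->]]] //|->].
  by exists i; rewrite !eqxx.
apply/existsP/eqP => [[l /andP[/eqP<- /eqP[/(bij_inj f_bij)->]]] //|->].
by exists j; rewrite !eqxx.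
Qed.

End Transfer.
End WordSat.

(** * Deterministic two-way machines *)

Definition oseq (T : Type) (o : option T) : seq T := if o is Some x then [:: x] else [::].

(* Unlike a [gsm], a machine reads the whole symbol at once and emits at most
   one letter per step. *)
Record mach (S C : Type) := Mach {
  mQ : finType;
  mstart : mQ;
  mfin : pred mQ;
  mdelta : mQ -> S -> option (mQ * option C * move) }.
Arguments mfin {S C m} _.
Arguments mdelta {S C m} _ _.

Definition mmove N i e : option nat :=
  match e with
  | MLeft => if i is j.+1 then Some j else None
  | MStay => Some i
  | MRight => if i.+1 < N then Some i.+1 else None
  end.

Section Run.
Variables (S C : Type) (M : mach S C) (N : nat) (t : nat -> S).

Definition mstep (c : mQ M * nat) : option (mQ M * nat * option C) :=
  if mfin c.1 then None
  else if mdelta c.1 (t c.2) is Some (q, o, e)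
  then omap (fun j => (q, j, o)) (mmove N c.2 e) else None.

Inductive mrun : mQ M * nat -> seq C -> mQ M * nat -> Prop :=
| MRefl c : mrun c [::] c
| MStep c1 c2 o z c3 :
    mstep c1 = Some (c2, o) -> mrun c2 z c3 -> mrun c1 (oseq o ++ z) c3.

Definition mhalt c z := exists c', mfin c'.1 /\ mrun c z c'.

Definition macc z := mhalt (mstart M, 0) z.

Lemma mrun_step c c' o : mstep c = Some (c', o) -> mrun c (oseq o) c'.
Proof. by move=> E; rewrite -[oseq o]cats0; apply: MStep E (MRefl _). Qed.

Lemma mrun_trans c1 z1 c2 z2 c3 :
  mrun c1 z1 c2 -> mrun c2 z2 c3 -> mrun c1 (z1 ++ z2) c3.
Proof.
elim=> [//|d1 d2 o z d3 E _ IH] /IH H.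
by rewrite -catA; apply: MStep E H.
Qed.

Lemma mhalt_fin c z : mfin c.1 -> mhalt c z <-> z = [::].
Proof.
move=> fc; split=> [[c' [_ r]]|->]; last by exists c; split=> //; apply: MRefl.
by case: r fc => // c1 c2 o z' c3; rewrite /mstep => + _ fc; rewrite fc.
Qed.

Lemma mhalt_stuck c z : ~~ mfin c.1 -> mstep c = None -> ~ mhalt c z.
Proof.
move=> fc E [c' [fc' r]].
case: r fc fc' E => [d /negP//|c1 c2 o z' c3 E _ _ _].
by rewrite E.
Qed.

Lemma mhalt_step c c' o z : mstep c = Some (c', o) ->
  mhalt c z <-> exists2 z', z = oseq o ++ z' & mhalt c' z'.
Proof.
move=> E; split=> [[d [fd r]]|[z' -> [d [fd r]]]]; last first.
  by exists d; split=> //; apply: MStep E r.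
case: r fd E => [d0 fd|c1 c2 o' z' c3 E1 r fd E].
  by rewrite /mstep fd.
move: E1 r; rewrite E => -[<- <-] r.
by exists z' => //; exists c3.
Qed.

Lemma mhalt_silent c c' z : mstep c = Some (c', None) -> mhalt c z <-> mhalt c' z.
Proof.
by move=> /mhalt_step->; split=> [[z' -> //]|]; exists z.
Qed.

Lemma mhalt_run c z1 c' z : mrun c z1 c' ->
  mhalt c z <-> exists2 z', z = z1 ++ z' & mhalt c' z'.
Proof.
move=> r; elim: r z => [d|c1 c2 o z0 c3 E _ IH] z.
  by split=> [|[z' ->//]]; exists z.
rewrite (mhalt_step _ E); split=> [[z' -> /IH[z'' -> H]]|[z' -> H]].
  by exists z'' => //; rewrite catA.
by exists (z0 ++ z'); [rewrite catA|apply/IH; exists z'].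
Qed.

Lemma mhalt_det c z z' : mhalt c z -> mhalt c z' -> z = z'.
Proof.
move=> [d [fd r]] /(mhalt_run _ r)[z'' -> /(mhalt_fin _ fd)->].
by rewrite cats0.
Qed.

End Run.

(** Lock-step simulation. One relation gives both implications because related configurations are
    final together, stuck together, or step together with the same output. *)
Lemma mhalt_bisim S S' C (M : mach S C) (M' : mach S' C) N N' t t'
    (Rl : mQ M * nat -> mQ M' * nat -> Prop) :
  (forall c c', Rl c c' -> mfin c.1 = mfin c'.1) ->
  (forall c c', Rl c c' -> ~~ mfin c.1 ->
     match mstep N t c, mstep N' t' c' with
     | Some (d, o), Some (d', o') => o = o' /\ Rl d d'
     | None, None => True
     | _, _ => False
     end) ->
  forall c c' z, Rl c c' -> mhalt N t c z <-> mhalt N' t' c' z.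
Proof.
move=> Hf Hs c c' z; split=> -[d [fd r]].
  elim: r fd c' H => [e fe e' /[dup] ee' /Hf|c1 c2 o y c3 E _ IH fd c' cc'].
    by rewrite fe => /esym fe'; apply/mhalt_fin.
  have nf : ~~ mfin c1.1 by apply/negP => f1; move: E; rewrite /mstep f1.
  have := Hs _ _ cc' nf; rewrite E.
  case E': (mstep N' t' c') => [[d' o']|//] [-> c2d'].
  by apply/(mhalt_step _ E'); exists y => //; apply: IH.
elim: r fd c H => [e fe e' /[dup] ee' /Hf|c1 c2 o y c3 E _ IH fd c0 cc'].
  by rewrite fe => fe'; apply/mhalt_fin.
have nf : ~~ mfin c0.1.
  by rewrite (Hf _ _ cc'); apply/negP => f1; move: E; rewrite /mstep f1.
have := Hs _ _ cc' nf; rewrite E.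
case E': (mstep N t c0) => [[d' o']|//] [<- c2d'].
by apply/(mhalt_step _ E'); exists y => //; apply: IH.
Qed.

Lemma tapeS (A : Type) (w : seq A) k :
  tape w k.+1 = if onth w k is Some a then Sym a else REnd.
Proof. by rewrite /= -onthE. Qed.

Lemma newposE n i e : newpos n i e = mmove n.+2 i e.
Proof. by case: e. Qed.

Definition tacc (A C : Type) (M : mach (tsym A) C) (w : seq A) (z : seq C) : Prop :=
  macc M (size w).+2 (tape w) z.

Lemma In_map (T : eqType) U (f : T -> U) s y :
  List.In y (map f s) <-> exists2 x, x \in s & y = f x.
Proof.
elim: s => [|x s IH] /=; first by split=> // -[].
rewrite IH; split=> [[<-|[x' xs ->]]|[x']].
- by exists x; rewrite ?mem_head.
- by exists x'; rewrite // inE xs orbT.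
- by rewrite inE => /orP[/eqP->|x's] ->; [left|right; exists x'].
Qed.

Lemma gstepP (A C : Type) (M : gsm A C) w p i out b :
  gstep (M := M) w (p, i, out) b <->
  exists x r j, [/\ List.In x (gdelta M), x.1.1.1 = p,
    (tape w i = x.1.1.2 /\ r = x.1.2) \/ (tape w i <> x.1.1.2 /\ r = x.2),
    newpos (size w) i r.2 = Some j & b = (r.1.1, j, out ++ r.1.2)].
Proof.
split=> [st|].
  move E: (p, i, out) st => a st.
  case: st E => p' s q1 a1 e1 q0 a0 e0 i' out' j ins ts mv [-> -> ->].
    by exists (p', s, (q1, a1, e1), (q0, a0, e0)), (q1, a1, e1), j; split=> //; left.
  by exists (p', s, (q1, a1, e1), (q0, a0, e0)), (q0, a0, e0), j; split=> //; right.
move=> [[[[p' s] [[q1 a1] e1]] [[q0 a0] e0]] [r [j [ins /= <- rE mv ->]]]].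
case: rE mv => -[ts ->] /= mv; first exact: GStep1 ins ts mv.
exact: GStep0 ins ts mv.
Qed.

(** * Machines as deterministic 2gsm's: reading a symbol by successive tests *)

Section MachToGsm.
Variables (A : finType) (C : Type) (M : mach (tsym A) C).

Definition syms : seq (tsym A) := [:: LEnd, REnd & map (@Sym A) (enum A)].
Definition sym_idx (s : tsym A) : nat :=
  match s with LEnd => 0 | REnd => 1 | Sym a => (index a (enum A)).+2 end.

Lemma nth_sym_idx s : nth LEnd syms (sym_idx s) = s.
Proof.
case: s => //= a; rewrite (nth_map a) ?nth_index ?mem_enum //.
by rewrite index_mem mem_enum.
Qed.

Lemma sym_idx_lt s : sym_idx s < size syms.
Proof. by case: s => //= a; rewrite size_map !ltnS index_mem mem_enum. Qed.

Lemma sym_idx_nth k : k < size syms -> sym_idx (nth LEnd syms k) = k.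
Proof.
case: k => [|[|k]] //=; rewrite size_map !ltnS => kA.
have /card_gt0P[a _] : 0 < #|A| by rewrite cardE (leq_ltn_trans _ kA).
by rewrite (nth_map a) //= index_uniq ?enum_uniq.
Qed.

(* State [Some (q, k)] tests whether the scanned symbol is the [k]-th one. *)
Notation gst := (option (mQ M * 'I_(size syms).+1)).

(** For a nonfinal state the index [ord_max], which equals [size syms], numbers no symbol, and
    [gsm_of_mach] gives it no instruction: an undefined transition is sent there and the computation
    is stuck. In a final state both branches lead to [None], so the tested symbol is arbitrary. *)
Definition test_instr (p : mQ M * 'I_(size syms).+1) :
    gst * tsym A * (gst * seq C * move) * (gst * seq C * move) :=
  if mfin p.1 then (Some p, LEnd, (None, [::], MStay), (None, [::], MStay))
  else (Some p, nth LEnd syms p.2,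
        (if mdelta p.1 (nth LEnd syms p.2) is Some (q, o, e)
         then (Some (q, ord0), oseq o, e) else (Some (p.1, ord_max), [::], MStay)),
        (Some (p.1, inord p.2.+1), [::], MStay)).

Definition gsm_of_mach : gsm A C :=
  @Gsm A C gst
    (map test_instr [seq p : mQ M * 'I_(size syms).+1 <- enum {: mQ M * 'I_(size syms).+1} |
      mfin p.1 || (p.2 < size syms)])
    (Some (mstart M, ord0)) None.

Lemma gsm_of_machP x : List.In x (gdelta gsm_of_mach) <->
  exists2 p : mQ M * 'I_(size syms).+1, mfin p.1 || (p.2 < size syms) & x = test_instr p.
Proof.
apply: iff_trans (In_map _ _ _) _; split=> -[p].
  by rewrite mem_filter => /andP[H _] ->; exists p.
by move=> H ->; exists p; rewrite // mem_filter H mem_enum.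
Qed.

Lemma test_instr1 p : (test_instr p).1.1.1 = Some p.
Proof. by rewrite /test_instr; case: ifP. Qed.

Lemma gsm_of_mach_wf : gsm_wf gsm_of_mach.
Proof. by move=> x /gsm_of_machP[p _ ->]; rewrite test_instr1. Qed.

Lemma gsm_of_mach_det : gsm_det gsm_of_mach.
Proof.
by move=> x y /gsm_of_machP[p _ ->] /gsm_of_machP[p' _ ->]; rewrite !test_instr1 => -[->].
Qed.

(** The second case covers a failed test as well as the jump to the stuck index: both leave the
    machine configuration and the output unchanged. *)
Lemma gsm_of_mach_step w q k i out b :
  gstep (M := gsm_of_mach) w (Some (q, k), i, out) b ->
  [\/ mfin q /\ b = (None, i, out),
      ~~ mfin q /\ (exists k', b = (Some (q, k'), i, out)) |
      exists q' o j, mstep (size w).+2 (tape w) (q, i) = Some (q', j, o) /\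
                     b = (Some (q', ord0), j, out ++ oseq o)].
Proof.
move=> /gstepP[_ [r [j [/gsm_of_machP[p p_ok ->]]]]].
rewrite test_instr1 => -[pE]; subst p; rewrite /test_instr /=.
case: ifP => fq /=.
  move=> rE mv ->; constructor 1; split=> //.
  by case: rE mv => -[_ ->] /= [->]; rewrite cats0.
case=> [[tE ->]|[_ ->] /= [<-] ->]; last first.
  by constructor 2; rewrite cats0; split; [|eexists].
rewrite -tE; case E: (mdelta q (tape w i)) => [[[q' o] e]|] /= mv ->.
  by constructor 3; exists q', o, j; rewrite /mstep /= fq E -newposE mv.
by case: mv => <-; constructor 2; rewrite cats0; split; [|eexists].
Qed.

Lemma gsm_of_mach_halt w i out c :
  greach (M := gsm_of_mach) w (None, i, out) c -> c = (None, i, out).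
Proof.
move E: (None, i, out) => c0 r; case: r E => // c1 c2 c3 st _ E; move: st.
rewrite -E => /gstepP[x [_ [_ [xin xp _ _ _]]]].
by case: (gsm_of_mach_wf xin).
Qed.

Lemma gsm_of_mach_sound w q k i out j z :
  greach (M := gsm_of_mach) w (Some (q, k), i, out) (None, j, z) ->
  exists2 z', z = out ++ z' & mhalt (size w).+2 (tape w) (q, i) z'.
Proof.
move E: (Some (q, k), i, out) => c; move E': (None, j, z) => c' r.
elim: r q k i out E E' => [{}c q k i out <- //|c1 c2 c3 st r IH q k i out E E'].
subst c1; case: (gsm_of_mach_step st) IH r => [[fq ->]|[fq [k' ->]]|[q' [o [i' [E ->]]]]] IH r.
- exists [::]; last exact/mhalt_fin.
  by move: r; rewrite -E' cats0 => /gsm_of_mach_halt[_ ->].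
- exact: IH erefl E'.
- have [z' -> H] := IH _ _ _ _ erefl E'.
  by exists (oseq o ++ z'); rewrite ?catA //; apply/(mhalt_step _ E); exists z'.
Qed.

Lemma gsm_of_mach_scan w q k i out : ~~ mfin q -> k <= sym_idx (tape w i) ->
  greach (M := gsm_of_mach) w (Some (q, inord k), i, out)
    (Some (q, inord (sym_idx (tape w i))), i, out).
Proof.
move=> fq; move En: (sym_idx (tape w i) - k) => n.
elim: n k En => [|n IH] k En kle.
  have -> : k = sym_idx (tape w i) by apply/eqP; rewrite eqn_leq kle -subn_eq0 En.
  exact: GRefl.
have klt : k < sym_idx (tape w i) by rewrite ltn_neqAle kle andbT; apply/eqP => kE; rewrite kE
  subnn in En.
have kK : k < size syms by apply: ltn_trans klt (sym_idx_lt _).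
apply: (@GTrans _ _ gsm_of_mach w _ (Some (q, inord k.+1), i, out)); last first.
  by apply: IH => //; rewrite subnS En.
apply/gstepP.
exists (test_instr (q, inord k)), (Some (q, inord k.+1), [::], MStay), i.
rewrite test_instr1 /test_instr /= (negbTE fq) inordK ?cats0 ?ltnS ?(ltnW kK) //; split=> //.
  apply/gsm_of_machP; exists (q, inord k); rewrite /= ?(negbTE fq) ?inordK ?ltnS ?(ltnW kK) //.
  by rewrite /test_instr /= (negbTE fq) inordK ?ltnS ?(ltnW kK).
right; split=> // tE; move: klt; rewrite tE sym_idx_nth ?ltnn //.
Qed.

Lemma gsm_of_mach_complete w q i out z :
  mhalt (size w).+2 (tape w) (q, i) z ->
  exists j, greach (M := gsm_of_mach) w (Some (q, ord0), i, out) (None, j, out ++ z).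
Proof.
move=> [[q' i'] [/= fq' r]]; move E: (q, i) r => c r; move E': (q', i') r => c' r.
elim: r q i out E E' => [_ q i out <- [Eq Ei]|c1 [q2 i2] o z' c3 E1 r IH q i out E E'].
  subst q' i'; exists i; rewrite cats0.
  apply: (@GTrans _ _ gsm_of_mach w _ (None, i, out)); last exact: GRefl.
  apply/gstepP.
  exists (test_instr (q, ord0)), (None, [::], MStay), i.
  rewrite test_instr1 /test_instr /= fq' cats0; split=> //.
    by apply/gsm_of_machP; exists (q, ord0); rewrite /= ?fq' // /test_instr /= fq'.
  by case: (tape w i) => [||a]; [left|right|right].
subst c1; have [j r'] := IH q2 i2 (out ++ oseq o) erefl E'.
exists j; rewrite catA; move: E1; rewrite /mstep /=; case: ifPn => // fq.
case Ed: mdelta => [[[q1 o1] e]|] //; case Em: mmove => [j1|] //= [? ? ?]; subst q1 o1 j1.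
have grT a b d : greach (M := gsm_of_mach) w a b -> greach (M := gsm_of_mach) w b d ->
    greach (M := gsm_of_mach) w a d.
  by elim=> // d1 d2 d3 s12 _ IH' /IH'; apply: GTrans.
have := gsm_of_mach_scan out fq (leq0n (sym_idx (tape w i))).
rewrite (_ : inord 0 = ord0); last by apply/val_inj; rewrite /= inordK.
move=> /grT; apply; apply: (@GTrans _ _ gsm_of_mach w _ _ _ _ r'); apply/gstepP.
set k := sym_idx _; have kK : k < (size syms).+1 by rewrite ltnS ltnW ?sym_idx_lt.
exists (test_instr (q, inord k)), (Some (q2, ord0), oseq o, e), i2.
rewrite test_instr1 /test_instr /= (negbTE fq) inordK // nth_sym_idx Ed newposE; split=> //.
  apply/gsm_of_machP; exists (q, inord k); rewrite /= ?(negbTE fq) ?inordK ?sym_idx_lt //.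
  by rewrite /test_instr /= (negbTE fq) inordK // nth_sym_idx Ed.
by left.
Qed.

Lemma gsm_of_machE w z : gsm_rel gsm_of_mach w z <-> tacc M w z.
Proof.
split=> [[j /gsm_of_mach_sound[z' -> //]]|].
by move=> /(gsm_of_mach_complete [::])[j r]; exists j.
Qed.

End MachToGsm.

(** * Deterministic 2gsm's as machines that emit letter by letter *)

Section GsmToMach.
Variables (A : finType) (C : Type) (M : gsm A C).
Hypotheses (M_wf : gsm_wf M) (M_det : gsm_det M).

Definition tsym_eq (s s' : tsym A) : bool :=
  match s, s' with
  | LEnd, LEnd | REnd, REnd => true
  | Sym a, Sym b => a == b
  | _, _ => false
  end.

Lemma tsym_eqP s s' : reflect (s = s') (tsym_eq s s').
Proof.
case: s s' => [||a] [||b]; do ?[by constructor].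
by apply: (iffP eqP) => [->|[]].
Qed.

Definition instr_of (q : gQ M) := ohead [seq x <- gdelta M | x.1.1.1 == q].

Definition act (q : gQ M) (s : tsym A) : option (gQ M * seq C * move) :=
  if instr_of q is Some x then Some (if tsym_eq s x.1.1.2 then x.1.2 else x.2) else None.

Lemma In_filter T (p : pred T) s (x : T) :
  List.In x (filter p s) <-> List.In x s /\ p x.
Proof.
elim: s => [|y s IH] /=; first by split=> // -[].
case: ifP => py /=; rewrite IH; split.
- by move=> [<-|[]]; auto.
- by move=> [[]]; auto.
- by move=> []; auto.
- by move=> [[<-|//] ]; rewrite ?py.
Qed.

Lemma instr_ofP x q : instr_of q = Some x <-> List.In x (gdelta M) /\ x.1.1.1 = q.
Proof.
rewrite /instr_of; split=> [|[xin xq]].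
  case E: (filter _ _) => [|y s] //= [<-].
  have /In_filter[yin /eqP //] : List.In y [seq x <- gdelta M | x.1.1.1 == q].
  by rewrite E; left.
have : List.In x [seq x <- gdelta M | x.1.1.1 == q] by apply/In_filter; rewrite xq.
case E: (filter _ _) => [|y s] // _ /=; congr Some.
have /In_filter[yin /eqP yq] : List.In y [seq x <- gdelta M | x.1.1.1 == q].
  by rewrite E; left.
by apply: M_det => //; rewrite yq xq.
Qed.

Lemma act_step w q i out b :
  gstep (M := M) w (q, i, out) b <->
  exists q' z e j, [/\ act q (tape w i) = Some (q', z, e),
    newpos (size w) i e = Some j & b = (q', j, out ++ z)].
Proof.
rewrite gstepP /act; split.
  move=> [x [[[q' z] e] [j [xin xq rE mv ->]]]].
  have /instr_ofP -> : List.In x (gdelta M) /\ x.1.1.1 = q by [].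
  exists q', z, e, j; split=> //.
  by case: rE => -[/tsym_eqP tE ->]; rewrite ?tE // (negbTE tE).
move=> [q' [z [e [j [E mv ->]]]]]; move: E.
case E: instr_of => [x|//] [rE]; have [xin xq] := (instr_ofP x q).1 E.
exists x, (q', z, e), j; split=> //.
by move: rE; case: tsym_eqP => tE ->; [left|right].
Qed.

Lemma act_fin s : act (gqf M) s = None.
Proof.
rewrite /act; case E: instr_of => [x|//].
by have [/M_wf] := (instr_ofP x _).1 E.
Qed.

Definition out_bound : nat := \max_(q : gQ M)
  if instr_of q is Some x then maxn (size x.1.2.1.2) (size x.2.1.2) else 0.

Lemma act_size q s q' z e : act q s = Some (q', z, e) -> size z <= out_bound.
Proof.
rewrite /act; case E: instr_of => [x|//] [rE].
apply: leq_trans (leq_bigmax q); rewrite E.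
by move: rE; case: ifP => _ ->; rewrite /= leq_max leqnn ?orbT.
Qed.

(* State [(q, k)] has already emitted the first [k] letters of the current output. *)
Definition mach_of_gsm : mach (tsym A) C :=
  @Mach _ C (gQ M * 'I_out_bound.+1)%type (gqin M, ord0) (fun q => q.1 == gqf M)
  (fun q s => if act q.1 s is Some (q', z, e) then
      if q.2.+1 < size z then Some ((q.1, inord q.2.+1), onth z q.2, MStay)
      else Some ((q', ord0), onth z q.2, e)
    else None).

Lemma mach_of_gsm_emit w q i q' z e j (k : 'I_out_bound.+1) :
  act q (tape w i) = Some (q', z, e) -> newpos (size w) i e = Some j ->
  mrun (M := mach_of_gsm) (size w).+2 (tape w) ((q, k), i) (drop k z) ((q', ord0), j).
Proof.
move=> E mv; move En: (size z - k) => n.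
have fq : (q == gqf M) = false by apply/eqP => qE; rewrite qE act_fin in E.
elim: n k En => [|n IH] k En.
  have kz : size z <= k by rewrite -subn_eq0 En.
  rewrite drop_oversize //; apply: (@mrun_step _ _ mach_of_gsm _ _ _ _ None).
  by rewrite /mstep /= fq E ltnNge leqW //= -newposE mv onth_default.
have kz : k < size z by rewrite -subn_gt0 En.
case Ez: (onth z k) (onthTE z k) => [c|]; last by rewrite kz.
have zk : drop k z = c :: drop k.+1 z.
  rewrite (drop_nth c) //; congr (_ :: _).
  by rewrite -odflt_onth Ez.
move=> _; case: (ltnP k.+1 (size z)) => k1z; last first.
  rewrite zk (drop_oversize k1z); apply: (@mrun_step _ _ mach_of_gsm _ _ _ _ (Some c)).
  by rewrite /mstep /= fq E ltnNge k1z /= -newposE mv Ez.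
rewrite zk; apply: (@MStep _ _ mach_of_gsm _ _ _ ((q, inord k.+1), i) (Some c)).
  by rewrite /mstep /= fq E k1z /= Ez.
have k1K : k.+1 < out_bound.+1 by rewrite ltnS ltnW // (leq_trans k1z (act_size E)).
by have := IH (inord k.+1); rewrite inordK // subnS En; apply.
Qed.

Lemma mach_of_gsm_complete w q i out q' j z :
  greach (M := M) w (q, i, out) (q', j, z) ->
  exists2 z', z = out ++ z' &
    mrun (M := mach_of_gsm) (size w).+2 (tape w) ((q, ord0), i) z' ((q', ord0), j).
Proof.
move E: (q, i, out) => c; move E': (q', j, z) => c' r.
elim: r q i out E E' => [c0 q i out <- [-> -> ->]|c1 c2 c3 st r IH q i out E E'].
  by exists [::]; rewrite ?cats0 //; apply: MRefl.
move: st; rewrite -E => /act_step[q1 [a [e [j1 [aE mv c2E]]]]].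
have [z' -> r'] := IH _ _ _ (esym c2E) E'.
exists (a ++ z'); first by rewrite catA.
by have := mach_of_gsm_emit ord0 aE mv; rewrite drop0 => /mrun_trans; apply.
Qed.

(** The machine may be in the middle of emitting the output [a] of an instruction that the 2gsm
    executes at once. The 2gsm is kept before that instruction, so the [k] letters already emitted
    reappear in front of [z]. *)
Lemma mach_of_gsm_sound w q (k : 'I_out_bound.+1) i z out :
  mhalt (M := mach_of_gsm) (size w).+2 (tape w) ((q, k), i) z ->
  (k = ord0 \/ exists q' a e, act q (tape w i) = Some (q', a, e) /\ k < size a) ->
  exists j, greach (M := M) w (q, i, out) (gqf M, j,
     out ++ (if act q (tape w i) is Some (_, a, _) then take k a else [::]) ++ z).
Proof.
move=> [[[qf kf] i'] [/= /eqP-> r]].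
move E: ((q, k), i) r => c r; move E': ((gqf M, kf), i') r => c' r.
elim: r q k i out E E' => [_ q k i out <- [Eq Ek Ei] _|c1 [[q2 k2] i2] o z' c3 st r IH q k i out
  E E' kok].
  by exists i; rewrite -Eq act_fin !cats0; apply: GRefl.
move: st; rewrite -E /mstep /=; case: eqP => // fq.
case Ea: (act q (tape w i)) kok => [[[q' a] e]|//] kok.
have E1 := IH q2 k2 i2 _ erefl E'.
have ko : take k a ++ oseq (onth a k) = take k.+1 a.
  case Ez: (onth a k) (onthTE a k) => [c0|] /= ka.
    by rewrite (take_nth c0) -?ka // cats1 -odflt_onth Ez.
  by rewrite cats0 !take_oversize // ?leqW // leqNgt -ka.
case: ifPn => k1a /=.
  move=> [? ? ? ?]; subst q2 k2 i2 o.
  have k1K : k.+1 < out_bound.+1 by rewrite ltnS ltnW // (leq_trans k1a (act_size Ea)).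
  have [|j] := E1 out; first by right; exists q', a, e; rewrite inordK.
  rewrite Ea inordK // -ko => H; exists j.
  by rewrite -catA in H.
case mv: mmove => [j1|//] [? ? ? ?]; subst q2 k2 j1 o.
have [|j] := E1 (out ++ a); first by left.
move=> H; exists j.
have aE : take k a ++ oseq (onth a k) = a by rewrite ko take_oversize // leqNgt.
apply: (@GTrans _ _ M w _ (q', i2, out ++ a)).
  apply/act_step; exists q', a, e, i2; split=> //.
rewrite (catA (take k a)) aE catA.
by move: H; case: act => [[[? ?] ?]|]; rewrite ?take0.
Qed.

Lemma mach_of_gsmE w z : gsm_rel M w z <-> tacc mach_of_gsm w z.
Proof.
split=> [[j /mach_of_gsm_complete[z' -> r]]|H].
  by exists ((gqf M, ord0), j); split; rewrite /= ?eqxx.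
have [|j] := mach_of_gsm_sound [::] H; first by left.
by case: act => [[[? ?] ?]|]; rewrite /= ?take0; exists j.
Qed.

End GsmToMach.

(** * Checking a local condition on the tape before a run *)

Section Sweep.
Variables (I : finType) (C : Type) (M : mach (tsym I) C).
Variables (ok : option I -> I -> bool) (okend : option I -> bool).

Fixpoint chain (p : option I) (v : seq I) : bool :=
  if v is x :: v' then ok p x && chain (Some x) v' else okend p.

(* [inl p]: checking, [p] being the previous letter; [inr None]: going back to
   the left end; [inr (Some q)]: running [M]. *)
Definition sweep : mach (tsym I) C :=
  @Mach _ C (option I + option (mQ M))%type (inl None)
  (fun q => if q is inr (Some q') then mfin q' else false)
  (fun q s => match q, s with
   | inl p, LEnd => Some (inl p, None, MRight)
   | inl p, Sym x => if ok p x then Some (inl (Some x), None, MRight) else None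
   | inl p, REnd => if okend p then Some (inr None, None, MLeft) else None
   | inr None, LEnd => Some (inr (Some (mstart M)), None, MStay)
   | inr None, Sym _ => Some (inr None, None, MLeft)
   | inr None, REnd => None
   | inr (Some q'), _ =>
       if mdelta q' s is Some (q2, o, e) then Some (inr (Some q2), o, e) else None
   end).

Variable v : seq I.
Local Notation halts := (mhalt (M := sweep) (size v).+2 (tape v)).

Lemma sweep_run q i z :
  halts (inr (Some q), i) z <-> mhalt (size v).+2 (tape v) (q, i) z.
Proof.
apply: (@mhalt_bisim _ _ _ sweep M _ _ _ _
  (fun c c' => c = (inr (Some c'.1), c'.2))) => //= [c c' ->|c [q' i'] -> nf] //.
rewrite /mstep /= (negbTE nf); case: mdelta => [[[q2 o] e]|] //.
by case: mmove.
Qed.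

Lemma sweep_back k z : k <= size v ->
  halts (inr None, k) z <-> tacc M v z.
Proof.
elim: k => [|k IH] kv; last first.
  rewrite -(IH (ltnW kv)); apply: mhalt_silent.
  rewrite /mstep [fst _]/= [snd _]/= tapeS.
  by move: kv; rewrite -onthTE; case: (onth v k).
rewrite /tacc /macc -sweep_run; exact: mhalt_silent.
Qed.

(** The prefix [v1] has been checked, with last letter [p]. A failing test leaves the machine stuck
    in a nonfinal state, which refutes halting. *)
Lemma sweep_check p v1 v2 z : v = v1 ++ v2 ->
  halts (inl p, (size v1).+1) z <-> chain p v2 /\ tacc M v z.
Proof.
elim: v2 v1 p => [|x v2 IH] v1 p vE.
  have E : mstep (M := sweep) (size v).+2 (tape v) (inl p, (size v1).+1) =
     if okend p then Some (inr None, size v, None) else None.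
    by rewrite /mstep /= -onthE onth_default vE cats0 //; case: (okend p).
  rewrite /=; case: (okend p) E => E; first by rewrite (mhalt_silent _ E) sweep_back //; split=>
    [|[]].
  by split=> [|[]] // H; case: (mhalt_stuck _ E H).
have vx : onth v (size v1) = Some x by rewrite vE onth_cat ltnn subnn.
have E : mstep (M := sweep) (size v).+2 (tape v) (inl p, (size v1).+1) =
     if ok p x then Some (inl (Some x), (size v1).+2, None) else None.
  rewrite /mstep /= -onthE vx /=; case: (ok p x) => //=.
  by have := onthTE v (size v1); rewrite vx /= -[_.+3 <= _]/(size v1 < size v) => <-.
rewrite /=; case: (ok p x) E => E.
  rewrite (mhalt_silent _ E); have := IH (rcons v1 x) (Some x); rewrite size_rcons.
  by apply; rewrite cat_rcons.
by split=> [|[]] // H; case: (mhalt_stuck _ E H).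
Qed.

Lemma sweepE z : tacc sweep v z <-> chain None v /\ tacc M v z.
Proof. by rewrite -(@sweep_check _ [::]) //; apply: mhalt_silent. Qed.

End Sweep.

Section Shift.
Variables (I : finType) (C : Type) (M : mach (tsym I) C).

(** A marked relabelling turns the left marker into a letter of its own; here that letter is [None],
    and it plays the left end of the tape for [M]. *)
Definition unshift_sym (s : tsym (option I)) : tsym I :=
  match s with Sym (Some x) => Sym x | REnd => REnd | _ => LEnd end.

(* Moving left from the extra first letter is forbidden: [M] would leave its tape. *)
Definition shift : mach (tsym (option I)) C :=
  @Mach _ C (option (mQ M)) None (fun q => if q is Some q' then mfin q' else false)
  (fun q s => if q is Some q' then
       match s, mdelta q' (unshift_sym s) with
       | LEnd, _ | Sym None, Some (_, _, MLeft) => None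
       | _, Some (q2, o, e) => Some (Some q2, o, e)
       | _, None => None
       end
     else Some (Some (mstart M), None, MRight)).

Lemma shiftE v z : tacc shift (None :: map Some v) z <-> tacc M v z.
Proof.
transitivity (mhalt (M := shift) (size v).+3 (tape (None :: map Some v)) (Some (mstart M), 1) z).
  by rewrite /tacc /= size_map; apply: mhalt_silent.
apply: (@mhalt_bisim _ _ _ shift M _ _ _ _ (fun c c' => c = (Some c'.1, c'.2.+1))) => // [c c'
  -> //|].
move=> c [q [|i]] -> /= nf; rewrite /mstep /= (negbTE nf) -?onthE.
  by case: (mdelta q _) => [[[q2 o] []]|].
rewrite onth_map; case: (onth v i) => [x|] /=;
  by case: (mdelta q _) => [[[q2 o] []]|] //=; rewrite !ltnS; case: ifP.
Qed.

End Shift.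

(** * Walking along the output *)

Lemma onth_split T (s : seq T) i x :
  onth s i = Some x -> exists s1 s2, s = s1 ++ x :: s2 /\ size s1 = i.
Proof.
elim: s i => [|y s IH] [|i] //=; first by move=> [->]; exists [::], s.
by move=> /IH[s1 [s2 [-> <-]]]; exists (y :: s1), s2.
Qed.

Definition set_bits k (b : {set 'I_k}) (X : nat) : bool :=
  if insub X is Some o then o \in b else false.

Definition word_sets L k (s : seq (L * {set 'I_k})) : valn :=
  fun p => if onth s p is Some t then set_bits t.2 else xpred0.

Section Walk.
Variables (L : finType) (np : nat) (Q : finType).
Variables (d : Q -> L * (nat -> bool) * (nat -> bool) -> Q) (q0 : Q).
Local Notation pletter := (L * {set 'I_np})%type.

Definition read (t : pletter) (b0 b1 : bool) (q : Q) : Q :=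
  d q (t.1, (fun y => (y == 0) && b0 || (y == 1) && b1), set_bits t.2).
Definition skip (q : Q) (t : pletter) : Q := read t false false q.

(* A letter, the parameters containing its position, the state of the automaton
   before it, and the action on states of the rest of the word after it. *)
Definition info : finType := (pletter * Q * {ffun Q -> Q})%type.
Definition i_pre (x : info) : Q := x.1.2.
Definition i_post (x : info) : {ffun Q -> Q} := x.2.
Definition pass (q : Q) (x : info) : Q := skip q x.1.1.

Variable Fdom : pred Q.

(** The state before a letter is forced from left to right, starting with [q0]; the action after a
    letter is forced from right to left, ending with the identity in [okend]. Both are conditions on
    neighbouring letters, so one sweep can check them. *)
Definition ok (p : option info) (x : info) : bool :=
  (i_pre x == if p is Some y then pass (i_pre y) y else q0) &&
  (if p is Some y then i_post y == [ffun q => i_post x (pass q x)] else true).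

Definition okend (p : option info) : bool :=
  if p is Some y then (i_post y == [ffun q => q]) && Fdom (pass (i_pre y) y)
  else Fdom q0.

Lemma chain_pre p v1 x v2 : chain ok okend p (v1 ++ x :: v2) ->
  i_pre x = foldl pass (if p is Some y then pass (i_pre y) y else q0) v1 /\
  chain ok okend (Some x) v2.
Proof.
elim: v1 p => [|y v1 IH] p /= /andP[/andP[/eqP E E'] H] //.
by have [-> ?] := IH _ H; rewrite /= E.
Qed.

Lemma chain_post x v : chain ok okend (Some x) v ->
  i_post x =1 (fun q => foldl pass q v) /\ Fdom (foldl pass (pass (i_pre x) x) v).
Proof.
elim: v x => [|y v IH] x /=; first by case/andP=> /eqP-> H; split=> // q; rewrite ffunE.
move=> /andP[/andP[/eqP E /eqP E'] /IH[Ey H]]; split; last by rewrite -E.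
by move=> q; rewrite E' ffunE Ey.
Qed.

Lemma chain_dom v : chain ok okend None v -> Fdom (foldl pass q0 v).
Proof.
by case: v => [|x v] //= /andP[/andP[/eqP E _] /chain_post[_]]; rewrite E.
Qed.

Fixpoint annotate (q : Q) (s : seq pletter) : seq info :=
  if s is t :: s' then (t, q, [ffun q' => foldl skip q' s']) :: annotate (skip q t) s'
  else [::].

Lemma annotate_proj q s : [seq x.1.1 | x <- annotate q s] = s.
Proof. by elim: s q => //= t s IH q; rewrite IH. Qed.

Lemma foldl_pass q (v : seq info) : foldl pass q v = foldl skip q [seq x.1.1 | x <- v].
Proof. by elim: v q => //= x v IH q; rewrite IH. Qed.

Lemma chain_annotate s : Fdom (foldl skip q0 s) -> chain ok okend None (annotate q0 s).
Proof.
suff H t q s' : Fdom (foldl skip (skip q t) s') ->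
    chain ok okend (Some (t, q, [ffun q' => foldl skip q' s'])) (annotate (skip q t) s').
  by case: s => [//|t s] /= /H ->; rewrite /ok /= eqxx.
elim: s' t q => [|t' s' IH] t q /= F.
  by rewrite /okend F andbT; apply/eqP/ffunP => q'; rewrite /i_post /= !ffunE.
rewrite IH // andbT /ok /= eqxx /=; apply/eqP/ffunP => q'.
by rewrite /i_post /= !ffunE.
Qed.

(** A position beyond the end of the word marks nothing. Taking [j] to be the length therefore means
    that node variable 1 is absent. *)
Definition run2 (s : seq pletter) i j :=
  foldl d q0 (code [seq t.1 | t <- s] (pos2 i j) (word_sets s)).

Definition read2 i j (q : Q) (p : nat * pletter) : Q := read p.2 (p.1 == i) (p.1 == j) q.

Lemma run2E s i j : run2 s i j =
  foldl (read2 i j) q0 (zip (iota 0 (size s)) s).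
Proof.
rewrite /run2 (_ : pos2 i j = (fun p => pos2 i j (p + 0))); last first.
  by apply/funext => p; rewrite addn0.
elim: s 0 q0 => //= t s IH m q; rewrite -IH; congr foldl.
rewrite (@eq_code _ _ _ (fun p => pos2 i j (p + m.+1)) _ (word_sets s)) // => p _.
by split=> //; rewrite addSnnS.
Qed.

Lemma foldl_skip m q s i j : (i < m) || (m + size s <= i) -> (j < m) || (m + size s <= j) ->
  foldl (read2 i j) q (zip (iota m (size s)) s) =
  foldl skip q s.
Proof.
elim: s m q => //= t s IH m q Hi Hj.
have ne l : (l < m) || (m + (size s).+1 <= l) -> (m == l) = false.
  by case/orP=> [/gtn_eqF//|H]; apply: ltn_eqF; apply: leq_trans H; rewrite -addSnnS leq_addr.
have nx l : (l < m) || (m + (size s).+1 <= l) -> (l < m.+1) || (m.+1 + size s <= l).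
  by rewrite addSnnS => /orP[/leqW ->|->]; rewrite ?orbT.
by rewrite IH ?nx // /read2 /= !ne.
Qed.

Lemma run2_1 s1 t s2 i j (b0 := size s1 == i) (b1 := size s1 == j) :
  b0 || (size (s1 ++ t :: s2) <= i) -> b1 || (size (s1 ++ t :: s2) <= j) ->
  run2 (s1 ++ t :: s2) i j = foldl skip (read t b0 b1 (foldl skip q0 s1)) s2.
Proof.
rewrite size_cat /= => Hi Hj; rewrite run2E size_cat iotaD zip_cat ?size_iota // foldl_cat.
have G l : (size s1 == l) || (size s1 + (size s2).+1 <= l) ->
    ((l < 0) || (0 + size s1 <= l)) * ((l < (size s1).+1) || ((size s1).+1 + size s2 <= l)).
  rewrite add0n addSnnS => /orP[/eqP->|H]; first by rewrite leqnn ltnSn.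
  by rewrite H orbT (leq_trans (leq_addr _ _) H).
by rewrite (@foldl_skip 0) ?G // ?add0n /= (@foldl_skip (size s1).+1) ?G.
Qed.

(** Either of the two variables may come first, so that walks to the right and to the left share
    this computation. *)
Lemma run2_2 s1 t m t' s2 i j (b := fun l l' => (size s1 == l) && (size s1 + (size m).+1 == l')) :
  b i j || b j i ->
  run2 (s1 ++ t :: m ++ t' :: s2) i j =
  foldl skip (read t' (b j i) (b i j) (foldl skip (read t (b i j) (b j i) (foldl skip q0 s1))
    m)) s2.
Proof.
move=> Hb; rewrite run2E !size_cat iotaD zip_cat ?size_iota // foldl_cat /= size_cat.
rewrite iotaD zip_cat ?size_iota // foldl_cat /= !add0n.
have ne (a : nat) n : (a == a + n.+1) = false by rewrite -{1}(addn0 a) eqn_add2l.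
have en (a : nat) n : (a + n.+1 == a) = false by rewrite eq_sym ne.
have ij : (i, j) = (size s1, size s1 + (size m).+1) \/ (j, i) = (size s1, size s1 + (size m).+1).
  by case/orP: Hb => /andP[/eqP-> /eqP->]; [left|right].
have G l : (l = size s1) \/ (l = size s1 + (size m).+1) ->
   [/\ (l < 0) || (0 + size s1 <= l),
       (l < (size s1).+1) || ((size s1).+1 + size m <= l) &
       (l < (size s1 + (size m).+1).+1) || ((size s1 + (size m).+1).+1 + size s2 <= l)].
  by case=> ->; rewrite addSnnS ?leqnn ?leq_addr ?ltnSn ?orbT ?ltnS ?leq_addr //.
have [/G[i1 i2 i3] /G[j1 j2 j3]] : (i = size s1 \/ i = size s1 + (size m).+1) /\
    (j = size s1 \/ j = size s1 + (size m).+1) by case: ij => -[-> ->]; auto.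
rewrite (foldl_skip _ i1 j1) /read2 /= -?/(read2 i j) (foldl_skip _ i2 j2).
rewrite addSnnS (foldl_skip _ i3 j3).
by case: ij => -[-> ->]; rewrite /b !eqxx ?ne ?en.
Qed.

Definition holds (F : pred Q) (x : info) : bool := F (i_post x (read x.1.1 true false (i_pre x))).
Definition holds_same (F : pred Q) (x : info) : bool := F (i_post x (read x.1.1 true true (i_pre
  x))).
(** Node variable 0 lies to the left of [x], and [q] is the state in which the automaton arrives at
    [x] after having read that mark. *)
Definition holds_right (F : pred Q) (q : Q) (x : info) : bool := F (i_post x (read x.1.1 false
  true q)).
(** Node variable 0 lies to the right of [x], and [f] is the action of everything after [x], that
    mark included. A walk to the left has to carry a function on states where a walk to the right
    carries a state. *)
Definition holds_left (F : pred Q) (f : {ffun Q -> Q}) (x : info) : bool :=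
  F (f (read x.1.1 false true (i_pre x))).

Section Valid.
Variable v : seq info.
Hypothesis v_ok : chain ok okend None v.
Let s := [seq x.1.1 | x <- v].
Definition accepts (F : pred Q) i j := F (run2 s i j).

Lemma v_split v1 x v2 : v = v1 ++ x :: v2 ->
  i_pre x = foldl pass q0 v1 /\ i_post x =1 (fun q => foldl pass q v2).
Proof.
move=> E; move: v_ok; by rewrite E => /chain_pre[? /chain_post[? _]].
Qed.

Lemma holdsE F v1 x v2 : v = v1 ++ x :: v2 ->
  accepts F (size v1) (size v) = holds F x.
Proof.
move=> vE; have [E1 E2] := v_split vE; rewrite /holds E2 E1 /accepts /s !foldl_pass vE.
rewrite map_cat /= run2_1 !size_map ?eqxx // ?size_cat /= ?size_map ?leqnn ?orbT //.
by rewrite -{1}(addn0 (size v1)) eqn_add2l.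
Qed.

Lemma holds_sameE F v1 x v2 : v = v1 ++ x :: v2 ->
  accepts F (size v1) (size v1) = holds_same F x.
Proof.
move=> vE; have [E1 E2] := v_split vE; rewrite /holds_same E2 E1 /accepts /s !foldl_pass vE.
by rewrite map_cat /= run2_1 !size_map ?eqxx.
Qed.

Lemma holds_rightE F v1 x m y v2 : v = v1 ++ x :: m ++ y :: v2 ->
  accepts F (size v1) (size v1 + (size m).+1) =
  holds_right F (foldl pass (read x.1.1 true false (i_pre x)) m) y.
Proof.
move=> vE; have [E1 E2] := v_split vE.
have [|E3 E4] := @v_split (v1 ++ x :: m) y v2; first by rewrite -catA.
have neS : (size v1 == size v1 + (size m).+1) = false by rewrite -{1}(addn0 (size v1)) eqn_add2l.
rewrite /holds_right E4 E1 /accepts /s !foldl_pass vE !map_cat /= map_cat /= run2_2 !size_map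
  !eqxx //.
by rewrite neS.
Qed.

Lemma holds_leftE F v1 y m x v2 : v = v1 ++ y :: m ++ x :: v2 ->
  accepts F (size v1 + (size m).+1) (size v1) =
  holds_left F [ffun q => i_post x (read x.1.1 true false (foldl pass q m))] y.
Proof.
move=> vE; have [E1 E2] := v_split vE.
have [|E3 E4] := @v_split (v1 ++ y :: m) x v2; first by rewrite -catA.
have neS : (size v1 == size v1 + (size m).+1) = false by rewrite -{1}(addn0 (size v1)) eqn_add2l.
rewrite /holds_left ffunE E4 E1 /accepts /s !foldl_pass vE !map_cat /= map_cat /= run2_2
  !size_map !eqxx ?orbT //.
by rewrite neS.
Qed.
End Valid.

(** * The walk from output node to output node *)

Section Walker.
Variables (K C : finType).
Variables (Ffirst Flast Fright : K -> pred Q) (Femit : K -> C -> pred Q) (Fnext : K -> K -> pred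
  Q).

Definition wstate : finType := (bool + K + (K * Q) + (K * {ffun Q -> Q}))%type.
Definition w_seek (b : bool) : wstate := inl (inl (inl b)).
Definition w_at (c : K) : wstate := inl (inl (inr c)).
Definition w_right (c : K) (q : Q) : wstate := inl (inr (c, q)).
Definition w_left (c : K) (f : {ffun Q -> Q}) : wstate := inr (c, f).

(* [w_seek]: looking for the first output node, or ([true]) halting; [w_at c]: at
   copy [c] of an output node; [w_right]/[w_left]: looking for its successor. *)
Definition wdelta (w : wstate) (a : tsym info) : option (wstate * option C * move) :=
  match w, a with
  | inl (inl (inl true)), _ => None
  | inl (inl (inl false)), LEnd => Some (w_seek false, None, MRight)
  | inl (inl (inl false)), REnd => Some (w_seek true, None, MStay)
  | inl (inl (inl false)), Sym x =>
      if [pick c | holds (Ffirst c) x] is Some c then Some (w_at c, None, MStay)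
      else Some (w_seek false, None, MRight)
  | inl (inl (inr c)), Sym x =>
      let o := [pick a | holds (Femit c a) x] in
      if holds (Flast c) x then Some (w_seek true, o, MStay)
      else if [pick c2 | holds_same (Fnext c c2) x] is Some c2 then Some (w_at c2, o, MStay)
      else if holds (Fright c) x
        then Some (w_right c (read x.1.1 true false (i_pre x)), o, MRight)
      else Some (w_left c [ffun q => i_post x (read x.1.1 true false q)], o, MLeft)
  | inl (inr (c, q)), Sym x =>
      if [pick c2 | holds_right (Fnext c c2) q x] is Some c2 then Some (w_at c2, None, MStay)
      else Some (w_right c (pass q x), None, MRight)
  | inr (c, f), Sym x =>
      if [pick c2 | holds_left (Fnext c c2) f x] is Some c2 then Some (w_at c2, None, MStay)
      else Some (w_left c [ffun q => f (pass q x)], None, MLeft)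
  | _, _ => None
  end.

Definition walker : mach (tsym info) C :=
  @Mach _ C wstate (w_seek false) (fun w => w == w_seek true) wdelta.

(** [N] lists the output nodes, as pairs of position and copy, in the order of the output string;
    [em k] is the letter emitted at the [k]-th of them. The hypotheses below state what the
    accepting sets say about this list. *)
Variables (v : seq info) (N : seq (nat * K)) (em : nat -> option C).
Hypothesis v_ok : chain ok okend None v.
Local Notation acc := (accepts v).
Local Notation n := (size v).
Hypothesis N_lt : forall p, p \in N -> p.1 < n.
Hypothesis N_first : forall i c, i < n -> acc (Ffirst c) i n = (ohead N == Some (i, c)).
Hypothesis N_last : forall k i c, onth N k = Some (i, c) -> acc (Flast c) i n = (k.+1 == size N).
Hypothesis N_right : forall k i c j c', onth N k = Some (i, c) -> onth N k.+1 = Some (j, c') ->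
  acc (Fright c) i n = (i < j).
Hypothesis N_next : forall k i c j c', onth N k = Some (i, c) -> onth N k.+1 = Some (j, c') ->
  forall j2 c2, j2 < n -> acc (Fnext c c2) i j2 = ((j2, c2) == (j, c')).
Hypothesis N_emit : forall k i c, onth N k = Some (i, c) ->
  forall a, acc (Femit c a) i n = (em k == Some a).

Local Notation run := (mrun (M := walker) n.+2 (tape v)).

Lemma pick_unique (T : finType) (P : pred T) x : P =1 pred1 x -> [pick y | P y] = Some x.
Proof.
move=> PE; case: pickP => [y|/(_ x)]; rewrite PE /= ?eqxx // => /eqP-> //.
Qed.

Lemma pick_none (T : finType) (P : pred T) : P =1 pred0 -> [pick y | P y] = None.
Proof. by move=> PE; case: pickP => // y; rewrite PE. Qed.

Lemma tape_split v1 x v2 p : v = v1 ++ x :: v2 -> p = size v1 -> tape v p.+1 = Sym x.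
Proof. by move=> -> ->; rewrite tapeS onth_cat ltnn subnn. Qed.

(** The node left is at [x], the letters [m] have been crossed and [m2] lies ahead of the target
    [y]. By uniqueness of the successor no test succeeds inside [m2], and at [y] it succeeds for the
    copy [c'] only. *)
Lemma walk_right c q c' i j v1 x m m2 y v2 :
  v = v1 ++ x :: m ++ m2 ++ y :: v2 -> i = size v1 -> j = size v1 + (size m + size m2).+1 ->
  (forall j2 c2, j2 < n -> acc (Fnext c c2) i j2 = ((j2, c2) == (j, c'))) ->
  q = foldl pass (read x.1.1 true false (i_pre x)) m ->
  run (w_right c q, (size v1 + (size m).+1).+1) [::] (w_at c', j.+1).
Proof.
move=> + iE + Hn; subst i; elim: m2 m q => [|y' m2 IH] m q vE jE qE.
  apply: (@mrun_step _ _ walker _ _ _ _ None).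
  have tE : tape v (size v1 + (size m).+1).+1 = Sym y.
    by apply: (tape_split (v1 := v1 ++ x :: m)); rewrite ?size_cat // vE -catA.
  rewrite /mstep [fst _]/= [snd _]/= tE /= (pick_unique (x := c')) => [|c2] /=.
    by rewrite jE addn0.
  have yn : j < n by rewrite jE vE size_cat /= size_cat /= ltn_add2l !ltnS addn0 -[X in X <
    _]addn0 ltn_add2l.
  rewrite qE -(holds_rightE v_ok _ vE); have := Hn j c2 yn.
  by rewrite jE addn0 => ->; rewrite xpair_eqE eqxx.
have y'n : size v1 + (size m).+1 < n.
  by rewrite vE size_cat ltn_add2l /= ltnS size_cat /= -[X in X < _]addn0 ltn_add2l.
apply: (@MStep _ _ walker _ _ _ (w_right c (pass q y'), (size v1 + (size m).+2).+1) None _ _ _).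
  have tE : tape v (size v1 + (size m).+1).+1 = Sym y'.
    by apply: (tape_split (v1 := v1 ++ x :: m)); rewrite ?size_cat // vE -catA.
  rewrite /mstep [fst _]/= [snd _]/= tE /= pick_none => [|c2] /=.
    by rewrite !ltnS y'n !addnS.
  rewrite qE -(holds_rightE v_ok _ vE) Hn //; apply/negP => /eqP[E _].
  by move: E; rewrite jE => /addnI[] /eqP; rewrite -[X in X == _]addn0 eqn_add2l.
have -> : size v1 + (size m).+2 = size v1 + (size (rcons m y')).+1 by rewrite size_rcons.
apply: IH; first by rewrite vE cat_rcons.
  by rewrite jE size_rcons /= addSnnS.
by rewrite -cats1 foldl_cat -qE.
Qed.

(** Mirror image of the walk to the right: [m] has been crossed, and [m2] shrinks from its right
    end, hence the induction on its last letter. *)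
Lemma walk_left c f c' i j v1 y m2 m x v2 :
  v = v1 ++ y :: m2 ++ m ++ x :: v2 -> i = size v1 + (size m2 + size m).+1 -> j = size v1 ->
  (forall j2 c2, j2 < n -> acc (Fnext c c2) i j2 = ((j2, c2) == (j, c'))) ->
  f = [ffun q => i_post x (read x.1.1 true false (foldl pass q m))] ->
  run (w_left c f, (size v1 + size m2).+1) [::] (w_at c', j.+1).
Proof.
move=> + + jE; subst j; elim/last_ind: m2 m f => [|m2 y' IH] m f vE iE Hn fE.
  apply: (@mrun_step _ _ walker _ _ _ _ None).
  have tE : tape v (size v1 + 0).+1 = Sym y by apply: (tape_split vE); rewrite addn0.
  rewrite /mstep [fst _]/= [snd _]/= tE /= (pick_unique (x := c')) => [|c2] /=.
    by rewrite addn0.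
  have yn : size v1 < n by rewrite vE size_cat /= -[X in X < _]addn0 ltn_add2l.
  rewrite fE -(holds_leftE v_ok _ vE); have := Hn _ c2 yn.
  by rewrite iE => ->; rewrite xpair_eqE eqxx.
have y'n : size v1 + (size m2).+1 < n.
  by rewrite vE size_cat ltn_add2l /= ltnS size_cat /= size_rcons ltnS leq_addr.
have vE' : v = (v1 ++ y :: m2) ++ y' :: m ++ x :: v2 by rewrite vE -catA /= cat_rcons.
apply: (@MStep _ _ walker _ _ _ (w_left c [ffun q => f (pass q y')], (size v1 + size m2).+1)
  None _ _ _).
  have tE : tape v (size v1 + size (rcons m2 y')).+1 = Sym y'.
    by apply: (tape_split vE'); rewrite size_cat size_rcons.
  rewrite /mstep [fst _]/= [snd _]/= tE /= pick_none => [|c2] /=.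
    by rewrite size_rcons addnS.
  rewrite fE -(holds_leftE v_ok _ vE').
  rewrite size_cat /= -addnA addSnnS (_ : _ + (_ + _) = i); last first.
    by rewrite iE size_rcons !addSn !addnS.
  rewrite Hn //; apply/negP => /eqP[E _].
  by move: E => /eqP; rewrite -[X in _ == X]addn0 eqn_add2l.
apply: (IH (y' :: m)).
- by rewrite vE cat_rcons.
- by rewrite iE size_rcons /= addSnnS.
- exact: Hn.
- by apply/ffunP => q; rewrite fE !ffunE.
Qed.

Lemma walk_next k i c j c' : onth N k = Some (i, c) -> onth N k.+1 = Some (j, c') ->
  run (w_at c, i.+1) (oseq (em k)) (w_at c', j.+1).
Proof.
move=> Ei Ej.
have iN : i < n by apply: (N_lt (p := (i, c))); apply/onthP; exists k.
have jN : j < n by apply: (N_lt (p := (j, c'))); apply/onthP; exists k.+1.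
case Ex: (onth v i) (onthTE v i) => [x|]; last by rewrite iN.
move=> _; have [v1 [v2 [vE iE]]] := onth_split Ex.
have tE : tape v i.+1 = Sym x by apply: (tape_split vE).
have Fl : holds (Flast c) x = false.
  rewrite -(holdsE v_ok _ vE) iE (N_last Ei); apply/negP => /eqP E.
  by move: (onthTE N k.+1); rewrite Ej E ltnn.
have emE : [pick a | holds (Femit c a) x] = em k.
  case: pickP => [a|none]; first by rewrite -(holdsE v_ok _ vE) iE (N_emit Ei) => /eqP.
  case E: (em k) => [a|//].
  by have := none a; rewrite -(holdsE v_ok _ vE) iE (N_emit Ei) E eqxx.
have Fs c2 : holds_same (Fnext c c2) x = ((i, c2) == (j, c')).
  by rewrite -(holds_sameE v_ok _ vE) iE (N_next Ei Ej).
have Fr : holds (Fright c) x = (i < j).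
  by rewrite -(holdsE v_ok _ vE) iE (N_right Ei Ej).
have [ij|ij|ij] := ltngtP i j.
- have st : mstep (M := walker) n.+2 (tape v) (w_at c, i.+1) =
     Some (w_right c (read x.1.1 true false (i_pre x)), i.+2, em k).
    rewrite /mstep [fst _]/= [snd _]/= tE /= Fl emE pick_none => [|c2] /=.
      by rewrite Fr ij /= !ltnS iN.
    by rewrite Fs xpair_eqE (ltn_eqF ij).
  rewrite -[oseq _]cats0; apply: (MStep st).
  case Ey: (onth v j) (onthTE v j) => [y|]; last by rewrite jN.
  move=> _; have [w1 [w2 [wE jE]]] := onth_split Ey.
  have [m w1E] : exists m, w1 = v1 ++ x :: m.
    exists (drop i.+1 w1).
    have -> : v1 = take i w1.
      by rewrite -[LHS](take_size_cat (x :: v2) erefl) iE -vE wE take_cat jE ij.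
    rewrite -{1}(cat_take_drop i w1) (drop_nth x) ?jE //; congr (_ ++ _ :: _).
    by have := Ex; rewrite wE onth_cat jE ij; apply: onth_nth.
  have := @walk_right c _ c' i j v1 x [::] m y w2 _ (esym iE) _ (N_next Ei Ej) erefl.
  rewrite addn1 iE; apply; first by rewrite wE w1E -catA.
  by rewrite -jE w1E size_cat iE.
- have st : mstep (M := walker) n.+2 (tape v) (w_at c, i.+1) =
     Some (w_left c [ffun q => i_post x (read x.1.1 true false q)], i, em k).
    rewrite /mstep [fst _]/= [snd _]/= tE /= Fl emE pick_none => [|c2] /=.
      by rewrite Fr ltnNge (ltnW ij).
    by rewrite Fs xpair_eqE (gtn_eqF ij).
  rewrite -[oseq _]cats0; apply: (MStep st).
  case Ey: (onth v j) (onthTE v j) => [y|]; last by rewrite jN.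
  move=> _; have [w1 [w2 [wE jE]]] := onth_split Ey.
  have [m v1E] : exists m, v1 = w1 ++ y :: m.
    exists (drop j.+1 v1).
    have -> : w1 = take j v1.
      by rewrite -[LHS](take_size_cat (y :: w2) erefl) jE -wE vE take_cat iE ij.
    rewrite -{1}(cat_take_drop j v1) (drop_nth y) ?iE //; congr (_ ++ _ :: _).
    by have := Ey; rewrite vE onth_cat iE ij; apply: onth_nth.
  have iE2 : i = size w1 + (size m).+1 by rewrite -iE v1E size_cat.
  have := @walk_left c _ c' i j w1 y m [::] x v2 _ _ (esym jE) (N_next Ei Ej) erefl.
  rewrite -(addnS (size w1) (size m)) -iE2; apply; first by rewrite vE v1E -catA.
  by rewrite addn0.
- apply: mrun_step; rewrite /mstep [fst _]/= [snd _]/= tE /= Fl emE (pick_unique (x := c')) /=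
  ?ij //.
  by move=> c2; rewrite Fs xpair_eqE ij eqxx.
Qed.

Lemma walk_all k i c : onth N k = Some (i, c) ->
  mhalt (M := walker) n.+2 (tape v) (w_at c, i.+1)
    (flatten [seq oseq (em l) | l <- iota k (size N - k)]).
Proof.
move Er: (size N - k) => r; elim: r k i c Er => [|r IH] k i c Er Ei.
  by move: (onthTE N k); rewrite Ei; move/eqP: Er; rewrite subn_eq0 leqNgt => /negbTE->.
have iN : i < n by apply: (N_lt (p := (i, c))); apply/onthP; exists k.
case: r IH Er => [|r] IH Er; last first.
  have : onth N k.+1 by rewrite onthTE -subn_gt0 subnS Er.
  case Ej: (onth N k.+1) => [[j c']|] // _.
  apply/(mhalt_run _ (walk_next Ei Ej)); eexists; last by apply: (IH _ _ _ _ Ej); rewrite subnS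
    Er.
  by [].
case Ex: (onth v i) (onthTE v i) => [x|]; last by rewrite iN.
move=> _; have [v1 [v2 [vE iE]]] := onth_split Ex.
have tE : tape v i.+1 = Sym x by apply: (tape_split vE).
have Fl : holds (Flast c) x.
  rewrite -(holdsE v_ok _ vE) iE (N_last Ei) -eqSS; apply/eqP.
  have kN : k < size N by rewrite -subn_gt0 Er.
  by rewrite -[in RHS](subnKC (ltnW kN)) Er addn1.
have emE : [pick a | holds (Femit c a) x] = em k.
  case: pickP => [a|none]; first by rewrite -(holdsE v_ok _ vE) iE (N_emit Ei) => /eqP.
  case E: (em k) => [a|//].
  by have := none a; rewrite -(holdsE v_ok _ vE) iE (N_emit Ei) E eqxx.
exists (w_seek true, i.+1); split=> //=; rewrite cats0; apply: mrun_step.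
by rewrite /mstep [fst _]/= [snd _]/= tE /= Fl emE.
Qed.

(** The search stops exactly at the head of [N]. If [N] is empty it arrives at the right end marker
    and halts there with empty output. *)
Lemma walk_start : tacc walker v (flatten [seq oseq (em l) | l <- iota 0 (size N)]).
Proof.
rewrite /tacc /macc; apply/(mhalt_silent (M := walker) (c' := (w_seek false, 1))); first by [].
suff H : forall v1 v2, v = v1 ++ v2 ->
    (forall i c, onth N 0 = Some (i, c) -> size v1 <= i) ->
    mhalt (M := walker) n.+2 (tape v) (w_seek false, (size v1).+1)
      (flatten [seq oseq (em l) | l <- iota 0 (size N)]).
  exact: (H [::] v).
move=> v1 v2; elim: v2 v1 => [|x v2 IH] v1 vE Hi.
  have NE : N = [::].
    case E: N => [//|[i c] N']; have : i < n by apply: (N_lt (p := (i, c))); rewrite E mem_head.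
    by rewrite ltnNge vE cats0 (Hi i c) // E.
  rewrite NE; apply/(mhalt_silent (M := walker) (c' := (w_seek true, (size v1).+1))); last
    exact/mhalt_fin.
  by rewrite /mstep [fst _]/= [snd _]/= tapeS vE cats0 onth_default.
have tE : tape v (size v1).+1 = Sym x by apply: (tape_split vE).
have vn : size v1 < n by rewrite vE size_cat -[X in X < _]addn0 ltn_add2l.
have Ff c : holds (Ffirst c) x = (onth N 0 == Some (size v1, c)).
  by rewrite -(holdsE v_ok _ vE) N_first //; case: (N).
case: (pickP (fun c => holds (Ffirst c) x)) => [c|none].
  move=> hc; have /eqP E : onth N 0 == Some (size v1, c) by rewrite -Ff.
  apply/(mhalt_silent (M := walker) (c' := (w_at c, (size v1).+1))); last first.
    by have := walk_all E; rewrite subn0.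
  rewrite /mstep [fst _]/= [snd _]/= tE /= (pick_unique (x := c)) //.
  by move=> c2; rewrite Ff E /= (inj_eq Some_inj) xpair_eqE eqxx eq_sym.
apply/(mhalt_silent (M := walker) (c' := (w_seek false, (size v1).+2))).
  by rewrite /mstep [fst _]/= [snd _]/= tE /= pick_none //= !ltnS vn.
have -> : (size v1).+1 = size (rcons v1 x) by rewrite size_rcons.
apply: IH; first by rewrite cat_rcons.
move=> i c E; rewrite size_rcons ltn_neqAle (Hi _ _ E) andbT.
by apply/eqP => iE; have := none c; rewrite Ff E iE eqxx.
Qed.

End Walker.
End Walk.

(** * Outputs of a transduction up to isomorphism *)

Section Output.
Variables (S1 : eqType) (G1 : Type) (S2 : finType) (G2 : Type) (T : nmso S1 G1 S2 G2).
Variables (g : graph S1 G1) (X : 'I_(nk T) -> {set gV g}).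

Definition output_by h (f : {p : gV g * nC T | out_node X p} -> gV h) : Prop :=
  [/\ bijective f,
      forall p, sat (nv1 (val p).1) (pval X) (nnode T (val p).2 (glab h (f p))) &
      forall p q c, gE h (f p) c (f q) =
        sat (nv2 (val p).1 (val q).1) (pval X) (nedge T (val p).2 (val q).2 c)].

Lemma is_outputP h : is_output X h <-> exists f, @output_by h f.
Proof. by split=> [[f [? []]]|[f []]]; exists f. Qed.

(** Provides the graph defined by the guessed parameters before anything is known about it being a
    string. *)
Lemma is_output_exists : exists h, is_output X h.
Proof.
have /fin_all_exists[l lP] (p : {p : gV g * nC T | out_node X p}) :
    exists s, sat (nv1 (val p).1) (pval X) (nnode T (val p).2 s).
  have /eqP/mem_card1[s sP] := valP p.
  by exists s; have := sP s; rewrite !inE eqxx.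
exists (@Graph _ _ {p : gV g * nC T | out_node X p}
  (fun p c q => sat (nv2 (val p).1 (val q).1) (pval X) (nedge T (val p).2 (val q).2 c)) l).
exists id; split; first by exists id.
by split=> [p|p q c]; first exact: (lP p).
Qed.

Lemma is_output_iso h h' : is_output X h -> iso h h' -> is_output X h'.
Proof.
move=> [f [f_bij [f_lab f_edge]]] [f' [f'_bij [f'_lab f'_edge]]].
exists (f' \o f); split; first exact: bij_comp.
split=> [p|p q c] /=; first by rewrite f'_lab; apply: f_lab.
by rewrite f'_edge; apply: f_edge.
Qed.

Lemma out_node_label p s s' : out_node X p ->
  sat (nv1 p.1) (pval X) (nnode T p.2 s) -> sat (nv1 p.1) (pval X) (nnode T p.2 s') -> s = s'.
Proof.
move=> /eqP/mem_card1[s0 sP]; have := (sP s, sP s').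
by rewrite !inE => -[-> ->] /eqP-> /eqP->.
Qed.

Lemma is_output_unique h h' : is_output X h -> is_output X h' -> iso h h'.
Proof.
move=> [f [f_bij [f_lab f_edge]]] [f' [f'_bij [f'_lab f'_edge]]].
have [k fK kK] := f_bij.
exists (f' \o k); split; first by apply: bij_comp => //; exists f.
split=> [v|v c w] /=; last by rewrite f'_edge -f_edge !kK.
apply: (out_node_label (valP (k v))); first exact: f'_lab.
by have := f_lab (k v); rewrite kK.
Qed.

End Output.

Lemma recog_local L (P : wpred L) u nb nb' sb sb' : recog P ->
  (forall i, i < size u -> nb i = nb' i /\ sb i = sb' i) -> P u nb sb -> P u nb' sb'.
Proof. by move=> [K _ E] H; rewrite !E (eq_code H). Qed.

Section WordGraph.
Variables (L : Type) (S1 : eqType) (G1 : Type) (lab : L -> S1) (e : L -> G1 -> bool).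
Variable u : seq L.
Local Notation g := (wgraph lab e u).

Definition set_valw (mu : nat -> {set 'I_(size u)}) : valn := @set_val _ _ _ g u id mu.

Lemma sat_word (nu : nat -> option (gV g)) mu phi :
  sat nu mu phi <-> wsat lab e u (@pos_val _ _ _ g u id nu) (set_valw mu) phi.
Proof. by apply: sat_wsat => //; exists id. Qed.

End WordGraph.

(** * From transductions to machines *)

Section NmsoToMach.
Variables (L : finType) (S1 : eqType) (G1 : Type) (lab : L -> S1) (e : L -> G1 -> bool).
Variables (S2 G2 C : finType) (L2 : Type) (lab2 : L2 -> S2) (e2 : L2 -> G2 -> bool).
Variable T : nmso S1 G1 S2 G2.
Variable enc2 : seq C -> seq L2.
Hypothesis enc2_size : forall z, size z <= size (enc2 z).
Hypothesis enc2_edge : forall z i a, onth (enc2 z) i = Some a -> i.+1 < size (enc2 z) ->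
  exists c, e2 a c.
(** [Em c a] says that the output node of copy [c] at node variable 0 emits [a]. It is instantiated
    by the node label for [nd] and by the label of the outgoing edge for [ed]. *)
Variable Em : nC T -> C -> wpred L.
Hypothesis Em_recog : forall c a, recog (Em c a).
Hypothesis EmP : forall (u : seq L) (X : 'I_(nk T) -> {set gV (wgraph lab e u)}) z f,
  @output_by _ _ _ _ T _ X (wgraph lab2 e2 (enc2 z)) f ->
  forall (p : {p : gV (wgraph lab e u) * nC T | out_node X p}) a, Em (val p).2 a u (pos1 (val
    p).1) (set_valw lab e (pval X)) <->
              onth z (f p) = Some a.

Local Notation K := (nC T).

Definition sub_val (s : nat -> option nat) (nb : valn) : valn :=
  fun p x => if s x is Some y then nb p y else false.

Definition w_dom : wpred L := fun u nb sb => wsat lab e u (sub_val (fun _ => None) nb) sb (ndom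
  T).

(** The condition of [out_node] that exactly one label formula holds, written with finite
    disjunctions and negation so that [recog_exists] and [recog_not] apply. *)
Definition w_node y (c : K) : wpred L := fun u nb sb =>
  let nb' := sub_val (fun x => if x == 0 then Some y else None) nb in
  exists s, wsat lab e u nb' sb (nnode T c s) /\
    ~ exists s', if s' == s then False else wsat lab e u nb' sb (nnode T c s').

Definition w_edge (c c' : K) (l : G2) : wpred L := fun u nb sb =>
  wsat lab e u (sub_val (fun x => if x < 2 then Some x else None) nb) sb (nedge T c c' l).

Definition w_next (c c' : K) : wpred L := fun u nb sb =>
  w_node 0 c u nb sb /\ w_node 1 c' u nb sb /\ exists l, w_edge c c' l u nb sb.

(** No output node precedes this one. The substitution [1 - x] exchanges the two node variables,
    which makes the quantified position the source of the edge. *)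
Definition w_first (c : K) : wpred L := fun u nb sb =>
  w_node 0 c u nb sb /\ ~ exists i, i < size u /\ exists c', w_next c' c u
    (sub_val (fun x => if x < 2 then Some (1 - x) else None) (set_pos nb 1 i)) sb.

Definition w_last (c : K) : wpred L := fun u nb sb =>
  ~ exists i, i < size u /\ exists c', w_next c c' u (set_pos nb 1 i) sb.

Definition w_after (c : K) : wpred L := fun u nb sb =>
  exists i, i < size u /\
    ((exists p p', [/\ p < p', p' < size u, set_pos nb 1 i p 0 & set_pos nb 1 i p' 1]) /\
     exists c', w_next c c' u (set_pos nb 1 i) sb).

Lemma recog_dom : recog w_dom.
Proof. exact: (recog_subst (fun _ => None) (recog_wsat lab e (ndom T))). Qed.

Lemma recog_node y c : recog (w_node y c).
Proof.
apply: (recog_subst (fun x => if x == 0 then Some y else None) (P := fun u nb sb => exists s,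
  wsat lab e u nb sb (nnode T c s) /\
    ~ exists s', if s' == s then False else wsat lab e u nb sb (nnode T c s'))).
apply: recog_exists => s; apply: recog_and; first exact: recog_wsat.
apply: recog_not; apply: recog_exists => s'; case: (s' == s).
  exact: recog_false.
exact: recog_wsat.
Qed.

Lemma recog_edge c c' l : recog (w_edge c c' l).
Proof. exact: (recog_subst (fun x => if x < 2 then Some x else None) (recog_wsat lab e _)). Qed.

Lemma recog_next c c' : recog (w_next c c').
Proof.
apply: recog_and; first exact: recog_node.
apply: recog_and; first exact: recog_node.
by apply: recog_exists => l; apply: recog_edge.
Qed.

Lemma recog_first c : recog (w_first c).
Proof.
apply: recog_and; first exact: recog_node.
apply: recog_not; apply: (recog_pos 1 (P := fun u nb sb => exists c', w_next c' c u
    (sub_val (fun x => if x < 2 then Some (1 - x) else None) nb) sb)).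
apply: recog_exists => c'; exact: (recog_subst (fun x => if x < 2 then Some (1 - x) else None)
  (recog_next c' c)).
Qed.

Lemma recog_last c : recog (w_last c).
Proof.
apply: recog_not; apply: (recog_pos 1 (P := fun u nb sb => exists c', w_next c c' u nb sb)).
by apply: recog_exists => c'; apply: recog_next.
Qed.

Lemma recog_after c : recog (w_after c).
Proof.
apply: (recog_pos 1 (P := fun u nb sb =>
  (exists p p', [/\ p < p', p' < size u, nb p 0 & nb p' 1]) /\
   exists c', w_next c c' u nb sb)).
apply: recog_and; first exact: recog_before.
by apply: recog_exists => c'; apply: recog_next.
Qed.

Lemma automaton : exists (Q : finType) (d : Q -> L * (nat -> bool) * (nat -> bool) -> Q) (q0 : Q)
  (Fdom : pred Q) (Ffirst Flast Fright : K -> pred Q) (Femit : K -> C -> pred Q)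
  (Fnext : K -> K -> pred Q),
  forall u nb sb, let q := foldl d q0 (code u nb sb) in
  [/\ w_dom u nb sb <-> Fdom q,
      forall c, (w_first c u nb sb <-> Ffirst c q) /\ (w_last c u nb sb <-> Flast c q),
      forall c, w_after c u nb sb <-> Fright c q,
      forall c a, Em c a u nb sb <-> Femit c a q &
      forall c c', w_next c c' u nb sb <-> Fnext c c' q].
Proof.
pose J : finType := option (K + K + K + (K * C) + (K * K))%type.
pose P (j : J) : wpred L := match j with
  | None => w_dom
  | Some (inl (inl (inl (inl c)))) => w_first c
  | Some (inl (inl (inl (inr c)))) => w_last c
  | Some (inl (inl (inr c))) => w_after c
  | Some (inl (inr (c, a))) => Em c a
  | Some (inr (c, c')) => w_next c c'
  end.
have /recog_family[Q [d [q0 [F FE]]]] : forall j, recog (P j).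
  case=> [[[[[c|c]|c]|[c a]]|[c c']]|]; [exact: recog_first|exact: recog_last|
    exact: recog_after|exact: Em_recog|exact: recog_next|exact: recog_dom].
exists Q, d, q0, (F None), (fun c => F (Some (inl (inl (inl (inl c)))))),
  (fun c => F (Some (inl (inl (inl (inr c)))))), (fun c => F (Some (inl (inl (inr c))))),
  (fun c a => F (Some (inl (inr (c, a))))), (fun c c' => F (Some (inr (c, c')))) => u nb sb q.
by split=> *; [|split| | |]; rewrite -FE.
Qed.

Lemma set_pos2 i j l : set_pos (pos2 i j) 1 l = pos2 i l.
Proof. by apply/funext => p; apply/funext => -[|[|x]]; rewrite /set_pos /pos2 /= ?orbF. Qed.

Lemma sub_pos2_0 i j : sub_val (fun x => if x == 0 then Some 0 else None) (pos2 i j) = pos1 i.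
Proof. by apply/funext => p; apply/funext => -[|x]; rewrite /sub_val /pos1 /pos2 /= ?orbF. Qed.

Lemma sub_pos2_1 i j : sub_val (fun x => if x == 0 then Some 1 else None) (pos2 i j) = pos1 j.
Proof. by apply/funext => p; apply/funext => -[|x]; rewrite /sub_val /pos1 /pos2 /= ?orbF. Qed.

Lemma sub_pos2 i j : sub_val (fun x => if x < 2 then Some x else None) (pos2 i j) = pos2 i j.
Proof. by apply/funext => p; apply/funext => -[|[|x]]. Qed.

Lemma sub_pos2_swap i j :
  sub_val (fun x => if x < 2 then Some (1 - x) else None) (pos2 i j) = pos2 j i.
Proof. by apply/funext => p; apply/funext => -[|[|x]]; rewrite /sub_val /pos2 /= ?orbF. Qed.

Section Semantics.
Variables (u : seq L) (X : 'I_(nk T) -> {set gV (wgraph lab e u)}).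
Local Notation n := (size u).
Local Notation sb := (set_valw lab e (pval X)).

Lemma w_domE nb : w_dom u nb sb <-> sat (nv0 _) (pval X) (ndom T).
Proof. by rewrite sat_word pos_val_nv0. Qed.

Lemma w_nodeE y c nb (i : 'I_n) :
  sub_val (fun x => if x == 0 then Some y else None) nb = pos1 i ->
  w_node y c u nb sb <-> out_node X (i, c).
Proof.
move=> nbE; rewrite /w_node /out_node nbE -(@pos_val_nv1 _ _ _ (wgraph lab e u) u id) /=; last
  by exists id.
split=> [[s [/sat_word sP uniq]]|/eqP/mem_card1[s sP]].
  apply/eqP; apply: (@eq_card1 _ s) => s'; rewrite !inE.
  apply/idP/eqP => [s'P|-> //]; apply/eqP/negP => /negP ss'.
  by case: uniq; exists s'; rewrite (negbTE ss'); apply/sat_word.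
exists s; split; first by apply/sat_word; have := sP s; rewrite !inE eqxx.
move=> [s']; case: eqP => // ss' /sat_word s'P.
by have := sP s'; rewrite !inE s'P => /esym/eqP.
Qed.

Lemma w_nextE c c' (i j : 'I_n) : w_next c c' u (pos2 i j) sb <->
  [/\ out_node X (i, c), out_node X (j, c') &
     exists l, @sat _ _ (wgraph lab e u) (nv2 i j) (pval X) (nedge T c c' l)].
Proof.
rewrite /w_next (w_nodeE _ (sub_pos2_0 _ _)) (w_nodeE _ (sub_pos2_1 _ _)) /w_edge sub_pos2.
by split=> [[? [? [l H]]]|[? ? [l H]]]; do !split=> //; exists l; move: H;
  rewrite sat_word (@pos_val_nv2 _ _ _ (wgraph lab e u) u id) //; exists id.
Qed.

Variables (z : seq C) (f : {p : gV (wgraph lab e u) * K | out_node X p} ->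
                           gV (wgraph lab2 e2 (enc2 z))).
Hypothesis f_out : output_by f.
Local Notation onode := {p : gV (wgraph lab e u) * K | out_node X p}.
Local Notation m := (size (enc2 z)).

Definition out_pos (q : onode) : nat * K := (nat_of_ord (val q).1, (val q).2).

Lemma out_pos_inj : injective out_pos.
Proof.
move=> [[i c] o] [[j c'] o'] [] /= /val_inj ij cc'; apply: val_inj => /=.
by rewrite ij cc'.
Qed.

Lemma out_word : exists N : seq (nat * K), size N = m /\
  forall l p, onth N l = Some p <-> exists2 q : onode, p = out_pos q & val (f q) = l.
Proof.
have [[f' fK f'K] _ _] := f_out.
exists [seq out_pos (f' l) | l <- enum 'I_m]; split; first by rewrite size_map size_enum_ord.
move=> l p; rewrite onth_map; split.
  case E: (onth _ l) => [lo|] //= [<-]; exists (f' lo); rewrite // f'K.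
  have : l < size (enum 'I_m) by rewrite -onthTE E.
  rewrite size_enum_ord => lm.
  by rewrite -(onth_nth lo _ _ _ E) -[l]/(val (Ordinal lm)) nth_ord_enum.
move=> [q -> <-]; suff -> : onth (enum 'I_m) (f q) = Some (f q) by rewrite /= fK.
case E: (onth _ _) => [l'|]; first by rewrite -(onth_nth (f q) _ _ _ E) nth_ord_enum.
by move: (onthTE (enum 'I_m) (f q)); rewrite E size_enum_ord ltn_ord.
Qed.

Lemma w_next_out (q : onode) j c' : j < n ->
  w_next (out_pos q).2 c' u (pos2 (out_pos q).1 j) sb <->
  exists2 q', out_pos q' = (j, c') & val (f q') = (val (f q)).+1.
Proof.
have [_ _ f_edge] := f_out.
move=> jn; rewrite (w_nextE _ _ _ (Ordinal jn)); split.
  move=> [_ jo [l]]; pose q' : onode := Sub (Ordinal jn, c') jo.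
  rewrite -[Ordinal jn]/(val q').1 -[c']/(val q').2 -f_edge => /andP[/eqP E _].
  by exists q'.
move=> [[[j' c2] /= jo] [jE cE] E]; subst c2.
have jE' : j' = Ordinal jn by apply: val_inj.
move: jo E; rewrite jE' => jo E.
split=> //; first by case: (q) => [[]].
have [|l el] := enc2_edge (tnth_word (f q)); first by rewrite -E ltn_ord.
by exists l; rewrite -(f_edge q (exist _ (Ordinal jn, c') jo)) /= E eqxx.
Qed.

End Semantics.

Section Automaton.
Variables (Q : finType) (d : Q -> L * (nat -> bool) * (nat -> bool) -> Q) (q0 : Q).
Variables (Fdom : pred Q) (Ffirst Flast Fright : K -> pred Q) (Femit : K -> C -> pred Q).
Variable Fnext : K -> K -> pred Q.
Hypothesis aut : forall u nb sb, let q := foldl d q0 (code u nb sb) in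
  [/\ w_dom u nb sb <-> Fdom q,
      forall c, (w_first c u nb sb <-> Ffirst c q) /\ (w_last c u nb sb <-> Flast c q),
      forall c, w_after c u nb sb <-> Fright c q,
      forall c a, Em c a u nb sb <-> Femit c a q &
      forall c c', w_next c c' u nb sb <-> Fnext c c' q].

Section Annotated.
Variable s : seq (L * {set 'I_(nk T)}).
Local Notation u := [seq t.1 | t <- s].
Variable X : 'I_(nk T) -> {set gV (wgraph lab e u)}.
Hypothesis XP : forall (i : 'I_(size u)) o,
  (i \in X o) = (if onth s i is Some t then o \in t.2 else false).
Local Notation sb := (set_valw lab e (pval X)).
Local Notation n := (size u).

Lemma word_setsE p : p < n -> word_sets s p = sb p.
Proof.
move=> pn; apply/funext => x.
rewrite -[p]/(val (Ordinal pn)) /set_valw set_valP /pval /word_sets.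
case: (onth s _) (XP (Ordinal pn)) => [t|] H; rewrite /set_bits;
  by case: insubP => [o _ _|_]; rewrite ?H ?inE.
Qed.

Lemma run2_local (P : wpred L) (F : pred Q) i j :
  recog P -> (forall u nb sb, P u nb sb <-> F (foldl d q0 (code u nb sb))) ->
  F (run2 d q0 s i j) <-> P u (pos2 i j) sb.
Proof.
move=> rP PF; rewrite -PF; split; apply: recog_local => // p pn; split=> //.
  exact: word_setsE.
by rewrite word_setsE.
Qed.

Lemma Fdom_sat : Fdom (foldl (skip d) q0 s) <-> sat (nv0 _) (pval X) (ndom T).
Proof.
rewrite -(@foldl_skip _ _ _ d 0 q0 s n n) ?add0n ?size_map ?leqnn // -run2E.
rewrite (run2_local (P := w_dom)) ?w_domE //; first exact: recog_dom.
by move=> u nb sb; have [] := aut u nb sb.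
Qed.

Variables (z : seq C) (f : {p : gV (wgraph lab e u) * K | out_node X p} ->
                           gV (wgraph lab2 e2 (enc2 z))).
Hypothesis f_out : output_by f.

Lemma walker_run v : [seq x.1.1 | x <- v] = s ->
  chain (ok d q0) (okend d q0 Fdom) None v ->
  tacc (walker (nk T) d Ffirst Flast Fright Femit Fnext) v z.
Proof.
move=> vs v_ok; have vn : size v = n by rewrite -vs !size_map.
have [N [sN NP]] := out_word f_out.
have [[f' fK f'K] _ _] := f_out.
have acc (P : wpred L) (F : pred Q) i j : recog P -> (forall u nb sb, P u nb sb <-> F (foldl d
  q0 (code u nb sb))) ->
    accepts d q0 v F i j <-> P u (pos2 i j) sb.
  by rewrite /accepts vs; apply: run2_local.
have acc_first c i j : accepts d q0 v (Ffirst c) i j <-> w_first c u (pos2 i j) sb.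
  by apply: acc => [|u nb sb]; [exact: recog_first|have [_ /(_ c)[]] := aut u nb sb].
have acc_last c i j : accepts d q0 v (Flast c) i j <-> w_last c u (pos2 i j) sb.
  by apply: acc => [|u nb sb]; [exact: recog_last|have [_ /(_ c)[]] := aut u nb sb].
have acc_after c i j : accepts d q0 v (Fright c) i j <-> w_after c u (pos2 i j) sb.
  by apply: acc => [|u nb sb]; [exact: recog_after|have [_ _ ->] := aut u nb sb].
have acc_emit c a i j : accepts d q0 v (Femit c a) i j <-> Em c a u (pos2 i j) sb.
  by apply: acc => [|u nb sb]; [exact: Em_recog|have [_ _ _ ->] := aut u nb sb].
have acc_next c c' i j : accepts d q0 v (Fnext c c') i j <-> w_next c c' u (pos2 i j) sb.
  by apply: acc => [|u nb sb]; [exact: recog_next|have [_ _ _ _ ->] := aut u nb sb].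
have NE l i c : onth N l = Some (i, c) -> exists2 q, out_pos q = (i, c) & val (f q) = l.
  by move=> /NP[q -> <-]; exists q.
have outn (q : {p : gV (wgraph lab e u) * K | out_node X p}) : (out_pos q).1 < n.
  by case: q => [[i c] ?] /=; apply: ltn_ord.
have next_out q i c l c' : out_pos q = (i, c) -> l < n -> w_next c c' u (pos2 i l) sb <->
    exists2 q', out_pos q' = (l, c') & val (f q') = (val (f q)).+1.
  by move=> E lN; have := w_next_out f_out q c' lN; rewrite E.
have posE (q : {p : gV (wgraph lab e u) * K | out_node X p}) :
    out_pos q = ((out_pos q).1, (out_pos q).2) by case: (out_pos q).
have nextP i c l c' : i < n -> l < n -> w_next c c' u (pos2 i l) sb ->
    exists q q', [/\ out_pos q = (i, c), out_pos q' = (l, c') & val (f q') = (val (f q)).+1].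
  move=> iN lN /[dup] /(w_nextE X c c' (Ordinal iN) (Ordinal lN))[iout _ _] H.
  pose q : {p : gV (wgraph lab e u) * K | out_node X p} := exist _ (Ordinal iN, c) iout.
  by have /(_ H)[q' ? ?] := (next_out q i c l c' erefl lN).1; exists q, q'.
(* There may be more output nodes than letters: for [ed] the last node carries none. At such nodes
   [onth z l] is [None] and nothing is emitted. *)
have zE : z = flatten [seq oseq (onth z l) | l <- iota 0 (size N)].
  rewrite sN; have := enc2_size z; move: (size (enc2 z)) => m.
  elim: z m => [|a z' IH] m.
    by move=> _; elim: m 0 => //= m IH k; rewrite -IH onth0n.
  case: m => // m; rewrite ltnS => /IH {1}->; rewrite /= (iotaDl 1 0) -map_comp.
  by congr (_ :: flatten _).
rewrite zE; apply: (walk_start v_ok).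
- by move=> p; rewrite vn => /onthP[l /NP[q -> _]].
- move=> i c; rewrite vn => iN; have -> : ohead N = onth N 0 by case: (N).
  apply/idP/eqP => [/acc_first[]|/NE[q qE fq0]].
    rewrite (w_nodeE X _ (i := Ordinal iN) (sub_pos2_0 _ _)) => iout noprev.
    pose q : {p : gV (wgraph lab e u) * K | out_node X p} := exist _ (Ordinal iN, c) iout.
    apply/NP; exists q => //; case E: (val (f q)) => [//|l]; case: noprev.
    have lm : l < size (enc2 z) by apply: leq_ltn_trans (ltn_ord (f q)); rewrite -[X in _ <=
      X]/(val (f q)) E.
    pose q' := f' (Ordinal lm).
    exists (out_pos q').1; split=> //; exists (out_pos q').2.
    rewrite set_pos2 sub_pos2_swap; apply/(next_out q' _ _ i c (posE _) iN); exists q => //.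
    by rewrite /q' f'K E.
  apply/acc_first; split.
    apply/(w_nodeE X _ (i := Ordinal iN) (sub_pos2_0 _ _)).
    case: q qE {fq0} => [[i' c'] /= o] [iE <-].
    by rewrite (_ : Ordinal iN = i') //; apply: val_inj.
  move=> [l [lN [c' ]]]; rewrite set_pos2 sub_pos2_swap.
  move=> /(nextP _ _ _ _ lN iN)[q1 [q2 [_ q2E]]].
  have -> : q2 = q by apply: out_pos_inj; rewrite q2E.
  by rewrite fq0.
- move=> l i c /NE[q qE fql]; rewrite vn; apply/idP/eqP => [/acc_last nonext|lm].
    have lm : l < size N by rewrite sN -fql ltn_ord.
    apply/eqP; rewrite eqn_leq lm leqNgt; apply/negP; rewrite sN => l1m.
    case: nonext; pose q' := f' (Ordinal l1m).
    exists (out_pos q').1; split=> //; exists (out_pos q').2.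
    rewrite set_pos2; apply/(next_out q) => //.
    by exists q'; rewrite // /q' f'K fql.
  apply/acc_last => -[j [jn [c']]]; rewrite set_pos2.
  move=> /(next_out _ _ _ _ _ qE jn)[q' _].
  by rewrite fql lm sN => E; have := ltn_ord (f q'); rewrite -[X in X < _]/(val (f q')) E ltnn.
- move=> l i c j c' /NE[q qE fql] /NE[q' q'E fq'l]; rewrite vn.
  apply/idP/idP => [/acc_after[j2 [j2n [[p [p' [pp' _]]]]]]|ij].
    rewrite set_pos2 /pos2 /= orbF => /eqP pi /eqP p'j2 [c2].
    move=> /(next_out _ _ _ _ _ qE j2n)[q2 q2E]; rewrite fql -fq'l => /val_inj.
    move=> /(can_inj fK) q2q'; move: q2E; rewrite q2q' q'E => -[-> _].
    by rewrite -pi -p'j2.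
  have jn : j < n by rewrite -[j]/(j, c').1 -q'E.
  apply/acc_after; exists j; rewrite set_pos2; split=> //; split.
    by exists i, j; rewrite /pos2 !eqxx.
  exists c'; apply/(next_out q) => //.
  by exists q'; rewrite // fql fq'l.
- move=> l i c j c' /NE[q qE fql] /NE[q' q'E fq'l] j2 c2; rewrite vn => j2n.
  apply/idP/eqP => [/acc_next/(next_out _ _ _ _ _ qE j2n)[q2 <-]|[-> ->]].
    by rewrite fql -fq'l -q'E => /val_inj/(can_inj fK)->.
  apply/acc_next/(next_out q) => //; first by rewrite -[j]/(j, c').1 -q'E.
  by exists q'; rewrite // fql fq'l.
- move=> l i c /NE[q qE fql] a; rewrite vn.
  (* Position [n] is outside the word, so marking it by variable 1 is invisible. *)
  have Eq : Em c a u (pos2 i n) sb <-> Em c a u (pos1 i) sb.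
    by split; apply: recog_local => // p pn; split=> //; apply/funext => x;
      rewrite /pos1 /pos2 (ltn_eqF pn) andbF orbF.
  have E2 : Em c a u (pos1 i) sb <-> onth z l = Some a.
    by rewrite -fql -(EmP f_out q a); move: qE => [<- <-].
  by apply/idP/eqP => [/acc_emit/Eq/E2|/E2/Eq/acc_emit].
Qed.

End Annotated.
End Automaton.

(** For soundness, an accepted annotation yields parameters satisfying the domain formula; these
    have some output graph, which is a string [z'] by hypothesis, and [walker_run] makes the machine
    produce [z']. Determinism then identifies [z] with [z']. Completeness is the same run on the
    computed annotation. *)
Lemma mach_of_nmso (W : seq L -> Prop) :
  (forall u h, W u -> nmso_rel T (wgraph lab e u) h ->
     exists z, iso h (wgraph lab2 e2 (enc2 z))) ->
  exists (I : finType) (letter : I -> L) (M : mach (tsym I) C), forall u z, W u ->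
    (exists2 v, map letter v = u & tacc M v z) <->
    nmso_rel T (wgraph lab e u) (wgraph lab2 e2 (enc2 z)).
Proof.
move=> strings.
have [Q [d [q0 [Fdom [Ffirst [Flast [Fright [Femit [Fnext aut]]]]]]]]] := automaton.
exists (info L (nk T) Q), (fun x => x.1.1.1).
exists (sweep (walker (nk T) d Ffirst Flast Fright Femit Fnext) (ok d q0) (okend d q0 Fdom)).
move=> u z Wu; split.
  move=> [v vu /sweepE[v_ok acc]]; pose s := [seq x.1.1 | x <- v].
  have su : [seq t.1 | t <- s] = u by rewrite -vu -map_comp.
  move: Wu; rewrite -su => Wu.
  pose X (o : 'I_(nk T)) : {set gV (wgraph lab e [seq t.1 | t <- s])} :=
    [set i : 'I_(size [seq t.1 | t <- s]) | if onth s i is Some t then o \in t.2 else false].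
  have XP (i : 'I_(size [seq t.1 | t <- s])) o :
      (i \in X o) = (if onth s i is Some t then o \in t.2 else false) by rewrite inE.
  have dom : sat (nv0 _) (pval X) (ndom T).
    by apply/(Fdom_sat aut XP); have := chain_dom v_ok; rewrite foldl_pass.
  have [h h_out] := is_output_exists X.
  have [|z' hz'] := strings _ h Wu; first by exists X.
  have z'_out := is_output_iso h_out hz'.
  have [f f_out] := (is_outputP _ _).1 z'_out.
  have acc' := walker_run aut XP f_out erefl v_ok.
  have -> : z = z' by apply: mhalt_det acc acc'.
  by exists X.
move=> [X [dom /is_outputP[f f_out]]].
pose s := [seq (tnth (in_tuple u) i, [set o | i \in X o]) | i <- enum 'I_(size u)].
have su : u = [seq t.1 | t <- s].
  by rewrite -map_comp -[LHS](@map_tnth_enum _ _ (in_tuple u)).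
have XP (i : 'I_(size u)) o : (i \in X o) = (if onth s i is Some t then o \in t.2 else false).
  rewrite onth_map; case E: (onth _ i) => [j|] /=.
    by rewrite inE -(onth_nth i _ _ _ E) nth_ord_enum.
  by move: (onthTE (enum 'I_(size u)) i); rewrite E size_enum_ord ltn_ord.
move: s su XP => s su; subst u => XP.
exists (annotate d q0 s); first by rewrite [LHS](map_comp fst (fun x => x.1.1)) annotate_proj.
apply/sweepE; have v_ok : chain (ok d q0) (okend d q0 Fdom) None (annotate d q0 s).
  by apply: chain_annotate; apply/(Fdom_sat aut XP).
by split=> //; apply: (walker_run aut XP f_out) => //; apply: annotate_proj.
Qed.

End NmsoToMach.

(** * Halting runs as lists of configurations *)

Lemma has_split T (p : pred T) s : has p s ->
  exists m x s2, [/\ s = m ++ x :: s2, p x & ~~ has p m].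
Proof.
elim: s => //= y s IH; case: (boolP (p y)) => [py _|npy /= /IH].
  by exists [::], y, s.
move=> [m [x [s2 [-> px nm]]]]; exists (y :: m), x, s2; split=> //=.
by rewrite negb_or npy.
Qed.

Lemma mem_split (T : eqType) (x : T) s : x \in s -> exists s1 s2, s = s1 ++ x :: s2.
Proof. by move=> /onthP[i E]; have [s1 [s2 [-> _]]] := onth_split E; exists s1, s2. Qed.

Section RunList.
Variables (S C L2 : Type) (M : mach S C) (inj : C -> L2) (haltL : option L2).
Variables (n : nat) (t : nat -> S).
Local Notation conf := (mQ M * nat)%type.

(** The letter of the output node that a configuration contributes, if any. [haltL] lets the final
    configuration contribute too: for [ed] it becomes the last node of the output path, while for
    [nd] it contributes nothing. *)
Definition conf_letter (q : mQ M) (x : S) : option L2 :=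
  if mfin q then haltL
  else if mdelta q x is Some (_, Some a, _) then Some (inj a) else None.

Definition cletter (c : conf) : option L2 := conf_letter c.1 (t c.2).

Definition csucc (c c' : conf) : Prop := exists o, mstep n t c = Some (c', o).

Fixpoint full_run (c : conf) (r : seq conf) : Prop :=
  if r is c' :: r' then csucc c c' /\ full_run c' r' else mfin c.1.

Lemma csucc_fun c c1 c2 : csucc c c1 -> csucc c c2 -> c1 = c2.
Proof. by move=> [o1 E] [o2]; rewrite E => -[]. Qed.

Lemma csucc_nfin c c' : csucc c c' -> ~~ mfin c.1.
Proof. by move=> [o]; rewrite /mstep; case: ifP. Qed.

Lemma csucc_lt c c' : c.2 < n -> csucc c c' -> c'.2 < n.
Proof.
move=> cn [o]; rewrite /mstep; case: ifP => // _; case: mdelta => [[[q a] e]|] //.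
case E: mmove => [j|] //= [<- _] /=; case: e E => /=.
- by case: (c.2) cn => // i iN [<-]; apply: ltnW.
- by move=> [<-].
- by case: ifP => // jn [<-].
Qed.

Lemma run_list c z : mhalt n t c z -> exists2 r, full_run c r &
  pmap cletter (c :: r) = map inj z ++ oseq haltL.
Proof.
move=> [c' [fc' r]]; elim: r fc' => [d fd|c1 c2 o y c3 E _ IH /IH[r fr rE]].
  by exists [::]; rewrite //= /cletter /conf_letter fd; case: haltL.
exists (c2 :: r) => /=; first by split=> //; exists o.
move: rE => /= ->; have nf : ~~ mfin c1.1 by apply: (@csucc_nfin _ c2); exists o.
rewrite /cletter /conf_letter (negbTE nf); move: E; rewrite /mstep (negbTE nf).
case: mdelta => [[[q o'] e]|] //; case: mmove => //= j [_ <-].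
by case: o'.
Qed.

Lemma full_run_fun c r r' : full_run c r -> full_run c r' -> r = r'.
Proof.
elim: r c r' => [|c1 r IH] c [|c2 r'] //=.
- by move=> fc [/csucc_nfin/negP].
- by move=> [/csucc_nfin/negP+ _] fc.
- by move=> [s1 f1] [s2 f2]; have E := csucc_fun s1 s2; subst c2; rewrite (IH _ r' f1).
Qed.

Lemma full_run_suffix c r a s1 s2 : full_run c r -> c :: r = s1 ++ a :: s2 -> full_run a s2.
Proof.
elim: s1 c r => [|b s1 IH] c r /= fr [E1 E2]; first by rewrite -E1 -E2.
by case: r fr E2 => [|c' r] /=; [case: (s1)|move=> [_ fr]; apply: IH].
Qed.

Lemma full_run_lt c r : c.2 < n -> full_run c r -> forall a, a \in c :: r -> a.2 < n.
Proof.
elim: r c => [|c' r IH] c cn /=; first by move=> _ a; rewrite inE => /eqP->.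
move=> [cc' fr] a; rewrite inE => /orP[/eqP-> //|].
exact: IH (csucc_lt cn cc') fr a.
Qed.

(** If a configuration recurred, determinism would make the run after its first occurrence equal to
    the shorter run after its second. Hence distinct moments of a halting run are distinct pairs of
    state and position, and can serve as output nodes. *)
Lemma full_run_uniq c r : full_run c r -> uniq (c :: r).
Proof.
elim: r c => [//|c' r IH] c fr; rewrite cons_uniq; have [_ fr'] := fr.
rewrite (IH _ fr') andbT; apply/negP => /mem_split[s1 [s2 E]].
have /= := full_run_fun fr (@full_run_suffix c (c' :: r) c (c :: s1) s2 fr (congr1 (cons c) E)).
rewrite E => /(congr1 size); rewrite size_cat /= => /eqP.
by rewrite -addSnnS -[X in _ == X]add0n eqn_add2r.
Qed.

(* Quantifying over all sets closed under steps, as the formulas will do. *)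
Definition closed_under (D : pred conf) (Z : conf -> bool) : Prop :=
  forall c, c.2 < n -> Z c -> D c -> forall c', csucc c c' -> Z c'.

(** The run itself, as a set, is closed under steps because the successor is unique and the last
    configuration has none; so it is the least closed set. *)
Lemma reach_run c r a : c.2 < n -> full_run c r ->
  (forall Z : conf -> bool, Z c -> closed_under predT Z -> Z a) <-> a \in c :: r.
Proof.
move=> cn fr; split=> [/(_ (mem (c :: r)))|].
  apply; first exact: mem_head.
  move=> b bn /mem_split[s1 [s2 E]] _ b' bb'; have := full_run_suffix fr E.
  case: s2 E => [|b2 s2] E /= ; first by move: (csucc_nfin bb') => /negP.
  by move=> [s _]; rewrite (csucc_fun bb' s) E mem_cat !inE eqxx !orbT.
move=> + Z Zc Zcl; elim: r c cn fr Zc => [|c' r IH] c cn /=.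
  by move=> _ Zc; rewrite inE => /eqP->.
move=> [cc' fr] Zc; rewrite inE => /orP[/eqP-> //|].
by apply: IH => //; [exact: csucc_lt cn cc'|exact: Zcl cc'].
Qed.

Lemma reach_halt c : c.2 < n ->
  (exists a, [/\ mfin a.1, a.2 < n & forall Z : conf -> bool, Z c -> closed_under predT Z -> Z
    a]) <->
  exists z, mhalt n t c z.
Proof.
move=> cn; split=> [[a [fa _ H]]|[z /run_list[r fr _]]].
  (* The closed set to test with consists of the configurations that [M] reaches, made boolean by
     classical choice of truth values. *)
  suff /asboolP[z r] : `[< exists z, mrun n t c z a >] by exists z, a.
  apply: (H (fun a => `[< exists z, mrun n t c z a >])).
    by apply/asboolP; exists [::]; apply: MRefl.
  move=> b _ /asboolP[z r] _ b' [o E]; apply/asboolP; exists (z ++ oseq o).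
  exact: mrun_trans r (mrun_step E).
exists (last c r); have lin : last c r \in c :: r by rewrite mem_last.
split; [|exact: full_run_lt lin|by move=> Z Zc Zcl; apply: (reach_run _ cn fr).2 lin Z Zc Zcl].
elim: r c fr {cn lin} => //= c' r IH c [_ /IH //].
Qed.

Section Outs.
Variables (c0 : conf) (r : seq conf).
Hypotheses (c0n : c0.2 < n) (fr : full_run c0 r).
Definition outs : seq conf := [seq c <- c0 :: r | cletter c].

Lemma outs_uniq : uniq outs.
Proof. by rewrite filter_uniq // full_run_uniq. Qed.

Lemma next_out a b : a \in outs -> b \in outs ->
  (forall Z : conf -> bool, (forall c', csucc a c' -> Z c') ->
     closed_under (fun c => ~~ cletter c) Z -> Z b) <->
  index b outs = (index a outs).+1.
Proof.
rewrite mem_filter => /andP[oa ain] bouts.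
have an := full_run_lt c0n fr ain.
have [s1 [s2 E]] := mem_split ain.
have fa := full_run_suffix fr E.
have outsE : outs = [seq c <- s1 | cletter c] ++ a :: [seq c <- s2 | cletter c].
  by rewrite /outs E filter_cat /= oa.
have ndup c : c \in [seq c <- s1 | cletter c] -> c \in a :: [seq c <- s2 | cletter c] -> False.
  have := outs_uniq; rewrite outsE cat_uniq => /and3P[_ /hasPn H _] c1 /H.
  by rewrite /= c1.
have ia : index a outs = size [seq c <- s1 | cletter c].
  rewrite outsE index_cat /= eqxx addn0.
  by case: ifP => // /ndup; rewrite mem_head => /(_ isT).
case: (boolP (has (fun c => isSome (cletter c)) s2)) => [hs2|ns2]; last first.
  have fs2 : [seq c <- s2 | cletter c] = [::].
    by apply/eqP; move: ns2; rewrite has_filter negbK.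
  split=> [H|ib]; last first.
    move: bouts; rewrite -index_mem ib ia outsE size_cat fs2 /= addn1 ltnn //.
  (* The rest of the run after [a] is one of the sets quantified over, and here it contains no
     configuration with a letter. *)
  have bs2 : b \in s2.
    apply: (H (mem s2)) => [c' ac'|c cn /mem_split[m1 [m2 Em]] _ c' cc'].
      by case: (s2) fa => [|d s3] /=; [move=> /(negP (csucc_nfin ac'))|
        move=> [ad _]; rewrite (csucc_fun ac' ad) mem_head].
    have := full_run_suffix fa (s1 := a :: m1) (congr1 (cons a) Em).
    case: m2 Em => [|d m2] Em /=; first by move=> /(negP (csucc_nfin cc')).
    by move=> [cd _]; rewrite (csucc_fun cc' cd) Em mem_cat !inE eqxx !orbT.
  have : b \in [seq c <- s2 | cletter c].
    by rewrite mem_filter bs2 andbT; move: bouts; rewrite mem_filter => /andP[].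
  by rewrite fs2.
have [m [b' [s3 [s2E ob' nm]]]] := has_split hs2.
have fs2 : [seq c <- s2 | cletter c] = b' :: [seq c <- s3 | cletter c].
  rewrite s2E filter_cat /= ob' (_ : [seq c <- m | cletter c] = [::]) //.
  by apply/eqP; move: nm; rewrite has_filter negbK.
have ib' : index b' outs = (index a outs).+1.
  rewrite ia outsE index_cat; case: ifP => [/ndup|_].
    by rewrite fs2 !inE eqxx orbT => /(_ isT).
  rewrite fs2 /= eqxx; case: eqP => [ab|_]; last by rewrite addn1.
  by have := outs_uniq; rewrite outsE fs2 ab cat_uniq /= mem_head andbF => /andP[].
have b'outs : b' \in outs by rewrite outsE fs2 mem_cat !inE eqxx !orbT.
split=> [H|ib]; last first.
  have -> : b = b' by rewrite -(nth_index a bouts) ib -ib' nth_index.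
  move=> Z Za Zcl; have sn : forall c, c \in a :: s2 -> c.2 < n by apply: full_run_lt an fa.
  move: fa Za sn; rewrite s2E; elim: m nm {ob' s2E} (a) => [|x m IH] /= nm a1.
    by move=> [s _] Za _; apply: Za.
  move=> [s fx] Za sn; move: nm; rewrite negb_or => /andP[nx nm].
  apply: (IH nm x fx) => [c' xc'|c ci]; last by apply: sn; rewrite inE ci orbT.
  by apply: (Zcl x) => //; [apply: sn; rewrite !inE eqxx orbT|apply: Za].
(* The test set is the silent stretch [m] followed by [b']. It is closed because [b'] has a letter,
   so its step is not demanded. *)
have : b \in rcons m b'.
  apply: (H (mem (rcons m b'))) => [c' ac'|c cn].
    move: fa; rewrite s2E; case: (m) => [|d m'] /= [ad _]; rewrite (csucc_fun ac' ad).
      by rewrite inE eqxx.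
    by rewrite inE eqxx.
  rewrite -[is_true _]/(is_true (c \in rcons m b')) mem_rcons inE => /orP[/eqP->|/mem_split[m1
    [m2 Em]]].
    by move=> /negP[].
  move=> _ c' cc'; have := full_run_suffix fa (s1 := a :: m1) (a := c) (s2 := m2 ++ b' :: s3).
  rewrite s2E Em -catA /= => /(_ erefl).
  case: m2 Em => [|d m2] Em /= [cd _]; rewrite (csucc_fun cc' cd)
    -[is_true _]/(is_true (_ \in rcons _ b')) mem_rcons.
    by rewrite inE eqxx.
  by rewrite !(inE, mem_cat) eqxx !orbT.
rewrite mem_rcons inE => /orP[/eqP-> //|bm].
move: bouts; rewrite mem_filter => /andP[ob _].
by case/negP: nm; apply/hasP; exists b.
Qed.

End Outs.
End RunList.

(** * Formulas describing a run *)

Section Connectives.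
Variables (S G : Type).
Implicit Types f : mso S G.

Definition FAnd f f' : mso S G := FNot (FOr (FNot f) (FNot f')).
Definition FImp f f' : mso S G := FOr (FNot f) f'.
Definition FAll1 x f : mso S G := FNot (FEx1 x (FNot f)).
Definition FAll2 X f : mso S G := FNot (FEx2 X (FNot f)).
Definition FFalse : mso S G := FEx1 0 (FNot (FEq _ _ 0 0)).
Definition FTrue : mso S G := FNot FFalse.
Definition FSome (J : finType) (P : pred J) (F : J -> mso S G) : mso S G :=
  foldr (fun j f => FOr (F j) f) FFalse [seq j <- enum J | P j].
Definition FEvery (J : finType) (P : pred J) (F : J -> mso S G) : mso S G :=
  FNot (FSome P (fun j => FNot (F j))).
End Connectives.
Arguments FFalse {S G}.
Arguments FTrue {S G}.

Section Sat.
Variables (S : eqType) (G : Type) (g : graph S G).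
Variables (nu : nat -> option (gV g)) (mu : nat -> {set gV g}).
Implicit Types f : mso S G.

Lemma sat_and f f' : sat nu mu (FAnd f f') = sat nu mu f && sat nu mu f'.
Proof. by rewrite /= -negb_and negbK. Qed.

Lemma sat_imp f f' : sat nu mu (FImp f f') = (sat nu mu f ==> sat nu mu f').
Proof. by rewrite /= implybE. Qed.

Lemma sat_ex1 x f : sat nu mu (FEx1 x f) = [exists v, sat (upd nu x (Some v)) mu f].
Proof. by []. Qed.

Lemma sat_all1 x f : sat nu mu (FAll1 x f) = [forall v, sat (upd nu x (Some v)) mu f].
Proof. by rewrite /= negb_exists; apply: eq_forallb => v; rewrite /= negbK. Qed.

Lemma sat_all2 X f : sat nu mu (FAll2 X f) = [forall A : {set gV g}, sat nu (upd mu X A) f].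
Proof. by rewrite /= negb_exists; apply: eq_forallb => v; rewrite /= negbK. Qed.

Lemma sat_false : sat nu mu FFalse = false.
Proof. by apply/existsP => -[v] /=; rewrite eqxx. Qed.

Lemma sat_true : sat nu mu FTrue.
Proof. exact: (negbT sat_false). Qed.

Lemma sat_some (J : finType) (P : pred J) (F : J -> mso S G) :
  sat nu mu (FSome P F) = [exists (j | P j), sat nu mu (F j)].
Proof.
rewrite /FSome; transitivity (has (fun j => sat nu mu (F j)) [seq j <- enum J | P j]).
  elim: [seq j <- enum J | P j] => [|j s IH]; first exact: sat_false.
  by rewrite -[LHS]/(sat nu mu (F j) || sat nu mu (foldr _ _ s)) IH.
apply/hasP/existsP => [[j]|[j /andP[Pj sj]]].
  by rewrite mem_filter => /andP[Pj _] sj; exists j; rewrite Pj.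
by exists j; rewrite // mem_filter Pj mem_enum.
Qed.

Lemma sat_every (J : finType) (P : pred J) (F : J -> mso S G) :
  sat nu mu (FEvery P F) = [forall (j | P j), sat nu mu (F j)].
Proof.
rewrite -[LHS]/(~~ sat nu mu (FSome P (fun j => FNot (F j)))) sat_some negb_exists.
by apply: eq_forallb => j; rewrite negb_and implybE /= negbK.
Qed.
End Sat.

Section WordFormulas.
Variables (L : Type) (S : eqType) (G : finType) (lab : L -> S) (e : L -> G -> bool).
Variable u : seq L.
Local Notation n := (size u).
Local Notation wsat := (wsat lab e u).
Implicit Types (f : mso S G) (nb sb : valn) (x y i : nat).

Lemma wsat_and nb sb f f' : wsat nb sb (FAnd f f') <-> wsat nb sb f /\ wsat nb sb f'.
Proof. by rewrite /= not_orE !not_notE. Qed.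

Lemma wsat_or nb sb f f' : wsat nb sb (FOr f f') <-> wsat nb sb f \/ wsat nb sb f'.
Proof. by []. Qed.

Lemma wsat_imp nb sb f f' : wsat nb sb (FImp f f') <-> (wsat nb sb f -> wsat nb sb f').
Proof.
split=> [[nf /nf//|f1 _ //]|H] /=.
by case: (lem (wsat nb sb f)) => ?; [right; apply: H|left].
Qed.

Lemma wsat_all1 nb sb x f :
  wsat nb sb (FAll1 x f) <-> forall i, i < n -> wsat (set_pos nb x i) sb f.
Proof.
rewrite /= -forallNE; split=> [H i iN|H i [iN]]; last by move=> nf; apply: nf; apply: H.
by have := H i; rewrite not_andE not_notE => -[|//]; case.
Qed.

Lemma wsat_all2 nb sb X f :
  wsat nb sb (FAll2 X f) <-> forall Z, wsat nb (set_set sb X Z) f.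
Proof. by rewrite /= -forallNE; split=> H Z; have := H Z; rewrite not_notE. Qed.

Lemma wsat_false nb sb : ~ wsat nb sb FFalse.
Proof.
move=> [i [iN]] /=; apply; exists i.
by rewrite /set_pos /= eqxx.
Qed.

Lemma wsat_some (J : finType) (P : pred J) (F : J -> mso S G) nb sb :
  wsat nb sb (FSome P F) <-> exists2 j, P j & wsat nb sb (F j).
Proof.
transitivity (exists2 j, j \in [seq j <- enum J | P j] & wsat nb sb (F j)); last first.
  split=> [[j]|[j Pj H]]; last by exists j; rewrite // mem_filter Pj mem_enum.
  by rewrite mem_filter => /andP[Pj _] H; exists j.
rewrite /FSome; elim: [seq j <- enum J | P j] => [|j s IH].
  by split=> [/wsat_false//|[]].
rewrite -[wsat _ _ _]/(wsat nb sb (F j) \/ wsat nb sb (foldr _ _ s)) IH; split.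
  by case=> [|[j' js]] H; [exists j|exists j']; rewrite // inE ?eqxx ?js ?orbT.
by move=> [j']; rewrite inE => /orP[/eqP->|js] H; [left|right; exists j'].
Qed.

Lemma wsat_every (J : finType) (P : pred J) (F : J -> mso S G) nb sb :
  wsat nb sb (FEvery P F) <-> forall j, P j -> wsat nb sb (F j).
Proof.
rewrite -[wsat _ _ _]/(~ wsat nb sb (FSome P (fun j => FNot (F j)))) wsat_some.
split=> [H j Pj|H [j Pj]]; last by apply; apply: H.
by apply: contrapT => nF; apply: H; exists j.
Qed.

Lemma wsat_alls nb sb s f : wsat nb sb (foldr (@FAll2 S G) f s) <->
  forall Z : nat -> nat -> bool, wsat nb (fun p X => if X \in s then Z X p else sb p X) f.
Proof.
elim: s sb => [|X s IH] sb /=; first by split=> [H Z|/(_ (fun _ _ => true))].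
rewrite -[~ _]/(wsat nb sb (FAll2 X (foldr (@FAll2 S G) f s))) wsat_all2; split.
  move=> H Z; have /IH/(_ Z) := H (Z X).
  congr (wsat _ _ _); apply/funext => p; apply/funext => Y; rewrite inE /set_set.
  by case: eqP => [->|] //=; rewrite if_same.
move=> H Z0; apply/IH => Z; have := H (fun Y p => if Y \in s then Z Y p else Z0 p).
congr (wsat _ _ _); apply/funext => p; apply/funext => Y; rewrite inE /set_set.
by case: eqP => [->|] //=; case: (_ \in s).
Qed.

Definition at1 nb x i := forall p, nb p x = (p == i).

Lemma at1_set nb x i : at1 (set_pos nb x i) x i.
Proof. by move=> p; rewrite /set_pos eqxx. Qed.

Lemma at1_skip nb x y i j : x != y -> at1 nb x i -> at1 (set_pos nb y j) x i.
Proof. by move=> /negbTE xy H p; rewrite /set_pos xy. Qed.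

Lemma wsat_in nb sb x X i : at1 nb x i -> i < n -> wsat nb sb (FIn _ _ x X) <-> sb i X.
Proof.
move=> H iN; split=> [[p [_]]|sX]; first by rewrite H => /eqP->.
by exists i; rewrite H.
Qed.

Definition FAdj x y : mso S G := FSome predT (fun c => FEdge S c x y).

Hypothesis u_edge : forall i a, onth u i = Some a -> i.+1 < n -> exists c, e a c.

Lemma wsat_adj nb sb x y i j : at1 nb x i -> at1 nb y j -> i < n -> j < n ->
  wsat nb sb (FAdj x y) <-> j = i.+1.
Proof.
move=> Hx Hy iN jN; rewrite wsat_some; split=> [[c _ [p [a [_ _ /andP[+ _]]]]]|jE].
  by rewrite Hx Hy => /eqP-> /eqP.
move: (jN); rewrite jE => iN1; case E: (onth u i) (onthTE u i) => [a|]; last by rewrite iN.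
by have [c ec] := u_edge E iN1; exists c => //; exists i, a; rewrite Hx Hy ec jE !eqxx.
Qed.

(** Variable 3 is reserved for a bound neighbour and variable 2 for a bound current position, while
    0 and 1 stay free for the node and edge formulas. This explains the side conditions [x != 3]. *)
Definition FFirst x : mso S G := FNot (FEx1 3 (FAdj 3 x)).
Definition FLast x : mso S G := FNot (FEx1 3 (FAdj x 3)).

Lemma wsat_first nb sb x i : x != 3 -> at1 nb x i -> i < n -> wsat nb sb (FFirst x) <-> i = 0.
Proof.
move=> x3 Hx iN; split=> [H|i0 [j [jN /(wsat_adj _ (at1_set _ _ _) (at1_skip _ x3 Hx) jN iN)]]].
  case: i iN Hx H => // i iN Hx []; exists i; split; first exact: ltnW.
  by apply/(wsat_adj _ (at1_set _ _ _) (at1_skip _ x3 Hx)) => //; apply: ltnW.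
by rewrite i0.
Qed.

Lemma wsat_last nb sb x i : x != 3 -> at1 nb x i -> i < n -> wsat nb sb (FLast x) <-> i.+1 = n.
Proof.
move=> x3 Hx iN; split=> [H|iE [j [jN /(wsat_adj _ (at1_skip _ x3 Hx) (at1_set _ _ _) iN jN)]]].
  apply/eqP; rewrite eqn_leq iN leqNgt; apply/negP => iN1; case: H.
  exists i.+1; split=> //.
  by apply/(wsat_adj _ (at1_skip _ x3 Hx) (at1_set _ _ _)).
by move=> jE; move: jN; rewrite jE iE ltnn.
Qed.

Section Machine.
Variables (I C : finType) (M : mach I C) (L2 : Type) (inj : C -> L2) (haltL : option L2).
Local Notation conf := (mQ M * nat)%type.

(** One set variable per letter of the guessed word, holding the positions of that letter. The
    variables from [#|I|] on hold, for each state [q], the positions [p] for which the configuration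
    [(q, p)] belongs to the set under consideration. *)
Definition par_var (x : I) : nat := enum_rank x.
Definition conf_var (q : mQ M) : nat := #|I| + enum_rank q.

(** With a universal quantifier over neighbours the formula holds vacuously when the head would
    leave the word, in agreement with [mmove] being [None]. *)
Definition FGo (q : mQ M) (m : move) x : mso S G :=
  match m with
  | MStay => FIn S G x (conf_var q)
  | MRight => FAll1 3 (FImp (FAdj x 3) (FIn S G 3 (conf_var q)))
  | MLeft => FAll1 3 (FImp (FAdj 3 x) (FIn S G 3 (conf_var q)))
  end.

Definition FStep (q : mQ M) x : mso S G :=
  FEvery predT (fun a => FImp (FIn S G x (par_var a))
    (if mfin q then FTrue
     else if mdelta q a is Some (q', _, m) then FGo q' m x else FTrue)).

Definition FLetter (P : pred L2) (q : mQ M) x : mso S G :=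
  FSome (fun a => oapp P false (conf_letter inj haltL q a))
        (fun a => FIn S G x (par_var a)).

Definition FClosed (silent : bool) : mso S G :=
  FEvery predT (fun q => FAll1 2 (FImp
    (FAnd (FIn S G 2 (conf_var q)) (if silent then FNot (FLetter predT q 2) else FTrue))
    (FStep q 2))).

(** Least closed set as an intersection of all closed ones. [start] is a parameter since
    reachability is used both from the initial configuration and from the successor of a given
    one. *)
Definition FReach (start : mso S G) silent (q : mQ M) x : mso S G :=
  foldr (@FAll2 S G) (FImp (FAnd start (FClosed silent)) (FIn S G x (conf_var q)))
    [seq conf_var q' | q' <- enum (mQ M)].

Definition FStart : mso S G := FAll1 2 (FImp (FFirst 2) (FIn S G 2 (conf_var (mstart M)))).

Variables (v : seq I) (x0 : I).
Local Notation t := (nth x0 v).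
Definition par_ok sb := forall i a, i < n -> sb i (par_var a) = (t i == a).
Definition conf_val sb (c : conf) : bool := sb c.2 (conf_var c.1).

Lemma wsat_par nb sb x i (F : I -> mso S G) : par_ok sb -> at1 nb x i -> i < n ->
  wsat nb sb (FEvery predT (fun a => FImp (FIn S G x (par_var a)) (F a))) <-> wsat nb sb (F (t
    i)).
Proof.
move=> sb_ok Hx iN; rewrite wsat_every; split=> [/(_ (t i) isT)/wsat_imp H|H a _].
  by apply: H; apply/(wsat_in _ _ Hx) => //; rewrite sb_ok.
by apply/wsat_imp => /(wsat_in _ _ Hx iN); rewrite sb_ok // => /eqP<-.
Qed.

Lemma wsat_letter (P : pred L2) nb sb q x i : par_ok sb -> at1 nb x i -> i < n ->
  wsat nb sb (FLetter P q x) <-> oapp P false (cletter inj haltL t (q, i)).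
Proof.
move=> sb_ok Hx iN; rewrite wsat_some; split=> [[a Pa /(wsat_in _ _ Hx iN)]|H].
  by rewrite sb_ok // => /eqP ta; rewrite /cletter /= ta.
by exists (t i) => //; apply/(wsat_in _ _ Hx iN); rewrite sb_ok.
Qed.

Lemma wsat_go nb sb q m x i : x != 3 -> at1 nb x i -> i < n ->
  wsat nb sb (FGo q m x) <-> forall j, mmove n i m = Some j -> conf_val sb (q, j).
Proof.
move=> x3 Hx iN; case: m; rewrite /FGo /mmove.
- rewrite wsat_all1; split=> [H j|H j jN].
    case: i iN Hx => // i iN Hx [<-]; have iN' := ltnW iN.
    have /wsat_imp := H i iN'; rewrite (wsat_in _ _ (at1_set _ _ _) iN'); apply.
    by apply/(wsat_adj _ (at1_set _ _ _) (at1_skip _ x3 Hx) iN' iN).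
  apply/wsat_imp => /(wsat_adj _ (at1_set _ _ _) (at1_skip _ x3 Hx) jN iN) iE.
  by apply/(wsat_in _ _ (at1_set _ _ _) jN); apply: (H j); rewrite iE.
- by rewrite (wsat_in _ _ Hx iN); split=> [H j [<-]|H] //; apply: H.
- rewrite wsat_all1; split=> [H j|H j jN].
    case: ifP => // iN1 [<-]; have /wsat_imp := H _ iN1.
    rewrite (wsat_in _ _ (at1_set _ _ _) iN1); apply.
    by apply/(wsat_adj _ (at1_skip _ x3 Hx) (at1_set _ _ _) iN iN1).
  apply/wsat_imp => /(wsat_adj _ (at1_skip _ x3 Hx) (at1_set _ _ _) iN jN) jE.
  by apply/(wsat_in _ _ (at1_set _ _ _) jN); apply: (H j); rewrite -jE jN.
Qed.

Lemma wsat_true nb sb : wsat nb sb FTrue.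
Proof. exact: wsat_false. Qed.

Lemma wsat_step nb sb q x i : par_ok sb -> x != 3 -> at1 nb x i -> i < n ->
  wsat nb sb (FStep q x) <-> forall c', csucc n t (q, i) c' -> conf_val sb c'.
Proof.
move=> sb_ok x3 Hx iN; rewrite wsat_par //; split.
  move=> + [q' j] [o]; rewrite /mstep /=; case: ifP => // _.
  case: mdelta => [[[q1 o1] m]|] // /(wsat_go _ _ _ x3 Hx iN) H.
  by case mE: mmove => [j1|] //= [<- <- _]; apply: H.
move=> H; case: ifP => fq; first exact: wsat_true.
case E: mdelta => [[[q1 o1] m]|]; last exact: wsat_true.
apply/(wsat_go _ _ _ x3 Hx iN) => j mE; apply: H; exists o1.
by rewrite /mstep /= fq E mE.
Qed.

Lemma wsat_closed nb sb silent : par_ok sb ->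
  wsat nb sb (FClosed silent) <->
  closed_under n t (if silent then (fun c => ~~ cletter inj haltL t c) else predT) (conf_val sb).
Proof.
move=> sb_ok; rewrite wsat_every; split.
  move=> H [q i] iN Zc Dc c' cc'; have /wsat_all1/(_ i iN)/wsat_imp := H q isT.
  rewrite wsat_and (wsat_in _ _ (at1_set _ _ _) iN) (wsat_step _ sb_ok _ (at1_set _ _ _)) //.
  apply=> //; split=> //; case: silent Dc {H} => Dc; last exact: wsat_true.
  by move/(wsat_letter _ _ sb_ok (at1_set _ _ _) iN); move: Dc; case: cletter.
move=> H q _; apply/wsat_all1 => i iN; apply/wsat_imp.
rewrite wsat_and (wsat_in _ _ (at1_set _ _ _) iN) (wsat_step _ sb_ok _ (at1_set _ _ _)) //.
move=> [Zc D] c' cc'; apply: (H (q, i)) cc' => //.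
case: (silent) D => // D; apply/negP => lc; apply: D.
by apply/(wsat_letter _ _ sb_ok (at1_set _ _ _) iN); case: cletter lc.
Qed.

Definition with_conf sb (Z : conf -> bool) : valn :=
  fun p X => if [pick q | conf_var q == X] is Some q then Z (q, p) else sb p X.

Lemma conf_val_with sb Z : conf_val (with_conf sb Z) = Z.
Proof.
apply/funext => -[q p]; rewrite /conf_val /with_conf /=.
case: pickP => [q' /eqP/addnI/val_inj/enum_rank_inj-> //|/(_ q)].
by rewrite eqxx.
Qed.

Lemma par_ok_with sb Z : par_ok sb -> par_ok (with_conf sb Z).
Proof.
move=> H i a iN; rewrite /with_conf; case: pickP => [q /eqP E|_]; last exact: H.
by have := ltn_ord (enum_rank a); rewrite -[X in X < _]/(par_var a) -E ltnNge leq_addr.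
Qed.

Lemma wsat_reach (start : mso S G) (Start : (conf -> bool) -> Prop) silent nb sb q x i :
  par_ok sb -> at1 nb x i -> i < n ->
  (forall sb', par_ok sb' -> wsat nb sb' start <-> Start (conf_val sb')) ->
  wsat nb sb (FReach start silent q x) <->
  forall Z, Start Z ->
    closed_under n t (if silent then (fun c => ~~ cletter inj haltL t c) else predT) Z -> Z (q,
      i).
Proof.
move=> sb_ok Hx iN HS; rewrite wsat_alls; split=> [H Z SZ clZ|H Z].
  have := H (fun X p => with_conf sb Z p X).
  rewrite (_ : (fun p X => _) = with_conf sb Z); last first.
    apply/funext => p; apply/funext => X; case: ifP => // XN.
    by rewrite /with_conf; case: pickP => // q' /eqP E; rewrite -E map_f ?mem_enum in XN.
  have ok' := par_ok_with Z sb_ok.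
  move/wsat_imp; rewrite wsat_and (wsat_closed _ _ ok') (HS _ ok') conf_val_with.
  by rewrite (wsat_in _ _ Hx iN) -[with_conf _ _ _ _]/(conf_val (with_conf sb Z) (q, i))
    conf_val_with; apply.
set sb' := (fun p X => _).
have sb'E : sb' = with_conf sb (fun c => Z (conf_var c.1) c.2).
  apply/funext => p; apply/funext => X; rewrite /sb' /with_conf; case: pickP => [q' /eqP<-|none].
    by rewrite map_f ?mem_enum.
  by case: mapP => // -[q' _ E]; have := none q'; rewrite E eqxx.
rewrite sb'E; set Z' := (fun c : conf => _); have ok' := par_ok_with Z' sb_ok.
apply/wsat_imp; rewrite wsat_and (wsat_closed _ _ ok') (HS _ ok') conf_val_with => -[SZ clZ].
by rewrite (wsat_in _ _ Hx iN) -[with_conf _ _ _ _]/(conf_val (with_conf sb Z') (q, i))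
  conf_val_with; apply: H.
Qed.

Lemma wsat_start nb sb : 0 < n -> wsat nb sb FStart <-> conf_val sb (mstart M, 0).
Proof.
move=> n0; rewrite wsat_all1; split=> [/(_ 0 n0)/wsat_imp|H i iN].
  by rewrite (wsat_first _ _ (at1_set _ _ _)) // (wsat_in _ _ (at1_set _ _ _)) //; apply.
apply/wsat_imp; rewrite (wsat_first _ _ (at1_set _ _ _)) // (wsat_in _ _ (at1_set _ _ _)) //.
by move=> ->.
Qed.

End Machine.
End WordFormulas.

Lemma inj_surj_bij (T U : finType) (f : T -> U) :
  injective f -> (forall y, exists x, f x = y) -> bijective f.
Proof.
by move=> f_inj /fin_all_exists[h hK]; exists h => // x; apply: f_inj.
Qed.

Lemma iso_sym (S G : Type) (g h : graph S G) : iso g h -> iso h g.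
Proof.
move=> [f [[f' fK f'K] [f_lab f_edge]]]; exists f'; split; first by exists f.
by split=> [x|x c y]; rewrite -?f_lab -?f_edge !f'K.
Qed.

Lemma iso_trans (S G : Type) (g h k : graph S G) : iso g h -> iso h k -> iso g k.
Proof.
move=> [f [f_bij [f_lab f_edge]]] [f' [f'_bij [f'_lab f'_edge]]].
exists (f' \o f); split; first exact: bij_comp.
by split=> [x|x c y] /=; rewrite ?f'_lab ?f'_edge.
Qed.

(** * From machines to transductions *)

Section MachToNmso.
Variables (L : finType) (S1 : eqType) (G1 : finType) (lab : L -> S1) (e : L -> G1 -> bool).
Variables (W : seq L -> Prop) (FString : mso S1 G1) (FLet : L -> nat -> mso S1 G1).
Hypothesis FStringP : forall (g : graph S1 G1) mu,
  @sat S1 G1 g (nv0 _) mu FString <-> exists2 u, W u & iso (wgraph lab e u) g.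
Hypothesis W_edge : forall u, W u -> forall i a, onth u i = Some a -> i.+1 < size u ->
  exists c, e a c.
Hypothesis FLetP : forall u, W u -> forall nb sb a x i, x != 3 -> at1 nb x i -> i < size u ->
  wsat lab e u nb sb (FLet a x) <-> onth u i = Some a.
Variables (I C : finType) (valid : bool -> bool -> L -> I -> bool) (M : mach I C).
Variables (S2 G2 : finType) (L2 : Type) (lab2 : L2 -> S2) (e2 : L2 -> G2 -> bool).
Variables (inj : C -> L2) (haltL : option L2) (eps : bool).

Hypothesis eps_halt : eps -> haltL = None.

Definition out_enc (z : seq C) : seq L2 := map inj z ++ oseq haltL.

(** The two flags tell [valid] whether a position is the first or the last one; cells of a folded
    tape have to record this. *)
Definition valid_word (u : seq L) (v : seq I) : Prop :=
  size v = size u /\ forall i a b, onth u i = Some a -> onth v i = Some b ->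
    valid (i == 0) (i.+1 == size u) a b.

(** The empty word has no position at which a configuration could live, so [eps] decides separately
    whether it is related to the empty output. *)
Definition mach_rel (u : seq L) (z : seq C) : Prop :=
  if u is [::] then eps /\ out_enc z = [::]
  else exists v x0, valid_word u v /\ macc M (size u) (nth x0 v) z.

Definition FLit (b : bool) (f : mso S1 G1) := if b then f else FNot f.
Definition FEmpty : mso S1 G1 := FNot (FEx1 0 FTrue).
(** The disjunct chosen at a position fixes both flags, the input letter and the guess, and requires
    that the position lies in the parameter set of that guess and in no other. *)
Definition FValid : mso S1 G1 := FAll1 2 (FSome
  (fun y : bool * bool * L * I => valid y.1.1.1 y.1.1.2 y.1.2 y.2)
  (fun y => FAnd (FAnd (FLit y.1.1.1 (FFirst S1 G1 2)) (FLit y.1.1.2 (FLast S1 G1 2)))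
     (FAnd (FLet y.1.2 2)
        (FEvery predT (fun a => FLit (a == y.2) (FIn S1 G1 2 (par_var a))))))).
Definition FAccept : mso S1 G1 :=
  FEx1 2 (FSome (mfin (m := M)) (fun q => FReach inj haltL (FStart S1 G1 M) false q 2)).

(** The copies are the states, so node [(x, q)] stands for a configuration. It satisfies a label
    formula when it is reached and has a letter, and then exactly one, since the label is a function
    of that letter. An edge joins it to the next configuration with a letter. *)
Definition nmso_of_mach : nmso S1 G1 S2 G2 :=
  @NMso S1 G1 S2 G2 #|I|
    (FAnd FString (FOr (FAnd FEmpty (if eps then FTrue else FFalse))
                       (FAnd (FNot FEmpty) (FAnd FValid FAccept))))
    (mQ M)
    (fun q s => FAnd (FReach inj haltL (FStart S1 G1 M) false q 0)
                     (FLetter S1 G1 inj haltL (fun l => lab2 l == s) q 0))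
    (fun q q' c => FAnd (FLetter S1 G1 inj haltL (fun l => e2 l c) q 0)
                        (FReach inj haltL (FStep S1 G1 q 0) true q' 1)).

Section Word.
Variables (u : seq L) (g : graph S1 G1) (f : 'I_(size u) -> gV g).
Hypotheses (Wu : W u) (f_bij : bijective f)
  (f_lab : forall i, glab g (f i) = lab (tnth (in_tuple u) i))
  (f_edge : forall i c j,
     gE g (f i) c (f j) = (val j == (val i).+1) && e (tnth (in_tuple u) i) c).
Variable X : 'I_#|I| -> {set gV g}.
Local Notation n := (size u).
Local Notation sb := (set_val f (pval X)).
Let u_edge := W_edge Wu.

Lemma satE nu phi : sat nu (pval X) phi <-> wsat lab e u (pos_val f nu) sb phi.
Proof. exact: sat_wsat. Qed.

Lemma pos1_at i : at1 (pos1 i) 0 i.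
Proof. by []. Qed.

Lemma pos2_at0 i j : at1 (pos2 i j) 0 i.
Proof. by move=> p; rewrite /pos2 /= orbF. Qed.

Lemma pos2_at1 i j : at1 (pos2 i j) 1 j.
Proof. by []. Qed.

Lemma sb_par (a : I) (i : 'I_n) : sb i (par_var a) = (f i \in X (enum_rank a)).
Proof. by rewrite set_valP /pval /par_var valK. Qed.

Lemma wsat_lit nb b phi : wsat lab e u nb sb (FLit b phi) <-> (wsat lab e u nb sb phi <-> b).
Proof.
case: b; first by split=> [H|[_ H]]; [split|apply: H].
by split=> [H|[H _]]; [split|move/H].
Qed.

Lemma wsat_valid nb : wsat lab e u nb sb FValid <->
  exists v, valid_word u v /\ forall x0, par_ok u v x0 sb.
Proof.
rewrite wsat_all1.
have litsP i y : i < n ->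
  wsat lab e u (set_pos nb 2 i) sb (FAnd (FAnd (FLit y.1.1.1 (FFirst S1 G1 2)) (FLit y.1.1.2
    (FLast S1 G1 2)))
     (FAnd (FLet y.1.2 2) (FEvery predT (fun a => FLit (a == y.2) (FIn S1 G1 2 (par_var a))))))
       <->
  [/\ y.1.1.1 = (i == 0), y.1.1.2 = (i.+1 == n), onth u i = Some y.1.2 &
      forall a : I, sb i (par_var a) = (y.2 == a)].
  move=> iN; have at2 := at1_set nb 2 i.
  rewrite !wsat_and !wsat_lit (wsat_first _ u_edge _ _ at2) // (wsat_last _ u_edge _ _ at2) //.
  rewrite (FLetP Wu _ _ _ at2) // wsat_every; split.
    move=> [[H1 H2] [H3 H4]]; split=> //.
    - by apply/idP/eqP => [/H1|/H1].
    - by apply/idP/eqP => [/H2|/H2].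
    move=> a; have := H4 a isT; rewrite wsat_lit (wsat_in _ _ _ _ at2) // eq_sym => H.
    by apply/idP/idP => /H.
  move=> [-> -> H3 H4]; split; first by split; split=> /eqP.
  by split=> // a _; rewrite wsat_lit (wsat_in _ _ _ _ at2) // H4 eq_sym.
split=> [H|[v [[sv vP] v_ok]] i iN].
  have /fin_all_exists[w wP] (i : 'I_n) : exists a, (forall b, onth u i = Some b ->
      valid (val i == 0) ((val i).+1 == n) b a) /\ forall b, sb i (par_var b) = (a == b).
    have /wsat_some[[[[b1 b2] a] b] ok H2] := H i (ltn_ord i).
    have [/= E1 E2 E3 E4] := (litsP i (b1, b2, a, b) (ltn_ord i)).1 H2.
    by exists b; split=> // b'; rewrite E3 => -[<-]; rewrite -E1 -E2.
  have wE (i : 'I_n) : onth (codom w) i = Some (w i).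
    rewrite /codom /image_mem onth_map; case E: (onth _ i) (onthTE (enum 'I_n) i) => [j|].
      by rewrite -[j](onth_nth i _ _ _ E) nth_ord_enum.
    by rewrite size_enum_ord ltn_ord.
  exists (codom w); split; last first.
    move=> x0 i a iN; have := (wP (Ordinal iN)).2 a; rewrite /= => ->.
    by rewrite (onth_nth x0 _ _ _ (wE (Ordinal iN))).
  rewrite /valid_word size_codom card_ord; split=> // i a b ua.
  have iN : i < n by rewrite -onthTE ua.
  by rewrite (wE (Ordinal iN)) => -[<-]; apply: (wP (Ordinal iN)).1.
apply/wsat_some; case ua: (onth u i) (onthTE u i) => [a|]; last by rewrite iN.
case vb: (onth v i) (onthTE v i) => [b|]; last by rewrite sv iN.
move=> _ _; exists (i == 0, i.+1 == n, a, b); first exact: vP.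
apply/litsP => //=; split=> // c; rewrite (v_ok b) //.
by rewrite (onth_nth b _ _ _ vb).
Qed.

Section Accepting.
Variables (v : seq I) (x0 : I) (z : seq C).
Hypotheses (n0 : 0 < n) (v_ok : par_ok u v x0 sb).
Local Notation t := (nth x0 v).
Hypothesis acc : macc M n t z.
Local Notation T := nmso_of_mach.
Local Notation letter := (cletter inj haltL t).

Lemma is_output_run : is_output (T := T) X (wgraph lab2 e2 (out_enc z)).
Proof.
have [r fr rE] := run_list inj haltL acc.
have c0n : (mstart M, 0).2 < n by [].
(* The isomorphism sends a node to the index of its configuration in this list. *)
pose O := outs inj haltL t (mstart M, 0) r.
have OE : map Some (out_enc z) = map letter O.
  by rewrite /out_enc -rE -[RHS]/(map letter (filter _ _)) pmapS_filter.
have sO : size (out_enc z) = size O by rewrite -(size_map Some) OE size_map.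
have On c : c \in O -> c.2 < n by rewrite mem_filter => /andP[_]; apply: (full_run_lt c0n fr).
have OX c l : c \in O -> letter c = Some l -> onth (out_enc z) (index c O) = Some l.
  move=> cO lE; have : onth (map Some (out_enc z)) (index c O) = Some (Some l).
    rewrite OE onth_map -lE; case E: (onth O _) (onthTE O (index c O)) => [c'|].
      by rewrite -[c'](onth_nth c _ _ _ E) nth_index.
    by rewrite index_mem cO.
  by rewrite onth_map; case: onth => //= a [->].
have reachP q x i nb : at1 nb x i -> i < n ->
    wsat lab e u nb sb (FReach inj haltL (FStart S1 G1 M) false q x) <->
    (q, i) \in (mstart M, 0) :: r.
  move=> Hx iN; rewrite -(reach_run _ c0n fr).
  apply: (wsat_reach u_edge inj haltL (Start := fun Z => Z (mstart M, 0)) _ _ v_ok Hx iN).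
  by move=> sb' _; apply: wsat_start.
have [f' fK f'K] := f_bij.
have nodeP (p : gV g * mQ M) s :
    sat (nv1 p.1) (pval X) (nnode T p.2 s) <->
    (p.2, val (f' p.1)) \in O /\ omap lab2 (letter (p.2, val (f' p.1))) = Some s.
  rewrite -{1}(f'K p.1) satE pos_val_nv1 // wsat_and (reachP _ _ _ _ (pos1_at _)) ?ltn_ord //.
  rewrite (wsat_letter _ _ _ _ _ _ v_ok (pos1_at _)) ?ltn_ord // mem_filter.
  case: (cletter _ _ _ _) => [l|] /=; last by split=> -[].
  by split=> [[-> /eqP->]|[-> [->]]].
have outP (p : gV g * mQ M) : out_node (T := T) X p <-> (p.2, val (f' p.1)) \in O.
  split=> [/eqP/mem_card1[s /(_ s)]|cO].
    by rewrite !inE eqxx => /nodeP[].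
  have := cO; rewrite mem_filter => /andP[+ _]; case lE: letter => [l|] // _.
  apply/eqP; apply: (@eq_card1 _ (lab2 l)) => s; rewrite !inE.
  by apply/idP/eqP => [/nodeP[_]|->]; [rewrite lE => -[]|apply/nodeP; rewrite lE].
have idx_lt (p : {p : gV g * mQ M | out_node (T := T) X p}) :
    index ((val p).2, val (f' (val p).1)) O < size (out_enc z).
  by rewrite sO index_mem; apply/outP/valP.
pose F p : 'I_(size (out_enc z)) := Ordinal (idx_lt p).
exists F; split; [|split].
- apply: inj_surj_bij => [p p' /(congr1 val)/= E|k].
    have pO := (outP _).1 (valP p); have p'O := (outP _).1 (valP p').
    have := nth_index (mstart M, 0) pO; rewrite E nth_index //.
    case: p p' {E pO p'O} => [[x q] o] [[x' q'] o'] /= [qq' /val_inj/(can_inj f'K) xx'].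
    by apply: val_inj; rewrite /= xx' qq'.
  have kO : nth (mstart M, 0) O k \in O by rewrite mem_nth // -sO.
  pose p := (f (Ordinal (On _ kO)), (nth (mstart M, 0) O k).1).
  have po : out_node (T := T) X p by apply/outP; rewrite /p /= fK /= -surjective_pairing.
  exists (exist _ p po); apply: val_inj; rewrite /= /p /= fK /= -surjective_pairing.
  by rewrite index_uniq // -?sO //; apply: outs_uniq fr.
- move=> p; apply/nodeP; have pO := (outP _).1 (valP p); split=> //.
  have := pO; rewrite mem_filter => /andP[+ _]; case lE: letter => [l|] // _.
  have := OX _ _ pO lE; rewrite -[index _ _]/(val (F p)) tnth_word => -[<-].
  by [].
move=> p p' c; have pO := (outP _).1 (valP p); have p'O := (outP _).1 (valP p').
have := pO; rewrite mem_filter => /andP[+ _]; case lE: letter => [l|] // _.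
have tE : tnth (in_tuple (out_enc z)) (F p) = l.
  by have := OX _ _ pO lE; rewrite -[index _ _]/(val (F p)) tnth_word => -[].
rewrite [LHS]/= tE; apply/idP/idP.
  move=> /andP[/eqP/(next_out c0n fr pO p'O) RS ec].
  apply/satE; rewrite -(f'K (val p).1) -(f'K (val p').1) pos_val_nv2 // wsat_and.
  rewrite (wsat_letter _ _ _ _ _ _ v_ok (pos2_at0 _ _)) ?ltn_ord // lE; split=> //.
  apply/(wsat_reach u_edge inj haltL _ _ v_ok (pos2_at1 _ _) (ltn_ord _)); last exact: RS.
  by move=> sb' ok'; apply: (wsat_step _ u_edge _ ok' _ (pos2_at0 _ _) (ltn_ord _)).
move=> /satE; rewrite -(f'K (val p).1) -(f'K (val p').1) pos_val_nv2 // wsat_and.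
rewrite (wsat_letter _ _ _ _ _ _ v_ok (pos2_at0 _ _)) ?ltn_ord // lE => -[ec].
move=> /(wsat_reach u_edge inj haltL _ _ v_ok (pos2_at1 _ _) (ltn_ord _)) RS.
apply/andP; split=> //; apply/eqP; rewrite !fK; apply: (next_out c0n fr pO p'O).1; apply: RS.
by move=> sb' ok'; apply: (wsat_step _ u_edge _ ok' _ (pos2_at0 _ _) (ltn_ord _)).
Qed.
End Accepting.

Lemma wsat_accept nb v x0 : 0 < n -> par_ok u v x0 sb ->
  wsat lab e u nb sb FAccept <-> exists z, macc M n (nth x0 v) z.
Proof.
move=> n0 v_ok; rewrite /macc -(reach_halt inj haltL (M := M) (nth x0 v) (c := (mstart M, 0))
  n0); split.
  move=> [i [iN /wsat_some[q fq]]].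
  move=> /(wsat_reach u_edge inj haltL (Start := fun Z => Z (mstart M, 0)) _ _ v_ok (at1_set _ _
    _) iN) H.
  exists (q, i); split=> //; apply: H => sb' _; exact: wsat_start.
move=> [[q i] [fq iN H]]; exists i; split=> //; apply/wsat_some; exists q => //.
apply/(wsat_reach u_edge inj haltL (Start := fun Z => Z (mstart M, 0)) _ _ v_ok (at1_set _ _ _)
  iN) => //.
by move=> sb' _; apply: wsat_start.
Qed.

Lemma wsat_empty nb : wsat lab e u nb sb FEmpty <-> n = 0.
Proof.
split=> [H|n0 [i []]]; last by rewrite n0.
apply/eqP; rewrite -leqn0 leqNgt; apply/negP => n0; apply: H.
have T0 : wsat lab e u (set_pos nb 0 0) sb FTrue by apply: wsat_true.
by exists 0.
Qed.

End Word.

Lemma iso_word u g : iso (wgraph lab e u) g -> exists f : 'I_(size u) -> gV g,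
  [/\ bijective f, forall i, glab g (f i) = lab (tnth (in_tuple u) i) &
   forall i c j, gE g (f i) c (f j) = (val j == (val i).+1) && e (tnth (in_tuple u) i) c].
Proof. by move=> [f [? [? ?]]]; exists f. Qed.

Lemma is_output_empty g (f : 'I_(size (Nil L)) -> gV g) (X : 'I_#|I| -> {set gV g}) :
  bijective f -> is_output (T := nmso_of_mach) X (wgraph lab2 e2 [::]).
Proof.
move=> [f' fK f'K]; have no (x : gV g) : False by case: (f' x).
exists (fun p => f' (val p).1); split; last by split=> p; case: (no (val p).1).
by apply: inj_surj_bij => [p|i]; [case: (no (val p).1)|case: (no (f i))].
Qed.

Lemma nmso_of_machP g h : nmso_rel nmso_of_mach g h <->
  exists u z, [/\ W u, mach_rel u z, iso (wgraph lab e u) g & iso (wgraph lab2 e2 (out_enc z)) h].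
Proof.
split.
  move=> [X []]; rewrite sat_and => /andP[/FStringP[u Wu ug] H] h_out.
  have [f [f_bij f_lab f_edge]] := iso_word ug; exists u.
  move: H => /(satE f_bij f_lab f_edge)/wsat_or[H|H]; move/wsat_and: H => -[].
    move=> /wsat_empty n0 eps_true; exists [::].
    have ept : eps by move: eps_true; case: ifP => // _ /wsat_false.
    have E : out_enc [::] = [::] by rewrite /out_enc eps_halt.
    have u0 : u = [::] by case: (u) n0.
    subst u; rewrite E; split=> //.
    by apply: is_output_unique h_out; apply: is_output_empty f_bij.
  move=> ne /wsat_and[/(wsat_valid _ Wu)[v [v_valid v_ok]] acc].
  have n0 : 0 < size u.
    by rewrite lt0n; apply/eqP => u0; apply: ne; exact: ((wsat_empty f X _).2 u0).
  have [x0 _] : exists x0 : I, True.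
    by case: (v) v_valid.1 n0 => [|x v' _ _]; [move=> /= <-|exists x].
  have [z zacc] := (wsat_accept Wu _ n0 (v_ok x0)).1 acc.
  exists z; split=> //; first by case: (u) n0 v_valid zacc => // a u' _ ? ?; exists v, x0.
  exact: is_output_unique (is_output_run Wu f_bij f_lab f_edge n0 (v_ok x0) zacc) h_out.
move=> [u [z [Wu uz ug zh]]]; have [f [f_bij f_lab f_edge]] := iso_word ug.
have str mu : @sat _ _ g (nv0 _) mu FString by apply/FStringP; exists u.
case: (posnP (size u)) => [n0|n0].
  have [ept zE] : eps /\ out_enc z = [::] by case: (u) n0 uz.
  exists (fun _ => set0); split.
    rewrite sat_and str; apply/(satE f_bij f_lab f_edge)/wsat_or; left; apply/wsat_and.
    by split; [exact: ((wsat_empty f _ _).2 n0)|rewrite ept; apply: wsat_true].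
  apply: is_output_iso zh; rewrite zE.
  have u0 : u = [::] by case: (u) n0.
  by subst u; apply: is_output_empty f_bij.
have [v [x0 [v_valid zacc]]] : exists v x0, valid_word u v /\ macc M (size u) (nth x0 v) z.
  by case: (u) n0 uz.
have [f' fK f'K] := f_bij.
(* The parameters encode the word [v]: one set for each letter, transported to the nodes of [g]. *)
pose X (o : 'I_#|I|) := [set x | nth x0 v (f' x) == enum_val o].
have v_ok x1 : par_ok u v x1 (set_val f (pval X)).
  move=> i a iN; rewrite -[i]/(val (Ordinal iN)) (sb_par f) inE fK enum_rankK /=.
  by rewrite (set_nth_default x1) // v_valid.1.
exists X; split; last first.
  exact: is_output_iso (is_output_run Wu f_bij f_lab f_edge n0 (v_ok x0) zacc) zh.
rewrite sat_and str; apply/(satE f_bij f_lab f_edge)/wsat_or; right; apply/wsat_and; split.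
  by move=> /(wsat_empty f X) E; rewrite E in n0.
apply/wsat_and; split; first by apply/(wsat_valid _ Wu); exists v.
by apply/(wsat_accept Wu _ n0 (v_ok x0)); exists z.
Qed.

End MachToNmso.

(** * From tapes to nodes *)

Section Fold.
Variables (B C : finType) (M : mach (tsym B) C).

(* A tape of the form [oseq p ++ y] with [y] nonempty is folded onto the positions
   of [y]: [slot_left] and [slot_extra] are the left end marker and the letter of
   [p], both carried by the first position, and [slot_right] is the right end
   marker, carried by the last one.  A cell consists of [p] (only meaningful at the
   first position), a letter of [y], and flags for the first and last position. *)
Definition slot : finType := (bool * bool)%type.
Definition slot_left : slot := (false, false).
Definition slot_extra : slot := (false, true).
Definition slot_mid : slot := (true, false).
Definition slot_right : slot := (true, true).
Definition cell : finType := (option B * B * bool * bool)%type.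
Definition cell_sym (x : cell) : B := x.1.1.2.

(** The head of the folded machine moves only between middle slots of neighbouring positions; all
    other moves change the slot and stay. The result is [None] precisely when the original head
    would leave its tape. *)
Definition slot_move (s : slot) (x : cell) (m : move) : option (slot * move) :=
  let: (p, _, f, l) := x in
  match s, m with
  | _, MStay => Some (s, MStay)
  | (false, false), MLeft => None
  | (false, false), MRight => Some (if p then slot_extra else slot_mid, MStay)
  | (false, true), MLeft => Some (slot_left, MStay)
  | (false, true), MRight => Some (slot_mid, MStay)
  | (true, false), MLeft =>
      if f then Some (if p then slot_extra else slot_left, MStay) else Some (slot_mid, MLeft)
  | (true, false), MRight => if l then Some (slot_right, MStay) else Some (slot_mid, MRight)
  | (true, true), MLeft => Some (slot_mid, MStay)
  | (true, true), MRight => None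
  end.

Definition slot_sym (s : slot) (x : cell) : tsym B :=
  let: (p, b, _, _) := x in
  match s with
  | (false, false) => LEnd
  | (false, true) => if p is Some b0 then Sym b0 else LEnd
  | (true, false) => Sym b
  | (true, true) => REnd
  end.

Definition fold_mach : mach cell C :=
  @Mach _ C (mQ M * slot)%type (mstart M, slot_left) (fun q => mfin q.1)
  (fun q x => if mdelta q.1 (slot_sym q.2 x) is Some (q', o, m) then
     if slot_move q.2 x m is Some (s', m') then Some ((q', s'), o, m') else None
   else None).

Variables (p : option B) (v : seq cell) (x0 : cell).
Local Notation n := (size v).
Hypothesis n0 : 0 < n.
Hypothesis v_first : (nth x0 v 0).1.1.1 = p.
Hypothesis v_flags : forall i, i < n ->
  (nth x0 v i).1.2 = (i == 0) /\ (nth x0 v i).2 = (i.+1 == n).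
Let w := oseq p ++ map cell_sym v.

(** Tape position 0 is the left marker. The optional letter of [p] occupies position 1, so position
    [i] of [y] is shifted by one for the marker and by [size (oseq p)]. *)
Definition fold_rel (c : mQ M * nat) (c' : mQ fold_mach * nat) : Prop :=
  c'.1.1 = c.1 /\
  match c'.1.2 with
  | (false, false) => c'.2 = 0 /\ c.2 = 0
  | (false, true) => [/\ c'.2 = 0, c.2 = 1 & p]
  | (true, false) => c'.2 < n /\ c.2 = (size (oseq p) + c'.2).+1
  | (true, true) => c'.2 = n.-1 /\ c.2 = (size w).+1
  end.

Lemma fold_machE z : macc fold_mach n (nth x0 v) z <-> tacc M w z.
Proof.
apply: iff_sym; apply: (mhalt_bisim (Rl := fold_rel)) => //.
  by move=> c c' [<- _].
move=> [q j] [[q' s] i] [/= -> {q'}] H nf; rewrite /mstep /= (negbTE nf).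
have sw : size w = size (oseq p) + n by rewrite size_cat size_map.
have iN : i < n.
  by case: s H => -[] -[] //=; [move=> [-> _]; rewrite ltn_predL|move=> []|move=> [->]|move=>
    [->]].
have [fE lE] := v_flags iN; have pE : i = 0 -> (nth x0 v i).1.1.1 = p by move=> ->.
have symE : tape w j = slot_sym s (nth x0 v i).
  case xE: (nth x0 v i) fE lE pE => [[[p' b] f] l] /= fE lE pE.
  case: s H => -[] -[] /=.
  - by move=> [_ ->]; rewrite tapeS onth_default.
  - move=> [_ ->]; rewrite tapeS onth_cat ltnNge leq_addr /= addnC addnK onth_map.
    case E: (onth v i) (onthTE v i) => [x|]; last by rewrite iN.
    by rewrite -[x](onth_nth x0 _ _ _ E) xE.
  - by move=> [i0 -> ps]; rewrite (pE i0) tapeS /w; case: (p) ps.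
  - by move=> [_ ->].
rewrite symE; case: mdelta => [[[q' o] m]|] //.
case: (nth x0 v i) fE lE pE {symE} => [[[p' b] f] l] /= fE lE pE; subst f l.
case: s H => -[] -[] /=.
- move=> [iE ->]; case: m => /=.
  + split=> //; split=> //=; rewrite iE ltn_predL n0; split=> //.
    by rewrite sw -addnS prednK.
  + by [].
  + by rewrite ltnn.
- move=> [_ ->]; case: m => /=.
  + case: eqP => [i0|/eqP i0].
      rewrite (pE i0) i0; case Ep: p => [b0|] /=; split=> //; split=> //=; rewrite ?Ep //.
    case: i i0 iN {pE} => //= i _ iN; split=> //; split=> //=.
    by split; [apply: ltnW|rewrite addnS].
  + by [].
  + rewrite sw !ltnS; case: eqP => [iE|/eqP iE] /=.
      rewrite ltn_add2l iN; split=> //; split=> //=.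
      by rewrite sw -iE /= addnS.
    have i1N : i.+1 < n by rewrite ltn_neqAle iE.
    by rewrite i1N ltn_add2l iN; split=> //; split=> //=; split; rewrite ?addnS.
- move=> [i0 -> ps]; case: m => /=.
  + by [].
  + by [].
  + rewrite sw !ltnS; case Ep: p ps => [b0|] //= _; split=> //; split=> //=; rewrite ?Ep ?i0 //.
- move=> [i0 ->]; rewrite (pE i0); case: m => /=.
  + by [].
  + by split=> //; split.
  + by case Ep: p => [b0|] /=; split=> //; split=> //=; rewrite ?Ep ?i0.
Qed.
End Fold.

Lemma all2_onth S T (R : S -> T -> bool) s t : all2 R s t <->
  size s = size t /\ forall i a b, onth s i = Some a -> onth t i = Some b -> R a b.
Proof.
elim: s t => [|a s IH] [|b t] /=; [by split=> // _; split=> // -[]|by split=> // -[]|by split=>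
  // -[]|].
split=> [/andP[ab /IH[-> H]]|[[sz] H]].
  by split=> // -[|i] a' b' /=; [move=> [<-] [<-]|apply: H].
apply/andP; split; first exact: (H 0).
by apply/IH; split=> // i; apply: (H i.+1).
Qed.

Lemma onth_mkseq T (f : nat -> T) n i : i < n -> onth (mkseq f n) i = Some (f i).
Proof.
move=> iN; case E: (onth _ i) (onthTE (mkseq f n) i) => [x|]; last by rewrite size_mkseq iN.
by rewrite -(onth_nth (f i) _ _ _ E) nth_mkseq.
Qed.

Section FoldRel.
Variables (B C L : finType) (M : mach (tsym B) C) (L2 : Type) (inj : C -> L2).
Variables (haltL : option L2) (eps : bool).
Variables (P : option B -> bool) (R : L -> B -> bool).

(** [P] constrains the extra letter, read at the first position only. For [nd] there must be none;
    for [ed] it must be an image of the left marker. *)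
Definition cell_valid (f l : bool) (a : L) (x : cell B) : bool :=
  [&& x.1.2 == f, x.2 == l, f ==> P x.1.1.1 & R a (cell_sym x)].

Lemma mach_rel_fold u z : u != [::] ->
  mach_rel cell_valid (fold_mach M) inj haltL eps u z <->
  exists p y, [/\ P p, all2 R u y & tacc M (oseq p ++ y) z].
Proof.
move=> un0; have n0 : 0 < size u by rewrite lt0n size_eq0.
transitivity (exists v x0, valid_word cell_valid u v /\
    macc (fold_mach M) (size u) (nth x0 v) z); first by case: (u) un0.
split.
  move=> [v [x0 [[sv vP] acc]]].
  have vN i : i < size v -> exists2 a, onth u i = Some a & cell_valid (i == 0) (i.+1 == size u)
    a (nth x0 v i).
    move=> iN; case ua: (onth u i) (onthTE u i) => [a|]; last by rewrite -sv iN.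
    case vb: (onth v i) (onthTE v i) => [b|]; last by rewrite iN.
    by move=> _ _; exists a => //; rewrite (onth_nth x0 _ _ _ vb); apply: vP.
  have v0 : 0 < size v by rewrite sv.
  exists (nth x0 v 0).1.1.1, (map (@cell_sym B) v); split.
  - by have [a _ /and4P[]] := vN 0 v0.
  - apply/all2_onth; rewrite size_map sv; split=> // i a b ua; rewrite onth_map.
    case vb: (onth v i) => [x|] //= [<-].
    by have := vP i a x ua vb => /and4P[].
  apply/(fold_machE M v0 erefl) => [i iN|]; last by rewrite sv.
  by have [a _ /and4P[/eqP-> /eqP->]] := vN i iN; rewrite sv.
move=> [p [y [Pp /all2_onth[sy yP] acc]]].
case: y sy yP acc => [|b0 y'] sy yP acc; first by rewrite sy in n0.
set y := b0 :: y' in sy yP acc.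
pose v := mkseq (fun i => (p, nth b0 y i, i == 0, i.+1 == size u)) (size u).
have sv : size v = size u by rewrite size_mkseq.
exists v, (p, b0, false, false); split; first split=> //.
  move=> i a b ua; have iN : i < size u by rewrite -onthTE ua.
  rewrite onth_mkseq // => -[<-]; rewrite /cell_valid /= !eqxx Pp implybT /=.
  apply: (yP i) => //; case E: (onth y i) (onthTE y i) => [c|]; last by rewrite -sy iN.
  by rewrite (onth_nth b0 _ _ _ E).
rewrite -sv; apply/(fold_machE M (p := p)) => [|||].
- by rewrite sv.
- by rewrite nth_mkseq.
- by move=> i iN; rewrite nth_mkseq -?sv.
have -> : map (@cell_sym B) v = y by rewrite /v /mkseq -map_comp sy; exact: (mkseq_nth b0 y).
exact: acc.
Qed.
End FoldRel.

(** * Recognizing string graphs *)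

(** The enumeration is the orbit of [x0] under the successor function, which fixes nodes without
    successor; the closure hypothesis says that the orbit contains all nodes. *)
Lemma path_enum (V : finType) (E : rel V) (x0 : V) :
  (forall x y y', E x y -> E x y' -> y = y') ->
  (forall x x' y, E x y -> E x' y -> x = x') ->
  (forall x, ~~ E x x0) ->
  (forall Z : {set V}, x0 \in Z -> (forall x y, x \in Z -> E x y -> y \in Z) ->
     forall x, x \in Z) ->
  exists s : seq V, [/\ uniq s, forall x, x \in s &
    forall x y, E x y = (index y s == (index x s).+1)].
Proof.
move=> E_fun E_inj root reach.
pose f v := odflt v [pick y | E v y].
have fE x y : E x y -> f x = y.
  by rewrite /f => xy; case: pickP => [y' /(E_fun _ _ _ xy)|/(_ y)]; rewrite ?xy.
pose s := orbit f x0; have s_uniq : uniq s by apply: orbit_uniq.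
have s_all x : x \in s.
  have := reach [set y | y \in s]; rewrite !inE => H.
  suff : x \in [set y | y \in s] by rewrite inE.
  apply: H => [|y y'].
    by rewrite -fconnect_orbit connect0.
  rewrite !inE -!fconnect_orbit => x0y /fE <-.
  exact: connect_trans x0y (fconnect1 _ _).
have s_nth i : i < size s -> nth x0 s i = iter i f x0.
  by rewrite size_orbit => iN; rewrite nth_traject.
have idx x : index x s < size s by rewrite index_mem.
have itx x : iter (index x s) f x0 = x by rewrite -s_nth // nth_index.
have succ x y : index y s = (index x s).+1 -> E x y.
  move=> H; have yE : y = f x by rewrite -(itx y) H iterS itx.
  have fx : f x != x.
    apply/negP => /eqP fx; move: H; rewrite yE fx => /eqP.
    by rewrite -[X in X == _]addn0 -addn1 eqn_add2l.
  move: fx; rewrite yE /f; case: pickP => [z //|_]; by rewrite eqxx.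
exists s; split=> // x y; apply/idP/eqP => [xy|/succ//].
have yE := fE _ _ xy.
case: (ltnP (index x s).+1 (size s)) => [iN|].
  by rewrite -yE -[in LHS](itx x) -iterS -s_nth // index_uniq.
(* An edge from the last node would close a cycle. It cannot enter the root, and entering a later
   node would, by injectivity, give that node two different predecessors. *)
move=> iN; have ixN : (index x s).+1 = size s by apply/eqP; rewrite eqn_leq iN idx.
case j: (index y s) => [|k].
  by move: (root x); rewrite (_ : x0 = y) ?xy // -(itx y) j.
have kN : k < size s by rewrite (ltn_trans _ (idx y)) // j.
have E2 : E (nth x0 s k) y by apply: succ; rewrite j index_uniq.
have xk := E_inj _ _ _ xy E2.
by have := idx y; rewrite j -ixN ltnS xk index_uniq // ltnn.
Qed.

Section PathFormula.
Variables (S1 : eqType) (G1 : finType).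
Local Notation form := (mso S1 G1).

Definition FEqv x y : form := FEq _ _ x y.
Definition FRoot : form :=
  FEx1 0 (FAnd (FNot (FEx1 1 (FAdj S1 G1 1 0)))
    (FAll2 0 (FImp (FAnd (FIn _ _ 0 0)
       (FAll1 1 (FAll1 2 (FImp (FAnd (FIn _ _ 1 0) (FAdj S1 G1 1 2)) (FIn _ _ 2 0)))))
     (FAll1 1 (FIn _ _ 1 0))))).
Definition FFun : form := FAll1 0 (FAll1 1 (FAll1 2
  (FImp (FAnd (FAdj S1 G1 0 1) (FAdj S1 G1 0 2)) (FEqv 1 2)))).
Definition FInj : form := FAll1 0 (FAll1 1 (FAll1 2
  (FImp (FAnd (FAdj S1 G1 0 2) (FAdj S1 G1 1 2)) (FEqv 0 1)))).
(** The root makes the path nonempty; the empty [nd] graph is added as a separate case in [FNd]. *)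
Definition FPath : form := FAnd FRoot (FAnd FFun FInj).

Definition adj (g : graph S1 G1) : rel (gV g) := fun x y => [exists c, gE g x c y].

Lemma sat_adj (g : graph S1 G1) nu (mu : nat -> {set gV g}) x y a b :
  nu x = Some a -> nu y = Some b -> sat nu mu (FAdj S1 G1 x y) = adj a b.
Proof.
move=> xE yE; rewrite sat_some; apply: eq_existsb => c /=.
by rewrite xE yE.
Qed.

Lemma sat_path (g : graph S1 G1) nu (mu : nat -> {set gV g}) : sat nu mu FPath ->
  exists s : seq (gV g), [/\ s != [::], uniq s, forall x, x \in s &
    forall x y, adj x y = (index y s == (index x s).+1)].
Proof.
rewrite /FPath !sat_and /FFun /FInj /FRoot sat_ex1 !sat_all1 => /and3P[/existsP[x0] + /forallP
  Hf /forallP Hi].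
rewrite sat_and sat_all2 => /andP[/existsPn Hr /forallP Hz].
have [||||s [s_uniq s_all sE]] := @path_enum (gV g) (@adj g) x0.
- move=> x y y' xy xy'; have := Hf x; rewrite sat_all1 => /forallP/(_ y); rewrite sat_all1 =>
  /forallP/(_ y').
  by rewrite sat_imp sat_and (@sat_adj g _ _ 0 1 x y) // (@sat_adj g _ _ 0 2 x y') // xy xy' /=
    => /eqP.
- move=> x x' y xy xy'; have := Hi x; rewrite sat_all1 => /forallP/(_ x'); rewrite sat_all1 =>
  /forallP/(_ y).
  by rewrite sat_imp sat_and (@sat_adj g _ _ 0 2 x y) // (@sat_adj g _ _ 1 2 x' y) // xy xy' /=
    => /eqP.
- move=> x; have : ~~ sat (upd (upd nu 0 (Some x0)) 1 (Some x)) mu (FAdj S1 G1 1 0) := Hr x.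
  by rewrite (@sat_adj g _ _ 1 0 x x0).
- move=> Z x0Z Zcl x; have := Hz Z; rewrite sat_imp => /implyP H.
  suff /H : sat (upd nu 0 (Some x0)) (upd mu 0 Z) (FAnd (FIn _ _ 0 0)
       (FAll1 1 (FAll1 2 (FImp (FAnd (FIn _ _ 1 0) (FAdj S1 G1 1 2)) (FIn _ _ 2 0))))).
    by rewrite sat_all1 => /forallP/(_ x).
  rewrite sat_and sat_all1; apply/andP; split; first exact: x0Z.
  apply/forallP => y; rewrite sat_all1; apply/forallP => y'.
  rewrite sat_imp sat_and (@sat_adj g _ _ 1 2 y y') //; apply/implyP => /andP[yZ yy'].
  exact: Zcl yZ yy'.
exists s; split=> //; by case: (s) (s_all x0).
Qed.

Definition enumerates (g : graph S1 G1) (s : seq (gV g)) : Prop :=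
  [/\ uniq s, forall x, x \in s & forall x y, adj x y = (index y s == (index x s).+1)].

Lemma sat_pathP (g : graph S1 G1) nu (mu : nat -> {set gV g}) : sat nu mu FPath <->
  exists2 s : seq (gV g), s != [::] & enumerates s.
Proof.
split=> [/sat_path[s [? ? ? ?]]|[s s0 [s_uniq s_all sE]]]; first by exists s.
have [x0 [s' sE0]] : exists x0 s', s = x0 :: s' by case: (s) s0 => // x0 s' _; exists x0, s'.
have i_inj x y : index x s = index y s -> x = y.
  by move=> H; rewrite -(nth_index x0 (s_all x)) H nth_index.
rewrite /FPath !sat_and /FFun /FInj /FRoot sat_ex1 !sat_all1; apply/and3P; split.
- apply/existsP; exists x0; rewrite sat_and sat_all2; apply/andP; split.
    apply/existsPn => x.
    apply: (_ : ~~ sat (upd (upd nu 0 (Some x0)) 1 (Some x)) mu (FAdj S1 G1 1 0)).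
    by rewrite (@sat_adj g _ _ 1 0 x x0) // sE sE0 /= eqxx.
  apply/forallP => Z; rewrite sat_imp sat_and !sat_all1; apply/implyP => /andP[x0Z Zcl].
  apply/forallP => x; apply: (_ : x \in Z).
  move E: (index x s) => i; elim: i x E => [|i IH] x E.
    suff -> : x = x0 by [].
    by apply: i_inj; rewrite E sE0 /= eqxx.
  have iN : i < size s by rewrite ltnW // -E index_mem.
  have yi : index (nth x0 s i) s = i by rewrite index_uniq.
  have /forallP/(_ (nth x0 s i)) := Zcl; rewrite sat_all1 => /forallP/(_ x).
  rewrite sat_imp sat_and (@sat_adj g _ _ 1 2 (nth x0 s i) x) // sE yi E eqxx andbT => /implyP;
    apply.
  exact: IH.
- apply/forallP => x; rewrite sat_all1; apply/forallP => y; rewrite sat_all1; apply/forallP => y'.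
  rewrite sat_imp sat_and (@sat_adj g _ _ 0 1 x y) // (@sat_adj g _ _ 0 2 x y') // !sE.
  by apply/implyP => /andP[/eqP E /eqP E']; apply/eqP/i_inj; rewrite E E'.
apply/forallP => x; rewrite sat_all1; apply/forallP => x'; rewrite sat_all1; apply/forallP => y.
rewrite sat_imp sat_and (@sat_adj g _ _ 0 2 x y) // (@sat_adj g _ _ 1 2 x' y) // !sE.
by apply/implyP => /andP[/eqP E /eqP]; rewrite E => -[E']; apply/eqP/i_inj.
Qed.

Section Enumerate.
Variables (L : Type) (lab : L -> S1) (e : L -> G1 -> bool) (g : graph S1 G1).

Lemma enumerates_iso (s : seq (gV g)) (lt : gV g -> L) : enumerates s ->
  (forall x, glab g x = lab (lt x)) ->
  (forall x c y, gE g x c y = adj x y && e (lt x) c) ->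
  iso (wgraph lab e (map lt s)) g.
Proof.
move=> [s_uniq s_all sE] lt_lab lt_edge.
pose f (i : 'I_(size (map lt s))) := tnth (in_tuple s) (cast_ord (size_map lt s) i).
have iN (i : 'I_(size (map lt s))) : i < size s by apply: leq_trans (ltn_ord i) _; rewrite
  size_map.
have fi i : index (f i) s = i by rewrite {1}/f (tnth_nth (f i)) /= index_uniq.
have ltf i : lt (f i) = tnth (in_tuple (map lt s)) i.
  by rewrite [RHS](tnth_nth (lt (f i))) /= (nth_map (f i)) // {1}/f (tnth_nth (f i)).
exists f; split; [|split].
- apply: inj_surj_bij => [i j /(congr1 (fun x => index x s))|x].
    by rewrite !fi => /val_inj.
  have xN : index x s < size (map lt s) by rewrite size_map index_mem.
  exists (Ordinal xN); rewrite /f (tnth_nth x) /=.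
  by rewrite nth_index.
- by move=> i; rewrite lt_lab ltf.
by move=> i c j; rewrite lt_edge sE !fi ltf.
Qed.

Lemma iso_enumerates u : iso (wgraph lab e u) g ->
  (forall i a, onth u i = Some a -> i.+1 < size u -> exists c, e a c) ->
  exists2 s : seq (gV g), size s = size u & enumerates s.
Proof.
move=> [f [f_bij [f_lab f_edge]]] u_edge; have f_inj := bij_inj f_bij.
have [f' fK f'K] := f_bij.
have fi (i : 'I_(size u)) : index (f i) [seq f j | j <- enum 'I_(size u)] = i.
  by rewrite (index_map f_inj) index_enum_ord.
exists [seq f i | i <- enum 'I_(size u)]; first by rewrite size_map size_enum_ord.
split; [by rewrite map_inj_uniq ?enum_uniq|by move=> x; rewrite -[x]f'K map_f ?mem_enum|].
move=> x y; rewrite -[x]f'K -[y]f'K !fi; apply/existsP/eqP => [[c]|E].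
  by rewrite f_edge => /andP[/eqP].
have [|c ec] := u_edge _ _ (tnth_word (f' x)); first by rewrite -E ltn_ord.
by exists c; rewrite f_edge /= E eqxx.
Qed.

End Enumerate.
End PathFormula.

Section Nd.
Variable A : finType.
Definition nd_edge (a : A) (c : unit) : bool := true.
Definition FNd : mso A unit := FOr (FEmpty A unit) (FPath A unit).

Lemma nd_wgraph (w : seq A) : iso (nd w) (wgraph id nd_edge w).
Proof. by exists id; split; [exists id|split=> // i c j; rewrite /= andbT]. Qed.

Lemma FNdP (g : graph A unit) mu : @sat _ _ g (nv0 _) mu FNd <->
  exists2 u, True & iso (wgraph id nd_edge u) g.
Proof.
have iso_s (s : seq (gV g)) : enumerates s -> exists2 u, True & iso (wgraph id nd_edge u) g.
  move=> s_en; exists (map (glab g) s) => //; apply: enumerates_iso => // x [] y.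
  rewrite andbT; apply/idP/existsP => [xy|[[] //]]; by exists tt.
split.
  move=> /orP[/existsPn empty|/sat_pathP[s _ /iso_s //]].
  apply: (iso_s [::]); have no (x : gV g) : False.
    exact: (negP (empty x) (sat_true (upd (nv0 _) 0 (Some x)) mu)).
  by split=> // x; case: (no x).
move=> [u _ ug]; apply/orP; have [//|s su s_en] := iso_enumerates ug.
  by move=> i a _ _; exists tt.
case: s s_en {su} => [[_ no _]|x s s_en]; last by right; apply/sat_pathP; exists (x :: s).
by left; apply/existsPn => x; have := no x.
Qed.
End Nd.

Section Ed.
Variable A : finType.
(** The letter of a node is the label of its outgoing edge, and [None] at the last node. *)
Definition ed_enc (w : seq A) : seq (option A) := rcons (map Some w) None.
Definition ed_edge (a : option A) (c : A) : bool := a == Some c.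
Definition ed_lab (a : option A) : unit := tt.
(** The path formula sees only whether some edge joins two nodes; this excludes parallel edges with
    different labels. *)
Definition FEdLabel : mso unit A := FAll1 0 (FAll1 1
  (FEvery (fun p : A * A => p.1 != p.2)
     (fun p => FNot (FAnd (FEdge unit p.1 0 1) (FEdge unit p.2 0 1))))).
Definition FEd : mso unit A := FAnd (FPath unit A) FEdLabel.

Lemma size_ed_enc w : size (ed_enc w) = (size w).+1.
Proof. by rewrite size_rcons size_map. Qed.

Lemma onth_ed_enc w i : onth (ed_enc w) i =
  if i < size w then Some (onth w i) else if i == size w then Some None else None.
Proof.
rewrite /ed_enc -cats1 onth_cat size_map onth_map; case: ltngtP => iw.
- by case E: (onth w i) (onthTE w i) => [a|] //=; rewrite iw.
- by case: (i - size w) (subn_gt0 (size w) i) => [|k] /=; rewrite ?iw ?onth0n.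
- by rewrite iw subnn.
Qed.

Lemma ed_enc_edge w i a : onth (ed_enc w) i = Some a -> i.+1 < size (ed_enc w) ->
  exists c, ed_edge a c.
Proof.
rewrite onth_ed_enc size_ed_enc ltnS => + iw; rewrite iw => -[<-].
by case E: (onth w i) (onthTE w i) => [c|]; [exists c; rewrite /ed_edge eqxx|rewrite iw].
Qed.

Lemma ed_wgraph (w : seq A) : iso (ed w) (wgraph ed_lab ed_edge (ed_enc w)).
Proof.
pose f (i : 'I_(size w).+1) : 'I_(size (ed_enc w)) := cast_ord (esym (size_ed_enc w)) i.
exists f; split; first by exists (cast_ord (size_ed_enc w)) => i; apply: val_inj.
split=> // i c j /=; congr (_ && _); rewrite /ed_edge.
have : onth (ed_enc w) (f i) = Some (tnth (in_tuple (ed_enc w)) (f i)) := tnth_word (f i).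
rewrite onth_ed_enc /= -onthE; case: ltnP => iw; first by move=> [<-].
by rewrite eqn_leq -ltnS ltn_ord iw /= => -[<-]; rewrite onth_default.
Qed.

Lemma FEdP (g : graph unit A) mu : @sat _ _ g (nv0 _) mu FEd <->
  exists2 u, (exists w, u = ed_enc w) & iso (wgraph ed_lab ed_edge u) g.
Proof.
have labE : sat (nv0 _) mu FEdLabel <->
    forall x y c c', gE g x c y -> gE g x c' y -> c = c'.
  rewrite sat_all1; split=> [/forallP H x y c c' xy xy'|H].
    have := H x; rewrite sat_all1 => /forallP/(_ y); rewrite sat_every => /forallP/(_ (c, c')).
    by case: eqP => //= _; rewrite xy xy'.
  apply/forallP => x; rewrite sat_all1; apply/forallP => y; rewrite sat_every.
  apply/forallP => -[c c']; apply/implyP => cc'.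
  apply: (_ : ~~ sat (upd (upd (nv0 _) 0 (Some x)) 1 (Some y)) mu
    (FAnd (FEdge unit c 0 1) (FEdge unit c' 0 1))).
  rewrite sat_and; apply/negP => /andP[xy xy'].
  by move: cc'; rewrite /= (H x y c c' xy xy') eqxx.
rewrite /FEd sat_and; split.
  move=> /andP[/sat_pathP[s s0 s_en] /labE lab1]; have [s_uniq s_all sE] := s_en.
  (* Reads the letter of a node off its outgoing edge. Both the target of that edge and its label
     are unique, so the choice is forced. *)
  pose lt x : option A := [pick c | [exists y, gE g x c y]].
  exists (map lt s); last first.
    apply: (enumerates_iso s_en) => [x|x c y]; first by case: (glab g x).
    apply/idP/andP => [xy|[/existsP[c' xy] /eqP]].
      have axy : adj x y by apply/existsP; exists c.
      split=> //; rewrite /ed_edge /lt; case: pickP => [c' /existsP[y' xy']|none].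
        have ay' : adj x y' by apply/existsP; exists c'.
        have yy' : y = y'.
          move: axy ay'; rewrite !sE => /eqP E /eqP E'.
          by rewrite -(nth_index x (s_all y)) E -E' nth_index.
        by rewrite -yy' in xy'; rewrite (lab1 _ _ _ _ xy xy').
      by move: (none c) => /existsP[]; exists y.
    rewrite /lt; case: pickP => // c2 /existsP[y' xy'] [<-].
    have axy : adj x y by apply/existsP; exists c'.
    have ay' : adj x y' by apply/existsP; exists c2.
    suff -> : y = y' by [].
    move: axy ay'; rewrite !sE => /eqP E /eqP E'.
    by rewrite -(nth_index x (s_all y)) E -E' nth_index.
  case/lastP: s s0 s_uniq s_all sE {s_en} => // s x _ s_uniq s_all sE.
  exists (pmap lt s); rewrite map_rcons /ed_enc.
  have -> : lt x = None.
    rewrite /lt; case: pickP => // c /existsP[y xy].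
    have : adj x y by apply/existsP; exists c.
    have xi : index x (rcons s x) = size s.
      by move: s_uniq; rewrite rcons_uniq -cats1 index_cat => /andP[/negbTE-> _] /=; rewrite
        eqxx addn0.
    rewrite sE xi => /eqP E; have := s_all y.
    by rewrite -index_mem E size_rcons ltnn.
  congr rcons; rewrite pmapS_filter; congr map; apply/esym/all_filterP/allP => y ys.
  have yi : index y (rcons s x) < size s by rewrite -cats1 index_cat ys index_mem.
  have : adj y (nth x (rcons s x) (index y (rcons s x)).+1).
    by rewrite sE index_uniq // size_rcons ltnS.
  move=> /existsP[c yc]; rewrite /lt; case: pickP => // none.
  by move: (none c) => /existsP[]; eexists; exact: yc.
move=> [u [w ->] ug]; apply/andP; split.
  have [|s ss s_en] := iso_enumerates ug; first exact: ed_enc_edge.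
  by apply/sat_pathP; exists s => //; rewrite -size_eq0 ss size_ed_enc.
apply/labE => x y c c'; have [f [[f' _ f'K] [_ f_edge]]] := ug.
rewrite -[x]f'K -[y]f'K !f_edge /= /ed_edge => /andP[_ /eqP E] /andP[_ /eqP].
by rewrite E => -[].
Qed.
End Ed.

(** * The two characterizations *)

Section NdCompose.
Variables (A C : finType) (m : strans A C).

Lemma FLab_nd (u : seq A) nb sb a x i : at1 nb x i -> i < size u ->
  wsat id (@nd_edge A) u nb sb (FLab unit a x) <-> onth u i = Some a.
Proof.
move=> Hx iN; split=> [[p [b [E + <-]]]|E]; first by rewrite Hx => /eqP <-.
by exists i, a; rewrite Hx.
Qed.

Lemma NMSO_nd_of_comp : fcomp REL DGSM_eps m -> NMSO_nd m.
Proof.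
move=> [B [m1 [m2 [[R m1E] [[[G [G_wf [G_det m2E]]] G_eps] mE]]]]].
pose M := mach_of_gsm G.
have ME y z : m2 y z <-> tacc M y z by rewrite m2E; apply: mach_of_gsmE.
(* The only relabelling of the empty string is the empty string, and by the condition on [m2] its
   image can only be empty; one bit records whether that pair is present. *)
pose eps := `[< m2 [::] [::] >].
exists (nmso_of_mach (FNd A) (fun a x => FLab unit a x)
  (cell_valid (fun p => p == None) R) (fold_mach M) id (@nd_edge C) id None eps) => g h.
have relE w z : mach_rel (cell_valid (fun p => p == None) R) (fold_mach M) id None eps w z <-> m
  w z.
  rewrite mE; case: (eqVneq w [::]) => [->|w0] /=.
    rewrite /out_enc cats0 map_id; split=> [[/asboolP e ->]|[y [/m1E]]].
      by exists [::]; split=> //; apply/m1E.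
    by case: y => // _ /[dup] /G_eps-> e; split=> //; apply/asboolP.
  rewrite mach_rel_fold //; split=> [[p [y [/eqP-> Ry acc]]]|[y [/m1E Ry /ME acc]]].
    by exists y; split; [apply/m1E|apply/ME].
  by exists None, y.
rewrite (nmso_of_machP (lab := id) (e := @nd_edge A) (W := fun _ => True)) //; first last.
- by move=> u _ nb sb a x i _; apply: FLab_nd.
- by move=> u _ i a _ _; exists tt.
- by move=> g' mu; rewrite FNdP.
split.
  move=> [w [z [_ /relE wz wg]]]; rewrite /out_enc cats0 map_id => zh.
  exists w, z; split=> //; split.
    exact: iso_trans (iso_sym wg) (iso_sym (nd_wgraph w)).
  exact: iso_trans (iso_sym zh) (iso_sym (nd_wgraph z)).
move=> [w [z [wz [gw hz]]]]; exists w, z; split=> //; first by apply/relE.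
  exact: iso_trans (iso_sym (nd_wgraph w)) (iso_sym gw).
rewrite /out_enc cats0 map_id; exact: iso_trans (iso_sym (nd_wgraph z)) (iso_sym hz).
Qed.

End NdCompose.

Section EdCompose.
Variables (A C : finType) (m : strans A C).

Definition FEdOut (a : A) x : mso unit A := FEx1 3 (FEdge unit a x 3).
Definition FEdLet (a : option A) x : mso unit A :=
  if a is Some c then FEdOut c x else FNot (FSome predT (fun c => FEdOut c x)).

Lemma wsat_ed_out w nb sb a x i : x != 3 -> at1 nb x i -> i < size (ed_enc w) ->
  wsat (@ed_lab A) (@ed_edge A) (ed_enc w) nb sb (FEdOut a x) <->
  onth (ed_enc w) i = Some (Some a).
Proof.
move=> x3 Hx iN; split.
  move=> [j [jN [p [b [E _ /andP[+ /eqP bE] _]]]]].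
  by rewrite (at1_skip j x3 Hx) => /eqP <-; rewrite E bE.
move=> E; have iw : i.+1 < size (ed_enc w).
  move: E; rewrite onth_ed_enc size_ed_enc ltnS; case: ltnP => // _.
  by case: eqP.
exists i.+1; split=> //; exists i, (Some a).
by rewrite (at1_skip _ x3 Hx) (at1_set nb 3) /ed_edge !eqxx.
Qed.

Lemma wsat_ed_let w nb sb a x i : x != 3 -> at1 nb x i -> i < size (ed_enc w) ->
  wsat (@ed_lab A) (@ed_edge A) (ed_enc w) nb sb (FEdLet a x) <-> onth (ed_enc w) i = Some a.
Proof.
move=> x3 Hx iN; case: a => [a|]; first exact: wsat_ed_out.
rewrite -[wsat _ _ _ _ _ _]/(~ wsat _ _ _ nb sb (FSome predT (fun c => FEdOut c x))) wsat_some.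
split=> [H|E [c _ /(wsat_ed_out _ _ x3 Hx iN)]]; last by rewrite E.
case E: (onth _ i) (onthTE (ed_enc w) i) => [[c|]|] //; last by rewrite iN.
by case: H; exists c => //; apply/(wsat_ed_out _ _ x3 Hx iN).
Qed.

(** The last node of the [ed] graph corresponds to the right marker, so the nodes account for all of
    [mark w] but the left marker. *)
Definition enc_sym (a : option A) : tsym A := if a is Some c then Sym c else REnd.

Lemma mark_enc (w : seq A) : mark w = LEnd :: map enc_sym (ed_enc w).
Proof. by rewrite /mark /ed_enc map_rcons -map_comp. Qed.

Lemma all2_mapl S T U (f : S -> T) (R : T -> U -> bool) s t :
  all2 R (map f s) t = all2 (fun x => R (f x)) s t.
Proof. by elim: s t => [|x s IH] [|y t] //=; rewrite IH. Qed.

Lemma NMSO_ed_of_comp : fcomp MREL DGSM m -> NMSO_ed m.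
Proof.
move=> [B [m1 [m2 [[R m1E] [[G [G_wf [G_det m2E]]] mE]]]]].
pose M := mach_of_gsm G.
have ME y z : m2 y z <-> tacc M y z by rewrite m2E; apply: mach_of_gsmE.
(* The relabelled left marker has no node of its own and becomes the extra letter of the folded
   tape. *)
pose P (p : option B) := if p is Some b then R LEnd b else false.
pose R' (a : option A) (b : B) := R (enc_sym a) b.
exists (nmso_of_mach (FEd A) FEdLet (cell_valid P R') (fold_mach M) (@ed_lab C) (@ed_edge C)
  some (Some None) false) => g h.
have relE w z : mach_rel (cell_valid P R') (fold_mach M) some (Some None) false (ed_enc w) z <->
  m w z.
  rewrite mE mach_rel_fold -?size_eq0 ?size_ed_enc //; split.
    move=> [[b|] [y [//= Pb Ry acc]]]; exists (b :: y); split; last exact/ME.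
    by apply/m1E; rewrite /relab mark_enc /= Pb all2_mapl.
  move=> [y [/m1E + /ME acc]]; rewrite /relab mark_enc.
  case: y acc => // b y acc /= /andP[Pb]; rewrite all2_mapl => Ry.
  by exists (Some b), y.
have encE (z : seq C) : out_enc some (Some None) z = ed_enc z by rewrite /out_enc cats1.
rewrite (nmso_of_machP (lab := @ed_lab A) (e := @ed_edge A) (W := fun u => exists w, u = ed_enc
  w)) //;
  first last.
- by move=> u [w ->] nb sb a x i x3 Hx iN; apply: wsat_ed_let.
- by move=> u [w ->]; apply: ed_enc_edge.
- exact: FEdP.
split.
  move=> [u [z [[w ->] /relE wz wg]]]; rewrite encE => zh.
  exists w, z; split=> //; split.
    exact: iso_trans (iso_sym wg) (iso_sym (ed_wgraph w)).
  exact: iso_trans (iso_sym zh) (iso_sym (ed_wgraph z)).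
move=> [w [z [wz [gw hz]]]]; exists (ed_enc w), z; split; [by exists w|exact/relE| |].
  exact: iso_trans (iso_sym (ed_wgraph w)) (iso_sym gw).
rewrite encE; exact: iso_trans (iso_sym (ed_wgraph z)) (iso_sym hz).
Qed.

End EdCompose.

(** * From graph transductions to compositions *)

(** An isomorphism of paths keeps the unique node without predecessor and commutes with successor,
    so it preserves positions. Strings can then be recovered from their graphs. *)
Lemma wgraph_iso_val (L : Type) (S : eqType) (G : Type) (lab : L -> S) (e : L -> G -> bool) (u
  u' : seq L) :
  (forall i a, onth u i = Some a -> i.+1 < size u -> exists c, e a c) ->
  (forall i a, onth u' i = Some a -> i.+1 < size u' -> exists c, e a c) ->
  iso (wgraph lab e u) (wgraph lab e u') -> size u = size u' /\
  exists f : 'I_(size u) -> 'I_(size u'), [/\ forall i, f i = i :> nat,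
    forall i, lab (tnth (in_tuple u') (f i)) = lab (tnth (in_tuple u) i) &
    forall (i : 'I_(size u)) c, i.+1 < size u -> e (tnth (in_tuple u') (f i)) c = e (tnth
      (in_tuple u) i) c].
Proof.
move=> u_edge u'_edge [f [f_bij [/= f_lab f_edge]]].
have sz : size u = size u' by rewrite -[LHS]card_ord -[RHS]card_ord; apply: bij_eq_card f_bij.
have f_succ (i j : 'I_(size u)) : val j = (val i).+1 -> val (f j) = (val (f i)).+1.
  move=> ij; have [|c ec] := u_edge _ _ (tnth_word i); first by rewrite -ij ltn_ord.
  by have := f_edge i c j; rewrite ij eqxx ec => /andP[/eqP].
have f0 (i : 'I_(size u)) : val i = 0 -> val (f i) = 0.
  move=> i0; case E: (val (f i)) => [//|k].
  have kN : k < size u' by apply: ltn_trans (ltn_ord (f i)); rewrite -[X in _ < X]/(val (f i)) E.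
  have [f' fK f'K] := f_bij.
  have [|c ec] := u'_edge _ _ (tnth_word (Ordinal kN)); first by rewrite /= -E ltn_ord.
  have := f_edge (f' (Ordinal kN)) c i; rewrite f'K /= ec -[nat_of_ord (f i)]/(val (f i)) E eqxx
    /=.
  by move/esym/andP=> [/eqP iE _]; rewrite i0 in iE.
have fv i : val (f i) = i.
  case: i => i; elim: i => [|i IH] iN; first exact: f0.
  have iN' := ltnW iN.
  by rewrite (f_succ (Ordinal iN')) // IH.
split=> //; exists f; split=> // i c iN.
have := f_edge i c (Ordinal iN); rewrite /= -[nat_of_ord (f _)]/(val (f _)) fv.
by rewrite -[nat_of_ord (f _)]/(val (f _)) fv /= eqxx.
Qed.

Lemma nd_wgraph_inj (A : finType) (w w' : seq A) :
  iso (wgraph id (@nd_edge A) w) (wgraph id (@nd_edge A) w') -> w = w'.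
Proof.
move=> /wgraph_iso_val[||sz [f [fv f_lab _]]]; [by move=> *; exists tt|by move=> *; exists tt|].
apply: eq_from_onth => i; case: (ltnP i (size w)) => iw; last first.
  by rewrite !onth_default // -sz.
have := tnth_word (f (Ordinal iw)); have := tnth_word (Ordinal iw).
by rewrite fv /= => -> ->; rewrite -(f_lab (Ordinal iw)).
Qed.

Section NdDecompose.
Variables (A C : finType).

Lemma comp_of_NMSO_nd (m : strans A C) : NMSO_nd m -> fcomp REL DGSM_eps m.
Proof.
move=> [T TE].
have TW u h : nmso_rel T (wgraph id (@nd_edge A) u) h ->
    exists2 z, m u z & iso h (wgraph id (@nd_edge C) z).
  move=> /TE[w [z [wz [uw hz]]]]; exists z; last exact: iso_trans hz (nd_wgraph z).
  by rewrite (nd_wgraph_inj (iso_trans uw (nd_wgraph w))).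
have mT u z : m u z <-> nmso_rel T (wgraph id (@nd_edge A) u) (wgraph id (@nd_edge C) z).
  split=> [uz|/TW[z' uz' /nd_wgraph_inj->//]].
  by apply/TE; exists u, z; split=> //; split; apply: iso_sym (nd_wgraph _).
pose Em (c : nC T) (a : C) : wpred A := fun u nb sb =>
  wsat id (@nd_edge A) u (sub_val (fun x => if x == 0 then Some 0 else None) nb) sb (nnode T c a).
have Em_recog c a : recog (Em c a) by exact: recog_subst _ (recog_wsat _ _ _).
have [||u X z f f_out p a|u h _ /TW[z _ hz]|I [letter [M ME]]] :=
  @mach_of_nmso A A unit id (@nd_edge A) C unit C C id (@nd_edge C) T id _ _ Em Em_recog _ (fun
    _ => True).
- by [].
- by move=> z i a _ _; exists tt.
- rewrite /Em (_ : sub_val _ _ = pos1 (val p).1); last first.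
    by apply/funext => q; apply/funext => -[|x].
  have [f_bij f_lab f_edge] := f_out.
  rewrite tnth_word -(@pos_val_nv1 _ _ _ (wgraph id (@nd_edge A) u) u id); last by exists id.
  rewrite -sat_word; split=> [H|[E]]; last by have := f_lab p; rewrite /= E.
  by rewrite (out_node_label (valP p) H (f_lab p)).
- by exists z.
pose R (a : A) (x : I) := letter x == a.
have RE w y : all2 R w y <-> map letter y = w.
  elim: w y => [|a w IH] [|x y] /=; [by split|by split|by split|].
  by split=> [/andP[/eqP-> /IH->]//|[<- /IH->]]; rewrite /R eqxx.
have mE : same_trans m (Defs.comp (relab R) (gsm_rel (gsm_of_mach M))).
  move=> w z; rewrite mT -ME //; split=> [[v vw acc]|[v [/RE vw /gsm_of_machE acc]]]; exists v
    => //.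
  by split; [apply/RE|apply/gsm_of_machE].
exists I, (relab R), (gsm_rel (gsm_of_mach M)); split; [by exists R|split=> //; split].
  exists (gsm_of_mach M); split; [exact: gsm_of_mach_wf|split=> //; exact: gsm_of_mach_det].
(* Every output node sits over an input node, and the empty input has none; a letter of [z] would
   give one. *)
move=> z acc; have /mT[X [_ /is_outputP[f [[f' _ _] _ _]]]] : m [::] z.
  by apply/mE; exists [::].
apply/eqP; rewrite -size_eq0 -leqn0 leqNgt; apply/negP => z0.
by case: (val (f' (Ordinal z0))).1.
Qed.

End NdDecompose.

Lemma ed_wgraph_inj (A : finType) (w w' : seq A) :
  iso (wgraph (@ed_lab A) (@ed_edge A) (ed_enc w)) (wgraph (@ed_lab A) (@ed_edge A) (ed_enc w'))
    ->
  w = w'.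
Proof.
move=> /wgraph_iso_val[||sz [f [fv _ fe]]]; [exact: ed_enc_edge|exact: ed_enc_edge|].
have sw : size w = size w' by move: sz; rewrite !size_ed_enc => -[].
apply: eq_from_onth => i; case: (ltnP i (size w)) => iw; last first.
  by rewrite !onth_default // -sw.
have iw1 : i < size (ed_enc w) by rewrite size_ed_enc ltnW.
have := tnth_word (Ordinal iw1); have := tnth_word (f (Ordinal iw1)).
rewrite fv !onth_ed_enc /= -sw iw => -[E'] [E].
case wE: (onth w i) (onthTE w i) => [a|]; last by rewrite iw.
have iw2 : i.+1 < size (ed_enc w) by rewrite size_ed_enc ltnS.
by move=> _; have := fe (Ordinal iw1) a iw2; rewrite /ed_edge -E -E' wE eqxx => /eqP->.
Qed.

Section EdDecompose.
Variables (A C : finType).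

Lemma comp_of_NMSO_ed (m : strans A C) : NMSO_ed m -> fcomp MREL DGSM m.
Proof.
move=> [T TE]; pose G (u : seq (option A)) := wgraph (@ed_lab A) (@ed_edge A) u.
pose H (z : seq C) := wgraph (@ed_lab C) (@ed_edge C) (ed_enc z).
have TW w h : nmso_rel T (G (ed_enc w)) h -> exists2 z, m w z & iso h (H z).
  move=> /TE[w' [z [wz [uw hz]]]]; exists z; last exact: iso_trans hz (ed_wgraph z).
  by rewrite (ed_wgraph_inj (iso_trans uw (ed_wgraph w'))).
have mT w z : m w z <-> nmso_rel T (G (ed_enc w)) (H z).
  split=> [wz|/TW[z' wz' /ed_wgraph_inj->//]].
  by apply/TE; exists w, z; split=> //; split; apply: iso_sym (ed_wgraph _).
(* A node emits the label of its edge to some output node; the last node of the output path has no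
   such edge and emits nothing. *)
pose Em (c : nC T) (a : C) : wpred (option A) := fun u nb sb =>
  exists i, i < size u /\ exists c', w_node (@ed_lab A) (@ed_edge A) 1 c' u (set_pos nb 1 i) sb /\
    w_edge (@ed_lab A) (@ed_edge A) c c' a u (set_pos nb 1 i) sb.
have Em_recog c a : recog (Em c a).
  apply: (recog_pos 1 (P := fun u nb sb => exists c', w_node (@ed_lab A) (@ed_edge A) 1 c' u nb
    sb /\
    w_edge (@ed_lab A) (@ed_edge A) c c' a u nb sb)).
  apply: recog_exists => c'; apply: recog_and; [exact: recog_node|exact: recog_edge].
have [|z i a|u X z f f_out p a|u h [w ->] /TW[z _ hz]|I [letter [M ME]]] :=
  @mach_of_nmso (option A) unit A (@ed_lab A) (@ed_edge A) unit C C (option C) (@ed_lab C)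
    (@ed_edge C)
    T (@ed_enc C) _ _ Em Em_recog _ (fun u => exists w, u = ed_enc w).
- by move=> z; rewrite size_ed_enc.
- exact: ed_enc_edge.
- have [[f' fK f'K] _ f_edge] := f_out.
  have pos2E (i j : nat) : set_pos (pos1 i) 1 j = pos2 i j.
    by apply/funext => q; apply/funext => -[|[|x]]; rewrite /set_pos /pos1 /pos2 /= ?orbF.
  have out_edge q : gE (wgraph (@ed_lab C) (@ed_edge C) (ed_enc z)) (f p) a (f q) <->
      w_edge (@ed_lab A) (@ed_edge A) (val p).2 (val q).2 a u (pos2 (val p).1 (val q).1)
        (set_valw (@ed_lab A) (@ed_edge A) (pval X)).
    rewrite f_edge /w_edge sub_pos2 sat_word (@pos_val_nv2 _ _ _ (G u) u id) //.
    by exists id.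
  have fpE : onth (ed_enc z) (f p) = Some (tnth (in_tuple (ed_enc z)) (f p)) := tnth_word _.
  split.
    move=> [j [jN [c' []]]]; rewrite pos2E.
    rewrite (w_nodeE X c' (i := Ordinal jN) (sub_pos2_1 _ _)) => jo ed_pj.
    have /andP[_ /eqP E] := (out_edge (exist _ (Ordinal jN, c') jo)).2 ed_pj.
    move: fpE; rewrite E onth_ed_enc; case: ifP => _; first by case.
    by case: ifP.
  move=> za; have fz : f p < size z by rewrite -onthTE za.
  have fz1 : (f p).+1 < size (ed_enc z) by apply: leq_trans (_ : (size z).+1 <= _); rewrite
    ?ltnS // size_ed_enc.
  pose q := f' (Ordinal fz1).
  exists (val q).1; split; first exact: ltn_ord.
  exists (val q).2; rewrite pos2E; split.
    rewrite (w_nodeE X (val q).2 (i := (val q).1) (sub_pos2_1 _ _)) -surjective_pairing.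
    exact: valP.
  apply/(out_edge q); rewrite /q f'K /= eqxx /= /ed_edge; apply/eqP.
  by move: fpE; rewrite onth_ed_enc fz za => -[].
- by exists z.
(* The left marker becomes the letter [None] that [shift] treats as the end of the tape; the right
   marker carries the annotation of the last node. *)
pose R (s : tsym A) (x : option I) : bool := match s, x with
  | LEnd, None => true
  | Sym a, Some y => letter y == Some a
  | REnd, Some y => letter y == None
  | _, _ => false
  end.
have RE w y : all2 R (mark w) y <-> exists2 v, y = None :: map Some v & map letter v = ed_enc w.
  rewrite mark_enc /=; case: y => [|[x|] y] //=; try by split=> // -[].
  transitivity (exists2 v, y = map Some v & map letter v = ed_enc w); last first.
    by split=> [[v -> E]|[v [-> E]]]; exists v.
  elim: (ed_enc w) y => [|a u IH] [|[x|] y] /=; try by split=> // -[[|? ?]].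
  - by split=> // _; exists [::].
  - have -> : R (enc_sym a) (Some x) = (letter x == a) by case: a.
    split=> [/andP[/eqP xa /IH[v -> <-]]|[[|x' v] //= [-> yv] [xa vu]]].
      by exists (x :: v); rewrite //= xa.
    by rewrite xa eqxx; apply/IH; exists v.
  - by rewrite (_ : R (enc_sym a) None = false) //; [split=> // -[[]]|case: a].
have mE : same_trans m (Defs.comp (fun w y => relab R (mark w) y) (gsm_rel (gsm_of_mach (shift
  M)))).
  move=> w z; rewrite mT -ME; last by exists w.
  split=> [[v vw acc]|[y [/RE[v -> vw] /gsm_of_machE/shiftE acc]]]; last by exists v.
  by exists (None :: map Some v); split; [apply/RE; exists v|apply/gsm_of_machE/shiftE].
exists (option I), (fun w y => relab R (mark w) y), (gsm_rel (gsm_of_mach (shift M))).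
split; [by exists R|split=> //; exists (gsm_of_mach (shift M))].
by split; [exact: gsm_of_mach_wf|split=> //; exact: gsm_of_mach_det].
Qed.

End EdDecompose.

(* NMSO_ed = MREL o DGSM  and  NMSO_nd = REL o DGSM_eps *)
Theorem theorem5p8 :
  (forall (A C : finType) (m : strans A C),
     NMSO_ed m <-> fcomp MREL DGSM m) /\
  (forall (A C : finType) (m : strans A C),
     NMSO_nd m <-> fcomp REL DGSM_eps m).
Proof.
split=> A C m; split.
- exact: comp_of_NMSO_ed.
- exact: NMSO_ed_of_comp.
- exact: comp_of_NMSO_nd.
- exact: NMSO_nd_of_comp.
Qed.
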